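(* For the decorated hypercubic lattice model described in the context with $d\ge2$, there are finite constants $c_2>0$, $c_3>0$, $\mu_1>0$ and $\mu_2<0$, depending only on $d$ (not on $L$, nor on $t,\lambda,U,U'$), such that, with $S_{\max}=N_{\rm d}/2=L^d/2$: (i) for every $\mu\ge\mu_1$, $$S_{\max}(S_{\max}+1)\ \ge\ \langle({\bf S}_{\rm tot})^2\rangle_\mu\ \ge\ S_{\max}(S_{\max}+1)\,(1-c_2e^{-\mu});$$ (ii) for every $\mu\le\mu_2$, $$\tfrac34\langle\hat N_{\rm e}\rangle_\mu\ \le\ \langle({\bf S}_{\rm tot})^2\rangle_\mu\ \le\ \tfrac34\langle\hat N_{\rm e}\rangle_\mu+c_3|V|e^{2\mu}.$$
   Context: Let $d\ge1$ and let $L\ge4$ be an even integer. Let $V=(\mathbb Z/L\mathbb Z)^d$ be the $d$-dimensional $L\times\cdots\times L$ hypercubic lattice with periodic boundary conditions, and let $B$ be the set of nearest-neighbour bonds $\{v,w\}$ ($v,w\in V$ at (periodic) Euclidean distance $1$). For each bond $\{v,w\}\in B$ introduce a new site $m(v,w)$ (the midpoint of the bond); let $M$ be the set of these midpoints and $\Lambda=V\cup M$. With fermion operators $c_{x\sigma}$, $x\in\Lambda$, $\sigma\in\{\uparrow,\downarrow\}$, satisfying the canonical anticommutation relations on the fermionic Fock space, $n_{x\sigma}=c^\dagger_{x\sigma}c_{x\sigma}$ and $\hat N_{\rm e}=\sum_x(n_{x\uparrow}+n_{x\downarrow})$, the Hamiltonian is $H=H_{\rm hop}+H_{\rm int}$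 with $$H_{\rm hop}=\sum_{\sigma}\sum_{\{v,w\}\in B}t\,(c^\dagger_{v\sigma}+c^\dagger_{w\sigma}+\lambda c^\dagger_{m(v,w)\sigma})(c_{v\sigma}+c_{w\sigma}+\lambda c_{m(v,w)\sigma}),$$ $$H_{\rm int}=U\sum_{u\in V}n_{u\uparrow}n_{u\downarrow}+U'\sum_{x\in M}n_{x\uparrow}n_{x\downarrow},$$ where $t>0$, $\lambda>0$, $U>0$, $U'>0$. Spin operators: $S^{(\alpha)}_x=\frac12\sum_{\sigma,\tau}c^\dagger_{x\sigma}p^{(\alpha)}_{\sigma\tau}c_{x\tau}$ with $p^{(\alpha)}$ the Pauli matrices, $S^{(\alpha)}_{\rm tot}=\sum_xS^{(\alpha)}_x$, $({\bf S}_{\rm tot})^2=\sum_{\alpha=1}^3(S^{(\alpha)}_{\rm tot})^2$. Let $P_0$ be the orthogonal projection (on the whole Fock space) onto the eigenspace of $H$ with eigenvalue $0$, and for an operator $O$ and $\mu\in\mathbb R$ let $$\langle O\rangle_\mu=\frac{\mathrm{Tr}[O\,e^{\mu\hat N_{\rm e}}P_0]}{\mathrm{Tr}[e^{\mu\hat N_{\rm e}}P_0]}.$$ *)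

(* Defs.v *)
From mathcomp Require Import all_boot all_order all_algebra.
From mathcomp Require Import complex.
From mathcomp Require Import reals sequences exp.
Set Implicit Arguments. Unset Strict Implicit. Unset Printing Implicit Defensive.
Import Order.TTheory GRing.Theory Num.Theory.
Local Open Scope ring_scope.

Definition site (d L : nat) := {ffun 'I_d -> 'I_L}.

Definition shift (d L : nat) (v : site d L) (j : 'I_d) : site d L :=
  [ffun k => if k == j then ordS (v k) else v k].

(* For L >= 3 (in particular L >= 4), every nearest-neighbour bond {v,w}
   is {v, shift v j} for a unique pair (v, j); we index bonds B by V x 'I_d. *)
Definition bond (d L : nat) := (site d L * 'I_d)%type.
Definition bond_fst (d L : nat) (b : bond d L) : site d L := b.1.
Definition bond_snd (d L : nat) (b : bond d L) : site d L := shift b.1 b.2.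

(* Lambda = V u M, midpoints M indexed by bonds. *)
Definition lsite (d L : nat) := (site d L + bond d L)%type.
Definition vsite (d L : nat) (v : site d L) : lsite d L := inl v.
Definition msite (d L : nat) (b : bond d L) : lsite d L := inr b.

(* fermionic modes (x, sigma); sigma = true is spin up, false spin down *)
Definition mode (d L : nat) := (lsite d L * bool)%type.

(* occupation-number basis of the fermionic Fock space *)
Definition fock (d L : nat) := {ffun mode d L -> bool}.

Definition fdim (d L : nat) : nat := #|{: fock d L}|.

Section Ops.
Variable R : realType.
Notation C := R[i].
Variables d L : nat.
Notation op := 'M[C]_(fdim d L).

Definition cfg (i : 'I_(fdim d L)) : fock d L := enum_val i.

Definition jw_sign (s : fock d L) (x : mode d L) : C :=
  (-1) ^+ #|[set y : mode d L | (enum_rank y < enum_rank x)%N && s y]|.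

Definition empty_at (s : fock d L) (x : mode d L) : fock d L :=
  [ffun y => if y == x then false else s y].

(* annihilation operator c_x (matrix acting on column vectors of
   coefficients in the occupation-number basis): c_x |s> = 0 if s x = false,
   and c_x |s> = jw_sign s x |s with x emptied> otherwise. *)
Definition ann (x : mode d L) : op :=
  \matrix_(i, j) (if cfg j x && (cfg i == empty_at (cfg j) x)
                  then jw_sign (cfg j) x else 0).

Definition adj (A : op) : op := \matrix_(i, j) (A j i)^*.

Definition cre (x : mode d L) : op := adj (ann x).

Definition num_op (x : mode d L) : op := cre x *m ann x.

Definition Ne : op := \sum_(x : lsite d L) (num_op (x, true) + num_op (x, false)).

(* e^{mu \hat N_e}: \hat N_e is diagonal in the occupation basis, with
   eigenvalue the number of occupied modes, so its exponential is diagonal. *)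
Definition expNe (mu : R) : op :=
  \matrix_(i, j) (if i == j then (expR (mu * #|[set y | cfg i y]|%:R))%:C%C else 0).

Definition bond_op (lam : R) (b : bond d L) (sg : bool) : op :=
  ann (vsite (bond_fst b), sg) + ann (vsite (bond_snd b), sg)
  + (lam%:C)%C *: ann (msite b, sg).

Definition H_hop (t lam : R) : op :=
  \sum_(sg : bool) \sum_(b : bond d L)
     (t%:C)%C *: (adj (bond_op lam b sg) *m bond_op lam b sg).

Definition H_int (U U' : R) : op :=
  (U%:C)%C *: \sum_(u : site d L) (num_op (vsite u, true) *m num_op (vsite u, false))
  + (U'%:C)%C *: \sum_(b : bond d L) (num_op (msite b, true) *m num_op (msite b, false)).

Definition Ham (t lam U U' : R) : op := H_hop t lam + H_int U U'.

(* Pauli matrices p^(1), p^(2), p^(3), indexed by 'I_3 (0,1,2);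
   spin index true = up (first row/column), false = down. *)
Definition pauli (a : 'I_3) (sg tau : bool) : C :=
  if (a : nat) == 0%N then (if sg != tau then 1 else 0)
  else if (a : nat) == 1%N then
    (if sg && ~~ tau then - 'i else if ~~ sg && tau then 'i else 0)
  else (if sg == tau then (if sg then 1 else -1) else 0).

Definition spin_op (a : 'I_3) (x : lsite d L) : op :=
  2^-1 *: \sum_(sg : bool) \sum_(tau : bool)
            (pauli a sg tau *: (cre (x, sg) *m ann (x, tau))).

Definition spin_tot (a : 'I_3) : op := \sum_(x : lsite d L) spin_op a x.

Definition spin_tot_sq : op := \sum_(a < 3) (spin_tot a *m spin_tot a).

Definition is_eigenproj (A : op) (e : C) (P : op) : Prop :=
  P *m P = P /\ adj P = P /\
  forall v : 'cV[C]_(fdim d L), (A *m v == e *: v) = (P *m v == v).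

Definition expect (P0 : op) (mu : R) (O : op) : C :=
  \tr (O *m expNe mu *m P0) / \tr (expNe mu *m P0).
End Ops.

(* Main.v *)
Require Import Defs.
From mathcomp Require Import all_boot all_order all_algebra.
From mathcomp Require Import complex.
From mathcomp Require Import reals sequences exp.
From mathcomp Require Import zify ring lra.
Set Implicit Arguments. Unset Strict Implicit. Unset Printing Implicit Defensive.

(** H is a sum of positive operators, so its kernel consists of the states
    killed by every bond operator and by every double annihilation. Such a state
    is determined by its components without electrons on the midpoints; these
    are supported on singly occupied configurations and symmetric under the
    exchange of two neighbouring spins. Hence the kernel has a basis indexed by
    a set A of occupied sites of V and a number of up spins on each cluster of A.
    By SU(2) symmetry the trace of (S_tot)^2 is three times that of (S^z)^2, and
    both parts of the theorem become statements about site percolation with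
    weight e^{mu|A|} prod_C (|C|+1), where (S_tot)^2 is replaced by
    sum_C |C|(|C|+2)/4.

    At low density, one sums over the cluster of a site. At high density, one
    runs a Peierls argument: the empty sites are grouped into units, two empty
    sites being linked when both border the same cluster C and the same component
    of the complement of C. Filling a unit D lowers the entropic factor by at
    most K^|D|: every cluster touching D except the largest one has a boundary
    component inside D, whose size controls the logarithm of that of the cluster.
    The units are counted as lattice animals for plaquette adjacency, since
    boundaries are plaquette-connected (Timar's argument) unless they wind around
    the torus. *)

(** * Clusters of a finite graph *)

(** At high density the loss in filling a single hole is unbounded: joining clusters of [a] and [b]
    sites replaces [(a+1)(b+1)] by [a+b+2]. Holes must therefore be filled together, in sets that
    contain whole separating surfaces. Linking all holes that border the same cluster [C] would
    achieve this, but holes on different sides of [C] may be far apart and could not be counted as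
    animals. Hence the restriction to one component [O] of the complement of [C]: a unit then
    contains the entire boundary of [O], and since [O] and its complement are both connected, that
    boundary is plaquette-connected up to winding. A rough isoperimetric inequality, with exponent
    [d] on the boundary, suffices, because only logarithms of cluster sizes enter. A unit that is
    not plaquette-connected has at least [L] sites, so adding the [d] coordinate lines through one
    of its sites connects it at bounded relative cost. The spin deficit counts pairs of sites
    without common cluster, each charged to a hole at one end or on a separating boundary. At low
    density [n(n+2) - 3n = n(n-1)] vanishes for isolated electrons, whence the factor [e^{2 mu}]. *)

Section Clusters.
Variables (V : finType) (e : rel V).
Hypothesis e_sym : symmetric e.
Implicit Types (A B C D O Y : {set V}) (x y z : V).

Definition within A : rel V := fun x y => [&& x \in A, y \in A & e x y].
Definition cluster A x : {set V} := [set y in A | connect (within A) x y].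
Definition clusters A : {set {set V}} := [set cluster A x | x in A].
Definition cluster_wt A : nat := \prod_(C in clusters A) #|C|.+1.
Definition touches x C := [exists c in C, e x c].
Definition bdry O : {set V} := [set x in O | touches x (~: O)].

Lemma within_sym A : connect_sym (within A).
Proof. by apply: sym_connect_sym => x y; rewrite /within e_sym andbCA. Qed.

Lemma cl_sub A x : cluster A x \subset A.
Proof. by apply/subsetP => y; rewrite inE => /andP[]. Qed.

Lemma mem_cl A x : x \in A -> x \in cluster A x.
Proof. by move=> xA; rewrite inE xA connect0. Qed.

Lemma cl_root A x y : y \in cluster A x -> x \in A.
Proof.
rewrite inE => /andP[yA /connectP[[|z p] /=]]; first by move=> _ <-.
by case/andP => /and3P[].
Qed.

Lemma cl_sym A x y : (y \in cluster A x) = (x \in cluster A y).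
Proof.
by apply/idP/idP => h; have hx := cl_root h; move: h;
  rewrite !inE within_sym hx => /andP[_ ->].
Qed.

Lemma cl_eq A x y : y \in cluster A x -> cluster A y = cluster A x.
Proof.
rewrite inE => /andP[_ xy]; apply/setP => z; rewrite !inE.
by rewrite (same_connect (within_sym A) xy).
Qed.

Lemma cl_step A x y z : y \in cluster A x -> z \in A -> e y z -> z \in cluster A x.
Proof.
rewrite !inE => /andP[yA xy] zA yz; rewrite zA /=.
by apply: connect_trans xy (connect1 _); rewrite /within yA zA.
Qed.

Lemma cl_ind A x (P : V -> Prop) :
    P x -> (forall y z, y \in cluster A x -> P y -> z \in A -> e y z -> P z) ->
  forall y, y \in cluster A x -> P y.
Proof.
move=> Px step y; rewrite inE => /andP[yA /connectP[p]].
elim/last_ind: p y yA => [y yA _ -> //|p z IH y yA].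
rewrite rcons_path last_rcons => /andP[pp /and3P[lA zA lz]] ->.
apply: (step (last x p) z) => //; last exact: IH.
by rewrite inE lA; apply/connectP; exists p.
Qed.

Lemma cl_mono A B x : A \subset B -> cluster A x \subset cluster B x.
Proof.
move=> AB; apply/subsetP => y yx; have xA := cl_root yx; move: y yx.
apply: cl_ind => [|y z _ yB zA yz]; first by rewrite mem_cl // (subsetP AB).
by apply: cl_step yB _ yz; rewrite (subsetP AB).
Qed.

Lemma adjsP x C : reflect (exists2 c, c \in C & e x c) (touches x C).
Proof. exact: 'exists_in_idP. Qed.

Lemma compsP A C : reflect (exists2 x, x \in A & C = cluster A x) (C \in clusters A).
Proof. exact: imsetP. Qed.

Lemma cl_comps A x : x \in A -> cluster A x \in clusters A.
Proof. exact: imset_f. Qed.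

Lemma comps_cl A C x : C \in clusters A -> x \in C -> C = cluster A x.
Proof. by case/compsP => y yA -> xy; rewrite (cl_eq xy). Qed.

Lemma comps_sub A C : C \in clusters A -> C \subset A.
Proof. by case/compsP => x _ ->; apply: cl_sub. Qed.

Lemma comps_n0 A C : C \in clusters A -> exists x, x \in C.
Proof. by case/compsP => x xA ->; exists x; apply: mem_cl. Qed.

Lemma comps_eq A C C' x : C \in clusters A -> C' \in clusters A -> x \in C -> x \in C' -> C = C'.
Proof. by move=> hC hC' xC xC'; rewrite (comps_cl hC xC) (comps_cl hC' xC'). Qed.

Lemma cl_idem A x : x \in A -> cluster (cluster A x) x = cluster A x.
Proof.
move=> xA; apply/eqP; rewrite eqEsubset cl_sub; apply/subsetP.
apply: cl_ind => [|y z yx yI zA yz]; first by rewrite !mem_cl.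
by apply: (cl_step yI _ yz); exact: (cl_step yx zA yz).
Qed.

(** Lets clusters survive a change of the occupied set that does not reach them, whether sites are
    removed ([wt_setD]) or added ([wt_fill]). *)
Lemma comps_stable A A' C : C \in clusters A -> C \subset A' ->
  (forall x, x \in A' -> touches x C -> x \in C) -> C \in clusters A'.
Proof.
move=> hC CA' hadj; have [x xC] := comps_n0 hC.
have xA := subsetP (comps_sub hC) _ xC.
suff -> : C = cluster A' x by rewrite cl_comps // (subsetP CA').
apply/eqP; rewrite eqEsubset; apply/andP; split.
  by rewrite (comps_cl hC xC) -(cl_idem xA) cl_mono // -(comps_cl hC xC).
apply/subsetP; apply: cl_ind => // y z _ yC zA' yz.
by apply: hadj => //; apply/adjsP; exists y => //; rewrite e_sym.
Qed.

Lemma trivIset_comps A : trivIset (clusters A).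
Proof.
apply/trivIsetP => C C' hC hC' neq; apply: contraR neq.
rewrite -setI_eq0 => /set0Pn[x /setIP[xC xC']]; apply/eqP; exact: comps_eq hC hC' xC xC'.
Qed.

Lemma cover_comps A : cover (clusters A) = A.
Proof.
apply/setP => x; apply/bigcupP/idP => [[C hC]|xA]; first exact/subsetP/comps_sub.
by exists (cluster A x); [apply: cl_comps | apply: mem_cl].
Qed.

Lemma sum_comps A (F : {set V} -> nat) :
  \sum_(C in clusters A) \sum_(x in C) F C = \sum_(x in A) F (cluster A x).
Proof.
rewrite -{2}(cover_comps A) (big_trivIset _ (trivIset_comps A)) /=.
apply: eq_bigr => C hC; apply: eq_bigr => x xC.
by rewrite -(comps_cl hC xC).
Qed.

Lemma sum_card_comps A : \sum_(C in clusters A) #|C| = #|A|.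
Proof. by rewrite -[in RHS](cover_comps A); apply/eqP; exact: trivIset_comps. Qed.

Lemma wt_gt0 A : 0 < cluster_wt A.
Proof. by apply: prodn_gt0. Qed.

(** The other clusters remain clusters of [A :\: C]; since all factors are at least 1, this
    inclusion is enough. *)
Lemma wt_setD A C : C \in clusters A -> cluster_wt A <= #|C|.+1 * cluster_wt (A :\: C).
Proof.
move=> hC; rewrite /cluster_wt (bigD1 C) //= leq_mul2l /=.
have sub : [set C' in clusters A | C' != C] \subset clusters (A :\: C).
  apply/subsetP => C'; rewrite inE => /andP[hC' neq].
  have dis x : x \in C' -> x \notin C.
    by move=> xC'; apply: contra neq => xC; apply/eqP; apply: comps_eq hC' hC xC' xC.
  apply: (comps_stable hC') => [|x].
    by apply/subsetP => x xC'; rewrite inE dis // (subsetP (comps_sub hC')).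
  rewrite inE => /andP[_ xA] /adjsP[c cC' xc].
  rewrite (comps_cl hC' cC'); apply: cl_step (mem_cl _) xA _.
    exact: subsetP (comps_sub hC') _ cC'.
  by rewrite e_sym.
rewrite (big_setID [set C' in clusters A | C' != C]) /= (setIidPr sub).
rewrite -[X in X <= _]muln1 leq_mul ?prodn_gt0 //.
by rewrite (eq_bigl (mem [set C' in clusters A | C' != C])) // => C'; rewrite !inE.
Qed.

(** * Units of empty sites *)

Definition link A : rel V := fun x y =>
  [&& x \notin A, y \notin A &
    [exists C in clusters A, [&& touches x C, touches y C & y \in cluster (~: C) x]]].
Definition unit_of A x : {set V} := [set y | connect (link A) x y].

Lemma linkP A x y :
  reflect (exists C, [/\ x \notin A, y \notin A, C \in clusters A, touches x C & touches y C /\ y \in cluster (~: C) x])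
    (link A x y).
Proof.
apply: (iffP and3P) => [[xA yA /exists_inP[C hC /and3P[xC yC xy]]]|[C [xA yA hC xC [yC xy]]]].
  by exists C; split.
by split=> //; apply/exists_inP; exists C => //; apply/and3P; split.
Qed.

Lemma link_sym A : connect_sym (link A).
Proof.
apply: sym_connect_sym => x y; apply/linkP/linkP => -[C [h1 h2 h3 h4 [h5 h6]]];
  by exists C; split=> //; split=> //; rewrite cl_sym.
Qed.

Lemma mem_unit A x : x \in unit_of A x.
Proof. by rewrite inE connect0. Qed.

Lemma unit_step A x y z : y \in unit_of A x -> link A y z -> z \in unit_of A x.
Proof. by rewrite !inE => xy yz; apply: connect_trans xy (connect1 yz). Qed.

Lemma unit_eq A x y : y \in unit_of A x -> unit_of A y = unit_of A x.
Proof.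
rewrite inE => xy; apply/setP => z; rewrite !inE.
by rewrite (same_connect (link_sym A) xy).
Qed.

Lemma unit_notin A x y : x \notin A -> y \in unit_of A x -> y \notin A.
Proof.
move=> xA; rewrite inE => /connectP[p]; elim/last_ind: p => [|p z IH]; first by move=> _ ->.
by rewrite rcons_path last_rcons => /andP[_ /and3P[_ zA _]] ->.
Qed.

Lemma adjs_notin A C x : C \in clusters A -> touches x C -> x \notin C -> x \notin A.
Proof.
move=> hC /adjsP[c cC xc]; apply: contra => xA.
rewrite (comps_cl hC cC); apply: cl_step (mem_cl _) xA _.
  exact: subsetP (comps_sub hC) _ cC.
by rewrite e_sym.
Qed.

Lemma comps_conn A C x y : C \in clusters A -> x \in C -> y \in C -> y \in cluster C x.
Proof.
move=> hC xC yC; have xA := subsetP (comps_sub hC) _ xC.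
by rewrite (comps_cl hC xC) cl_idem // -(comps_cl hC xC).
Qed.

Lemma bd_compl A C x y : C \in clusters A -> y \in bdry (cluster (~: C) x) ->
  [/\ y \in cluster (~: C) x, touches y C & y \notin A].
Proof.
move=> hC; rewrite inE => /andP[yO /adjsP[z]]; rewrite inE => zO yz.
have yC : y \notin C by move/(subsetP (cl_sub _ _)): yO; rewrite inE.
have zC : z \in C.
  apply: contraR zO => zC; apply: cl_step yO _ yz; by rewrite inE.
have ac : touches y C by apply/adjsP; exists z.
by split=> //; apply: adjs_notin ac yC.
Qed.

(* Crossing from one component of the complement of C to another one along
   a chain of links must happen at a boundary site of each of them. *)
Lemma bd_sub_unit A C x y z :
    x \notin A -> C \in clusters A -> y \in unit_of A x -> z \in unit_of A x -> touches z C ->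
  exists y0, [/\ y0 \in bdry (cluster (~: C) y) & bdry (cluster (~: C) y) \subset unit_of A x].
Proof.
move=> xA hC yD zD zC; set O := cluster _ y; set D := unit_of A x.
have nC w : w \in D -> w \in ~: C.
  move/(unit_notin xA); rewrite inE; apply: contra; exact/subsetP/comps_sub.
have yO : y \in O by apply/mem_cl/nC.
have bdin w : w \in D -> w \in O -> touches w C -> w \in bdry O.
  move=> wD wO /adjsP[c cC wc]; rewrite inE wO; apply/adjsP; exists c => //.
  by rewrite inE; apply/negP => /(subsetP (cl_sub _ _)); rewrite inE cC.
have [y0 y0D y0b] : exists2 y0, y0 \in D & y0 \in bdry O.
  have : connect (link A) y z by move: zD; rewrite -(unit_eq yD) inE.
  case/connectP => p; elim: p (y) yD yO => [|w p IH] u uD uO /=.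
    by move=> _ zu; exists u => //; apply: bdin => //; rewrite -zu.
  case/andP => uw pw zl; have wD := unit_step uD uw.
  case: (boolP (w \in O)) => [wO|wO]; first exact: IH pw zl.
  exists u => //; apply: bdin => //.
  have/linkP[C' [u1 w1 hC' uC' [wC' uwC']]] := uw.
  case: (eqVneq C' C) => [<- //|neq].
  case/negP: wO; move/adjsP: uC' => [c cC' uc]; move/adjsP: wC' => [c' c'C' wc'].
  have sub : C' \subset ~: C.
    apply/subsetP => s sC'; rewrite inE; apply: contra neq => sC.
    by apply/eqP; apply: comps_eq hC' hC sC' sC.
  have cO : c \in O by apply: cl_step uO (subsetP sub _ cC') uc.
  have c'O : c' \in O.
    rewrite /O -(cl_eq cO); apply: (subsetP (cl_mono _ sub)).
    exact: comps_conn hC' cC' c'C'.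
  by apply: cl_step c'O (nC _ wD) _; rewrite e_sym.
exists y0; split=> //; apply/subsetP => w wb.
have [wO wC wA] := bd_compl hC wb; have [y0O y0C y0A] := bd_compl hC y0b.
apply: unit_step y0D _; apply/linkP; exists C; split=> //; split=> //.
by rewrite (cl_eq y0O).
Qed.

(** * The entropic cost of filling a unit *)

Section Fill.
Variables (k Delta : nat).
Hypothesis k_gt0 : 0 < k.
Hypothesis deg : forall x, #|[set y | e x y]| <= Delta.
Hypothesis iso : forall O, minn #|O| #|~: O| <= #|bdry O| ^ k.

(** Turns polynomial isoperimetry into a fixed cost [2 ^ k] per boundary site, through
    [b.+1 <= 2 ^ b]. *)
Lemma pow_bound (n b : nat) : n <= b ^ k -> n.+1 <= 2 ^ (k * b).
Proof.
move=> h; have : n.+1 <= b.+1 ^ k.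
  apply: leq_ltn_trans h _; rewrite ltn_exp2r //.
move/leq_trans; apply; rewrite mulnC expnM leq_exp2r //.
exact: ltn_expl.
Qed.

(** Being connected and disjoint from [C], the larger cluster [C1] lies in one component [O] of the
    complement of [C]. So [O] and its complement both have at least [#|C|] sites, and isoperimetry
    applies to [bdry O], which consists of sites of the unit touching [C]. *)
Lemma cluster_bound A x C C1 :
    x \notin A -> C \in clusters A -> C1 \in clusters A -> C != C1 -> #|C| <= #|C1| ->
    (exists2 z, z \in unit_of A x & touches z C) ->
    (exists2 z, z \in unit_of A x & touches z C1) ->
  #|C|.+1 <= 2 ^ (k * #|[set y in unit_of A x | touches y C]|).
Proof.
move=> xA hC hC1 neq le [z zD zC] [y yD yC1].
have [y0 [_ sub]] := bd_sub_unit xA hC yD zD zC.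
set O := cluster (~: C) y in sub.
have dis w : w \in C1 -> w \in ~: C.
  move=> w1; rewrite inE; apply: contra neq => wC.
  by apply/eqP; apply: comps_eq hC hC1 wC w1.
have C1O : C1 \subset O.
  move/adjsP: yC1 => [c cC1 yc]; apply/subsetP => w wC1.
  have yO : y \in O.
    apply/mem_cl; have := unit_notin xA yD; rewrite inE; apply: contra; exact/subsetP/comps_sub.
  have cO : c \in O by apply: cl_step yO _ yc; apply: dis.
  rewrite /O -(cl_eq cO); apply: (subsetP (cl_mono (A := C1) _ _)); first exact/subsetP/dis.
  exact: comps_conn hC1 cC1 wC1.
have CO : C \subset ~: O by rewrite -[C]setCK setCS; apply: cl_sub.
apply: pow_bound; apply: leq_trans (_ : #|bdry O| ^ k <= _).
  apply: leq_trans (iso O); rewrite leq_min (subset_leq_card CO) andbT.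
  exact: leq_trans le (subset_leq_card C1O).
rewrite leq_exp2r //; apply: subset_leq_card; apply/subsetP => w wb.
by rewrite inE (subsetP sub) //=; case: (bd_compl hC wb).
Qed.

Lemma deg_comps A x : \sum_(C in clusters A) touches x C <= Delta.
Proof.
apply: leq_trans (deg x); apply: leq_trans (leq_imset_card (cluster A) _).
rewrite -sum1_card big_mkcond [X in _ <= X]big_mkcond /=; apply: leq_sum => C _.
case: (boolP (C \in clusters A)) => // hC; case: adjsP => // -[c cC xc].
by rewrite (comps_cl hC cC) imset_f // inE.
Qed.

(** Untouched clusters survive. The largest touched one, [C1], is paid for by the cluster [E] of the
    filled set that contains it; the others cost [2 ^ k] for each incidence with a site of the unit,
    and a site touches at most [Delta] clusters. *)
Lemma wt_fill A x : x \notin A ->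
  cluster_wt A <= 2 ^ (k * Delta * #|unit_of A x|) * cluster_wt (A :|: unit_of A x).
Proof.
move=> xA; set D := unit_of A x; pose T := [set C in clusters A | [exists z in D, touches z C]].
pose U := clusters A :\: T.
have TP C : C \in T -> C \in clusters A /\ exists2 z, z \in D & touches z C.
  by rewrite inE => /andP[-> /exists_inP].
have subU : U \subset clusters (A :|: D).
  apply/subsetP => C; rewrite !inE negb_and => /andP[h hC]; move: h; rewrite hC /= => h.
  apply: (comps_stable hC) => [|y].
    by apply: subset_trans (comps_sub hC) (subsetUl _ _).
  rewrite inE => /orP[yA ac|yD ac].
    by apply: contraLR yA; apply: adjs_notin hC ac.
  by case/negP: h; apply/exists_inP; exists y.
have -> : cluster_wt A = (\prod_(C in T) #|C|.+1) * \prod_(C in U) #|C|.+1.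
  rewrite /cluster_wt (big_setID T) /=; congr (_ * _); apply: eq_bigl => C.
  by rewrite !inE andbA andbb.
case: (set_0Vmem T) => [->|[C0 C0T]].
  rewrite big_set0 mul1n -[X in X <= _]mul1n leq_mul ?expn_gt0 //.
  rewrite /cluster_wt [X in _ <= X](big_setID U) /= (setIidPr subU) -[X in X <= _]muln1 leq_mul //.
  exact: prodn_gt0.
have [C1 C1T C1max] := arg_maxnP (fun C : {set V} => #|C|) C0T.
have [hC1 [y yD yC1]] := TP _ C1T.
have [c cC1 yc] := adjsP _ _ yC1.
have cA : c \in A by apply: subsetP (comps_sub hC1) _ cC1.
pose E := cluster (A :|: D) c.
have C1E : C1 \subset E by rewrite (comps_cl hC1 cC1) cl_mono // subsetUl.
have hE : E \in clusters (A :|: D) by apply: cl_comps; rewrite inE cA.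
(* [E] contains the site [y] of the unit, so its factor is not already used by a surviving
   cluster. *)
have EU : E \notin U.
  apply/negP => EU; have := hE; move: EU; rewrite !inE => /andP[_ hE'] _.
  have := subsetP (comps_sub hE') y; rewrite (negPf (unit_notin xA yD)) => /(_ _)/notF; apply.
  apply: cl_step (mem_cl _) _ _; first by rewrite inE cA.
  - by rewrite inE yD orbT.
  by rewrite e_sym.
rewrite (bigD1 C1) //= -mulnA mulnCA.
apply: leq_mul.
  apply: leq_trans (_ : \prod_(C in T | C != C1) 2 ^ (k * #|[set z in D | touches z C]|) <= _).
    apply: leq_prod => C /andP[CT neq]; have [hC exC] := TP _ CT.
    by apply: cluster_bound hC1 neq _ _ _ => //; [apply: C1max | exists y].
  rewrite -expn_sum leq_exp2l // -big_distrr /= -mulnA leq_mul2l; apply/orP; right.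
  apply: leq_trans (_ : \sum_(C in clusters A) \sum_(z in D) touches z C <= _).
    rewrite [X in _ <= X](big_setID T) /=; apply: leq_trans (leq_addr _ _).
    have -> : clusters A :&: T = T by apply/setP => C; rewrite !inE andbA andbb.
    rewrite [X in _ <= X](bigD1 C1) //=; apply: leq_trans (leq_addl _ _).
    apply: leq_sum => C _; rewrite -sum1_card [X in X <= _]big_mkcond [X in _ <= X]big_mkcond.
    by apply: leq_sum => z _; rewrite !inE; case: (connect _ _ _); case: touches.
  rewrite exchange_big /= mulnC -sum_nat_const; apply: leq_sum => z _; exact: deg_comps.
rewrite /cluster_wt [X in _ <= X](bigD1 E) //=; apply: leq_mul; first by rewrite ltnS subset_leq_card.
apply: leq_trans (_ : \prod_(C in clusters (A :|: D) | (C != E) && (C \in U)) #|C|.+1 <= _).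
  rewrite [X in X <= _](eq_bigl (fun C => [&& C \in clusters (A :|: D), C != E & C \in U])) // => C.
  case CU: (C \in U); rewrite ?andbF // (subsetP subU _ CU) andbT.
  by case: eqP CU => // ->; rewrite (negPf EU).
rewrite [X in _ <= X](bigID [pred C | C \in U]) /= -[X in X <= _]muln1 leq_mul ?prodn_gt0 //.
by rewrite [X in X <= _](eq_bigl (fun C => (C \in clusters (A :|: D)) && (C != E) && (C \in U))) // => C; rewrite andbA.
Qed.
End Fill.

(* A cluster of n sites carries spin S = n/2, and n(n+2) = 4S(S+1). *)
Definition spin_sq4 A : nat := \sum_(C in clusters A) #|C| * #|C|.+2.

Lemma exit_edge (S : {set V}) x y : connect e x y -> x \in S -> y \notin S ->
  exists a b, [/\ a \in S, b \notin S & e a b].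
Proof.
case/connectP => p; elim: p x => [|z p IH] x /=; first by move=> _ -> ->.
case/andP => xz pz yl xS yS; case: (boolP (z \in S)) => zS; first exact: IH pz yl zS yS.
by exists x, z.
Qed.

Lemma card_bigcup_le (I T : finType) (P : pred I) (F : I -> {set T}) :
  #|\bigcup_(i | P i) F i| <= \sum_(i | P i) #|F i|.
Proof.
elim/big_rec2: _ => [|i n S _ le]; first by rewrite cards0.
by apply: leq_trans (leq_card_setU _ _) _; rewrite leq_add2l.
Qed.

(** * The spin deficit as a number of separated pairs *)

Section Deficit.
Variables (k Delta : nat).
Hypothesis k_gt0 : 0 < k.
Hypothesis deg : forall x, #|[set y | e x y]| <= Delta.
Hypothesis iso : forall O, minn #|O| #|~: O| <= #|bdry O| ^ k.
Hypothesis conn : forall x y, connect e x y.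

(** The smaller side is controlled by the boundary of the component, which lies in the unit of [x];
    the larger one is at most [#|V|]. *)
Lemma cut_card A x c : x \notin A -> c \in A -> e x c ->
  #|~: cluster (~: cluster A c) x| * #|cluster (~: cluster A c) x| <= #|V| * #|unit_of A x| ^ k.
Proof.
move=> xA cA xc; set O := cluster _ _.
have hC := cl_comps cA.
have xC : touches x (cluster A c) by apply/adjsP; exists c => //; apply: mem_cl.
have [_ [_ sub]] := bd_sub_unit xA hC (mem_unit A x) (mem_unit A x) xC.
have : minn #|O| #|~: O| <= #|unit_of A x| ^ k.
  by apply: leq_trans (iso O) _; rewrite leq_exp2r // subset_leq_card.
rewrite /minn; case: ifP => _ h; last rewrite mulnC;
  by apply: leq_mul h; apply: max_card.
Qed.

(** [spin_sq4 A] is the number of pairs [Q] in a common cluster plus [2 * #|A|]. A pair outside [Q]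
    has an empty end or lies in two clusters; then a path from [w] to [v] leaves the component of
    [w] in the complement of the cluster of [v] at an empty site [x], and [R] collects the pairs
    charged to such [x]. *)
Lemma deficit A :
  #|V| * #|V|.+2 <=
  spin_sq4 A + #|V| * (4 + Delta) * \sum_(x in ~: A) #|unit_of A x| ^ k.
Proof.
pose Q := [set p : V * V | p.2 \in cluster A p.1].
pose R := \bigcup_(x in ~: A) \bigcup_(c in [set c in A | e x c])
  setX (~: cluster (~: cluster A c) x) (cluster (~: cluster A c) x).
have cQ : #|Q| = \sum_(C in clusters A) #|C| * #|C|.
  transitivity (\sum_(C in clusters A) \sum_(x in C) #|C|); last first.
    by apply: eq_bigr => C _; rewrite sum_nat_const.
  rewrite (sum_comps A (fun C => #|C|)) -sum1_card.
  rewrite (eq_bigl (fun p : V * V => true && (p.2 \in cluster A p.1))); last by move=> p; rewrite inE.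
  rewrite -(pair_big_dep xpredT (fun x y => y \in cluster A x) (fun _ _ => 1)) /=.
  rewrite (bigID (mem A)) /= addnC big1 ?add0n => [|x xA].
    by apply: eq_bigr => x _; rewrite sum1_card.
  by rewrite big1 // => y /cl_root xA'; rewrite xA' in xA.
have sub : ~: Q \subset setX (~: A) setT :|: setX setT (~: A) :|: R.
  apply/subsetP => -[v w]; rewrite !inE /= andbT.
  case: (boolP (v \in A)) => //= vA; case: (boolP (w \in A)) => //= wA nvw.
  have wO : w \in cluster (~: cluster A v) w.
    by apply: mem_cl; rewrite inE; move: nvw; rewrite inE wA.
  have vO : v \notin cluster (~: cluster A v) w.
    by apply/negP => /(subsetP (cl_sub _ _)); rewrite inE mem_cl.
  have [x [c [xO cO xc]]] := exit_edge (conn w v) wO vO.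
  have hC := cl_comps vA.
  have cC : c \in cluster A v.
    apply: contraR cO => cC; apply: cl_step xO _ xc; by rewrite inE.
  have xb : x \in bdry (cluster (~: cluster A v) w).
    by rewrite inE xO; apply/adjsP; exists c => //; rewrite inE.
  have [_ _ xA] := bd_compl hC xb.
  apply/bigcupP; exists x; first by rewrite inE.
  apply/bigcupP; exists c; first by rewrite inE xc andbT (subsetP (cl_sub _ _) _ cC).
  by rewrite inE /= (cl_eq cC) (cl_eq xO) inE vO.
have cR : #|R| <= \sum_(x in ~: A) Delta * (#|V| * #|unit_of A x| ^ k).
  apply: leq_trans (card_bigcup_le _ _) _; apply: leq_sum => x; rewrite inE => xA.
  apply: leq_trans (card_bigcup_le _ _) _.
  apply: leq_trans (_ : \sum_(c in [set c in A | e x c]) #|V| * #|unit_of A x| ^ k <= _).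
    apply: leq_sum => c; rewrite inE => /andP[cA xc]; rewrite cardsX; exact: cut_card.
  rewrite sum_nat_const leq_mul2r; apply/orP; right; apply: leq_trans (deg x).
  by apply: subset_leq_card; apply/subsetP => c; rewrite !inE => /andP[_ ->].
have cA' : #|~: A| <= \sum_(x in ~: A) #|unit_of A x| ^ k.
  rewrite -sum1_card; apply: leq_sum => x _.
  by rewrite expn_gt0; apply/orP; left; apply/card_gt0P; exists x; apply: mem_unit.
have e1 : #|Q| + #|~: Q| = #|V| * #|V| by rewrite cardsC card_prod.
have e2 : #|A| + #|~: A| = #|V| by rewrite cardsC.
have e3 : spin_sq4 A = #|Q| + 2 * #|A|.
  rewrite /spin_sq4 cQ -(sum_card_comps A) big_distrr -big_split /=; apply: eq_bigr => C _; lia.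
have e4 : #|~: Q| <= 2 * (#|~: A| * #|V|) + #|R|.
  apply: leq_trans (subset_leq_card sub) _.
  apply: leq_trans (leq_card_setU _ _) _; rewrite leq_add2r.
  apply: leq_trans (leq_card_setU _ _) _; rewrite !cardsX !cardsT; lia.
move: cR; rewrite -big_distrr /= -big_distrr /=.
move: cA'; set S := \sum_(x in _) _ => cA' cR.
case: (posnP #|V|) => [->|V0]; first by rewrite mul0n.
have h1 : #|~: A| * #|V| <= #|V| * S by rewrite mulnC leq_mul2l cA' orbT.
have h2 : #|~: A| <= #|V| * S by apply: leq_trans cA' _; rewrite leq_pmull.
have -> : #|V| * (4 + Delta) * S = 4 * (#|V| * S) + Delta * (#|V| * S) by rewrite -mulnDl mulnCA mulnA.
have -> : #|V| * #|V|.+2 = #|V| * #|V| + 2 * #|V| by lia.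
move: e4 e3 e2 e1 cR h1 h2 cA'; clear.
move: (spin_sq4 A) #|Q| #|~: Q| #|R| #|~: A| #|A| #|V| S => x q q1 r b a v S. clear. move: (Delta * _) => y; nia.

Qed.
End Deficit.

(** * Lattice animals *)

Definition connected_at x Y := (x \in Y) && (cluster Y x == Y).

(* A connected set is swept by a closed-up walk that makes a two-step
   excursion each time it discovers a new site. *)
Lemma sweeping_walk x Y : connected_at x Y ->
  exists p, [/\ path e x p, size p = (#|Y|.-1).*2 & Y = [set y in x :: p]].
Proof.
move=> /andP[xY /eqP cY].
suff H : forall m, m < #|Y| -> exists p, [/\ path e x p, size p = m.*2,
    [set y in x :: p] \subset Y & #|[set y in x :: p]| = m.+1].
  have Y0 : 0 < #|Y| by apply/card_gt0P; exists x.
  have [|p [pp sp sub cp]] := H #|Y|.-1; first by rewrite prednK.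
  exists p; split=> //; apply/eqP; rewrite eq_sym eqEcard sub cp prednK //=; apply: leqnn.
elim=> [_|m IH mY].
  exists [::]; split=> //; first by apply/subsetP => y; rewrite !inE => /eqP->.
  by rewrite set_seq1 cards1.
have [p [pp sp sub cp]] := IH (ltnW mY).
pose K := [set y in x :: p].
have [z zY zK] : exists2 z, z \in Y & z \notin K.
  have : #|Y :\: K| > 0 by rewrite cardsD (setIidPr sub) subn_gt0 cp.
  by case/card_gt0P => z; rewrite !inE => /andP[zK zY]; exists z; rewrite ?inE.
have xK : x \in K by rewrite !inE eqxx.
have : connect (within Y) x z by move: zY; rewrite -{1}cY inE => /andP[].
have [u [w [uK wK /and3P[uY wY uw]]]] : exists u w, [/\ u \in K, w \notin K & within Y u w].
  move: zY; rewrite -{1}cY inE => /andP[_ /connectP[q]].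
  elim: q (x) xK => [|w q IHq] u uK /=; first by move=> _ zu; rewrite zu uK in zK.
  case/andP => uw wq zl; case: (boolP (w \in K)) => wK; first exact: IHq wK wq zl.
  by exists u, w.
have up : u \in x :: p by move: uK; rewrite inE.
have : [/\ path e x p, size p = m.*2 & [set y in x :: p] = K] by [].
case/splitPl: up => p1 p2 lu [{}pp {}sp eK].
exists (p1 ++ w :: u :: p2).
have eqK : [set y in x :: p1 ++ w :: u :: p2] = w |: K.
  rewrite -eK; apply/setP => y; rewrite !inE !mem_cat !inE.
  have : (y == u) -> (y == x) || (y \in p1).
    by move/eqP->; rewrite -lu -in_cons mem_last.
  case: (y == u); case: (y == x); case: (y \in p1) => //=; rewrite ?orbT //;
   by move/(_ isT).
split.
- move: pp; rewrite !cat_path /= lu => /andP[-> ->].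
  by rewrite uw e_sym uw.
- by rewrite size_cat /= doubleS -sp size_cat !addnS.
- by rewrite eqK subUset sub1set wY.
- by rewrite eqK cardsU1 wK cp.
Qed.

Section Animals.
Variable Delta : nat.
Hypothesis deg : forall x, #|[set y | e x y]| <= Delta.

Lemma card_paths x n : #|[set p : n.-tuple V | path e x p]| <= Delta ^ n.
Proof.
elim: n x => [|n IH] x.
  by apply: leq_trans (max_card _) _; rewrite card_tuple expn0.
have -> : [set p : n.+1.-tuple V | path e x p] =
    \bigcup_(y in [set y | e x y]) [set cons_tuple y p | p in [set p : n.-tuple V | path e y p]].
  apply/setP => p; rewrite inE; apply/idP/bigcupP => [|[y]].
    case: p => -[|y p] //= szp /andP[xy yp]; exists y; rewrite ?inE //.
    by apply/imsetP; exists (Tuple (szp : size p == n)); rewrite ?inE //; apply: val_inj.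
  by rewrite inE => xy /imsetP[q]; rewrite inE => yq -> /=; rewrite xy.
apply: leq_trans (card_bigcup_le _ _) _.
apply: leq_trans (_ : \sum_(y in [set y | e x y]) Delta ^ n <= _).
  by apply: leq_sum => y _; apply: leq_trans (leq_imset_card _ _) (IH y).
by rewrite sum_nat_const expnS leq_mul2r deg orbT.
Qed.

Lemma card_animals x n :
  #|[set Y | connected_at x Y && (#|Y| == n.+1)]| <= Delta ^ n.*2.
Proof.
apply: leq_trans (card_paths x n.*2).
apply: leq_trans (leq_imset_card (fun p : n.*2.-tuple V => [set y in x :: p]) _).
apply: subset_leq_card; apply/subsetP => Y; rewrite inE => /andP[cY /eqP sY].
have [p [pp sp eY]] := sweeping_walk cY; move: sp; rewrite sY => /eqP sp.
by apply/imsetP; exists (Tuple sp) => //; rewrite inE.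
Qed.
End Animals.
End Clusters.

(** * The discrete torus *)

Section Torus.
Variables (d L : nat).
Notation V := (site d L).
Implicit Types (v w x y u : V) (i : 'I_L) (j k : 'I_d) (O K D : {set V}).

Definition upd v j i : V := [ffun k => if k == j then i else v k].

Lemma updE v j i k : upd v j i k = if k == j then i else v k.
Proof. by rewrite ffunE. Qed.

Lemma shiftE v j k : shift v j k = if k == j then ordS (v k) else v k.
Proof. by rewrite ffunE. Qed.

Lemma shift_upd v j i : shift (upd v j i) j = upd v j (ordS i).
Proof. by apply/ffunP => k; rewrite shiftE !updE; case: eqP. Qed.

Lemma upd_shift v j k i : j != k -> upd (shift v j) k i = shift (upd v k i) j.
Proof.
move=> jk; apply/ffunP => l; rewrite shiftE !updE shiftE.
by case: (eqVneq l k) => [->|//]; rewrite eq_sym (negPf jk).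
Qed.

Lemma upd_shift_same v j i : upd (shift v j) j i = upd v j i.
Proof. by apply/ffunP => l; rewrite !updE shiftE; case: eqP. Qed.

Lemma upd_id v j : upd v j (v j) = v.
Proof. by apply/ffunP => l; rewrite updE; case: eqP => [->|]. Qed.

Lemma shiftC v j k : shift (shift v j) k = shift (shift v k) j.
Proof.
by apply/ffunP => l; rewrite !shiftE; case: (l == k); case: (l == j).
Qed.

Lemma shift_inj j : injective (fun v => shift v j).
Proof.
move=> v w /ffunP h; apply/ffunP => l; have := h l; rewrite !shiftE.
by case: eqP => // _; apply: ordS_inj.
Qed.

Lemma ordS_const (T : Type) (h : 'I_L -> T) :
  (forall i, h (ordS i) = h i) -> forall i i', h i = h i'.
Proof.
move=> hS; have H n (lt : n < L) (lt0 : 0 < L) : h (Ordinal lt) = h (Ordinal lt0).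
  elim: n lt => [|n IH] lt; first by congr h; apply: val_inj.
  rewrite -(IH (ltnW lt)) -[RHS]hS; congr h; apply: val_inj => /=.
  by rewrite modn_small.
move=> i i'; have L0 : 0 < L by apply: leq_ltn_trans (ltn_ord i).
by case: i i' => n nL [n' n'L]; rewrite (H _ nL L0) (H _ n'L L0).
Qed.

(** [P] confines the moves to a slice in [clean_slice], where one direction is missing from [J]. *)
Lemma subtorus_const (T : Type) (h : V -> T) (P : pred V) (J : {set 'I_d}) :
  (forall v j, j \in J -> P v -> P (shift v j) /\ h (shift v j) = h v) ->
  forall v w, P v -> (forall j, j \notin J -> v j = w j) -> h v = h w.
Proof.
move=> step v w Pv vw.
have line u j i : j \in J -> P u -> P (upd u j i) /\ h (upd u j i) = h u.
  move=> jJ Pu; have L0 : 0 < L by apply: leq_ltn_trans (ltn_ord i).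
  have Hn n : P (upd u j (iter n (@ordS L) (u j))) /\ h (upd u j (iter n (@ordS L) (u j))) = h u.
    elim: n => [|n [IH1 IH2]] /=; first by rewrite upd_id.
    rewrite -shift_upd; have [h1 h2] := step _ _ jJ IH1; by rewrite h2.
  have it n : val (iter n (@ordS L) (u j)) = (u j + n) %% L.
    elim: n => [|n IH] /=; first by rewrite addn0 modn_small.
    by rewrite IH -addn1 modnDml addn1 addnS.
  (* Modulo [L], this number of unit steps leads from [u j] to [i]. *)
  have := Hn (L - u j + i); congr (P (upd u j _) /\ h (upd u j _) = _);
  by apply: val_inj; rewrite it addnA subnKC ?modnDl ?modn_small // ltnW.
pose mix (s : seq 'I_d) : V := [ffun j => if j \in s then w j else v j].
have H s : {subset s <= J} -> P (mix s) /\ h (mix s) = h v.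
  elim: s => [|j s IH] sJ.
    by have -> : mix [::] = v by apply/ffunP => l; rewrite ffunE.
  have [|h1 h2] := IH; first by move=> l ls; apply: sJ; rewrite inE ls orbT.
  have -> : mix (j :: s) = upd (mix s) j (w j).
    by apply/ffunP => l; rewrite updE !ffunE inE; case: eqP => [->|].
  rewrite -h2; apply: line => //; by apply: sJ; rewrite inE eqxx.
have [|_ <-] := H (enum J); first by move=> j; rewrite mem_enum.
congr h; apply/ffunP => l; rewrite ffunE mem_enum; case: ifP => // lJ.
by apply: vw; rewrite lJ.
Qed.

(* Z/2-valued cochains on the edges (v, shift v j). *)
Section Gauge.
Implicit Types f : V -> 'I_d -> bool.

Definition closed f := forall v j k,
  f v j (+) f (shift v j) k = f v k (+) f (shift v k) j.
(** The holonomy around the closed line through [v] in direction [j]. For a closed cochain these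
    numbers determine its class in the first cohomology of the torus. *)
Definition hol f v j := \big[addb/false]_(i < L) f (upd v j i) j.
Definition flat f := closed f /\ forall v j, hol f v j = false.

(** Closedness is summed over the ladder of plaquettes between two parallel lines; each rung occurs
    twice and cancels. *)
Lemma hol_shift f v j k : closed f -> hol f (shift v k) j = hol f v j.
Proof.
move=> cf; rewrite /hol; case: (eqVneq k j) => [->|kj].
  by apply: eq_bigr => i _; rewrite upd_shift_same.
have -> : \big[addb/false]_(i < L) f (upd (shift v k) j i) j =
   \big[addb/false]_(i < L) (f (upd v j i) j (+) (f (upd v j i) k (+) f (upd v j (ordS i)) k)).
  apply: eq_bigr => i _; rewrite upd_shift // -shift_upd.
  have := cf (upd v j i) j k.
  by do 4!case: (f _ _).
rewrite !big_split /= [X in _ (+) (_ (+) X)](_ : _ = \big[addb/false]_(i < L) f (upd v j i) k).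
  by rewrite addbb addbF.
by rewrite [RHS](reindex (@ordS L)) //=; apply: onW_bij; exact: ordS_bij.
Qed.

Lemma hol_const f v w j : closed f -> hol f v j = hol f w j.
Proof.
move=> cf; apply: (subtorus_const (h := fun v => hol f v j) (P := xpredT) (J := setT)) => //.
- by move=> u k _ _; split => //; apply: hol_shift.
- by move=> k; rewrite inE.
Qed.

Definition cob (g : V -> bool) v j := g v (+) g (shift v j).

Lemma flat_cob g : flat (cob g).
Proof.
split=> [v j k|v j]; rewrite /cob.
  by rewrite (shiftC v k j); do 4!case: (g _).
rewrite /hol; have -> : \big[addb/false]_(i < L) (g (upd v j i) (+) g (shift (upd v j i) j)) =
  \big[addb/false]_(i < L) (g (upd v j i)) (+) \big[addb/false]_(i < L) (g (upd v j (ordS i))).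
  by rewrite -big_split; apply: eq_bigr => i _; rewrite shift_upd.
rewrite [X in X (+) _](reindex (@ordS L)) ?addbb //=.
by apply: onW_bij; exact: ordS_bij.
Qed.

Lemma flatD f f' : flat f -> flat f' -> flat (fun v j => f v j (+) f' v j).
Proof.
move=> [c h] [c' h']; split=> [v j k|v j].
  by rewrite addbACA c c' addbACA.
by rewrite /hol big_split /= -/(hol f v j) -/(hol f' v j) h h'.
Qed.

(** Integration one direction at a time. Once [f'] vanishes in the directions of [J], it is
    integrated along [k] from coordinate 0; by closedness the primitive [g'] is invariant in the
    directions of [J], so nothing already achieved is lost. *)
Lemma flat_exact_on f (J : seq 'I_d) : flat f ->
  exists g, forall v j, j \in J -> f v j = cob g v j.
Proof.
elim: J => [|k J IH] ff; first by exists xpredT.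
have [g gE] := IH ff.
pose f' v j := f v j (+) cob g v j.
have [cf' hf'] : flat f' by apply: flatD => //; apply: flat_cob.
have f'0 v j : j \in J -> f' v j = false by move=> jJ; rewrite /f' gE // addbb.
pose g' v := \big[addb/false]_(i < L | i < v k) f' (upd v k i) k.
have g'k v : cob g' v k = f' v k.
  rewrite /cob /g' shiftE eqxx.
  under [X in _ (+) X]eq_bigr => i _ do rewrite upd_shift_same.
  case: (ltnP (v k).+1 L) => vL.
    rewrite [X in _ (+) X](bigD1 (v k)) /=; last by rewrite modn_small.
    rewrite upd_id addbC -addbA [X in _ (+) X](_ : _ = false) ?addbF // -[RHS](addbb (\big[addb/false]_(i < L | i < v k) f' (upd v k i) k)).
    congr (_ (+) _); apply: eq_bigl => i; rewrite modn_small // ltnS.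
    by rewrite ltn_neqAle andbC.
  (* On the edge that wraps around to coordinate 0, the vanishing holonomy closes the
     integration. *)
  have vE : (v k).+1 = L by apply/eqP; rewrite eqn_leq vL ltn_ord.
  rewrite [X in _ (+) X]big_pred0 ?addbF => [|i]; last by rewrite /= vE modnn.
  have := hf' v k; rewrite /hol (bigD1 (v k)) //= upd_id.
  rewrite (eq_bigl (fun i : 'I_L => i < v k)) => [|i].
    by move/(congr1 (addb (f' v k))); rewrite addKb addbF.
  by rewrite ltn_neqAle andbC -ltnS vE ltn_ord.
have g'J v j : j \in J -> j != k -> cob g' v j = false.
  move=> jJ jk; rewrite /cob /g' shiftE [k == j]eq_sym (negPf jk) -big_split big1 //= => i _.
  rewrite upd_shift //; have := cf' (upd v k i) k j; rewrite !(f'0 _ _ jJ) addbF /= => ->.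
  by rewrite addbb.
exists (fun v => g v (+) g' v) => v j; rewrite inE.
have -> : cob (fun v => g v (+) g' v) v j = cob g v j (+) cob g' v j.
  by rewrite /cob addbACA.
case: (eqVneq j k) => [->|jk] /= jJ; last by rewrite g'J // addbF gE.
by rewrite g'k /f' addbCA addbb addbF.
Qed.

Lemma flat_exact f : flat f -> exists g, forall v j, f v j = cob g v j.
Proof.
move=> ff; have [g gE] := flat_exact_on (enum 'I_d) ff.
by exists g => v j; rewrite gE // mem_enum.
Qed.
End Gauge.

(** * Nearest-neighbour and plaquette adjacency *)

Definition nearest : rel V := fun v w => [exists j, (w == shift v j) || (v == shift w j)].
(** The case [j = k] gives a degenerate plaquette of collinear sites; it only enlarges [star] and
    makes [star_shift] immediate. *)
Definition plaq u j k : seq V := [:: u; shift u j; shift u k; shift (shift u j) k].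
Definition star : rel V := fun x y =>
  [exists u, exists j, exists k, (x \in plaq u j k) && (y \in plaq u j k)].

Lemma nn_sym : symmetric nearest.
Proof. by move=> v w; apply/existsP/existsP => -[j h]; exists j; rewrite orbC. Qed.

Lemma nn_shift v j : nearest v (shift v j).
Proof. by apply/existsP; exists j; rewrite eqxx. Qed.

Lemma starP x y :
  reflect (exists u j k, x \in plaq u j k /\ y \in plaq u j k) (star x y).
Proof.
apply: (iffP existsP) => [[u /existsP[j /existsP[k /andP[xp yp]]]]|[u [j [k [xp yp]]]]].
  by exists u, j, k.
by exists u; apply/existsP; exists j; apply/existsP; exists k; rewrite xp.
Qed.

Lemma star_sym : symmetric star.
Proof. by move=> x y; apply/starP/starP => -[u [j [k [h h']]]]; exists u, j, k. Qed.

Lemma star_shift v j : star v (shift v j).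
Proof. by apply/starP; exists v, j, j; rewrite !inE !eqxx orbT. Qed.

Lemma nn_connect v w : connect nearest v w.
Proof.
have -> : connect nearest v w = connect nearest v v; last exact: connect0.
apply: (subtorus_const (h := connect nearest v) (P := xpredT) (J := setT)) => [u j _ _|//|j]; last by rewrite inE.
split=> //; apply/esym/same_connect1r; last exact: nn_shift.
exact: sym_connect_sym nn_sym.
Qed.

Lemma nn_deg v : #|[set w | nearest v w]| <= d.*2.
Proof.
pose F (p : 'I_d * bool) := if p.2 then shift v p.1 else odflt v [pick w | v == shift w p.1].
have -> : d.*2 = #|[set: 'I_d * bool]| by rewrite cardsT card_prod card_ord card_bool muln2.
apply: leq_trans (leq_imset_card F _); apply: subset_leq_card.
apply/subsetP => w; rewrite inE => /existsP[j /orP[/eqP->|/eqP vw]]; apply/imsetP.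
  by exists (j, true).
exists (j, false) => //; rewrite /F /=; case: pickP => [u /eqP|/(_ w)].
  by rewrite vw => /shift_inj.
by rewrite vw eqxx.
Qed.

Lemma plaq_inj x u u' j k (a : nat) : a < 4 ->
  nth x (plaq u j k) a = nth x (plaq u' j k) a -> u = u'.
Proof.
case: a => [|[|[|[|//]]]] _ /=; [by []|exact: shift_inj..|].
by move=> h; apply: (shift_inj (j := j)); apply: (shift_inj (j := k)).
Qed.

(** There are [d ^ 2] choices of [(j, k)] and 16 choices of the corners occupied by [x] and [y]. *)
Lemma star_deg x : #|[set y | star x y]| <= 16 * d ^ 2.
Proof.
pose F (p : ('I_d * 'I_d) * ('I_4 * 'I_4)) :=
  let: ((j, k), (a, b)) := p in
  nth x (plaq (odflt x [pick u | x == nth x (plaq u j k) a]) j k) b.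
have -> : 16 * d ^ 2 = #|[set: ('I_d * 'I_d) * ('I_4 * 'I_4)]|.
  by rewrite cardsT !card_prod !card_ord; lia.
apply: leq_trans (leq_imset_card F _); apply: subset_leq_card.
apply/subsetP => y; rewrite inE => /starP[u [j [k [xp yp]]]]; apply/imsetP.
move: (xp) (yp) => /(nthP x)[a la xa] /(nthP x)[b lb yb].
exists ((j, k), (Ordinal la, Ordinal lb)) => //; rewrite /F /=.
case: pickP => [u' /eqP /=|/(_ u)]; last by rewrite /= xa eqxx.
by rewrite -{1}xa => /(plaq_inj la) <-; rewrite yb.
Qed.

Lemma edge_bd O v w : nearest v w -> v \in O -> w \notin O -> v \in bdry nearest O.
Proof. by move=> vw vO wO; rewrite inE vO; apply/adjsP; exists w; rewrite ?inE. Qed.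

Lemma line_const O v j : (forall i, upd v j i \notin bdry nearest O) ->
  forall i i', (upd v j i \in O) = (upd v j i' \in O).
Proof.
move=> h; apply: ordS_const => i.
have e : nearest (upd v j i) (upd v j (ordS i)) by rewrite -shift_upd nn_shift.
apply/idP/idP => [h1|h1]; apply: contraT => h2.
  by have := h (ordS i); rewrite (edge_bd _ h1 h2) // nn_sym.
by have := h i; rewrite (edge_bd e h1 h2).
Qed.

Lemma mixed_line O v w j : w = upd v j (w j) -> (v \in O) != (w \in O) ->
  exists i, upd v j i \in bdry nearest O.
Proof.
move=> wE neq; apply/existsP; apply: contraR neq => /existsPn h.
by have := line_const h (v j) (w j); rewrite upd_id -wE => ->.
Qed.

(** Fewer than [L] boundary sites miss one of the [L] slices orthogonal to [j], and a connected
    slice without boundary sites is entirely inside or outside [O]. *)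
Lemma clean_slice O j : #|bdry nearest O| < L ->
  exists i, forall v w, v j = i -> w j = i -> (v \in O) = (w \in O).
Proof.
move=> bL; have [i iP] : exists i, i \notin [set (v : V) j | v in bdry nearest O].
  apply/existsP; apply: contraLR bL => /existsPn h; rewrite -leqNgt.
  rewrite -[X in X <= _](card_ord L) -cardsT; apply: leq_trans (leq_imset_card (fun v : V => v j) _).
  by apply: subset_leq_card; apply/subsetP => i _; have := h i; rewrite negbK.
exists i => v w vi wi.
apply: (subtorus_const (h := fun u => u \in O) (P := fun u => u j == i) (J := [set~ j])).
- move=> u k; rewrite !inE => kj /eqP ui; split.
    by rewrite shiftE [j == k]eq_sym (negPf kj) ui.
  have nb u' : u' j = i -> u' \notin bdry nearest O.
    by move=> u'i; apply: contra iP => u'b; apply/imsetP; exists u'.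
  have si : shift u k j = i by rewrite shiftE [j == k]eq_sym (negPf kj).
  have e := nn_shift u k.
  apply/idP/idP => [h1|h1]; apply: contraT => h2.
    by have := nb _ si; rewrite (edge_bd _ h1 h2) // nn_sym.
  by have := nb _ ui; rewrite (edge_bd e h1 h2).
- by rewrite vi.
by move=> k; rewrite !inE negbK => /eqP ->; rewrite vi wi.
Qed.

Hypothesis d_ge2 : 2 <= d.

Lemma card_site : #|{: V}| = L ^ d.
Proof. by rewrite card_ffun !card_ord. Qed.

(** With [b >= L] boundary sites, [b ^ d] is at least the volume. Otherwise there are clean slices
    in two directions; they intersect, hence share one colour [c]. Both lines through a site of the
    other colour, in these directions, run into a clean slice and so contain boundary sites; these
    two boundary sites determine the site, whence the bound [b ^ 2]. *)
Lemma nn_iso O : minn #|O| #|~: O| <= #|bdry nearest O| ^ d.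
Proof.
set b := #|bdry nearest O|; case: (leqP L b) => [Lb|bL].
  apply: leq_trans (geq_minl _ _) _; apply: leq_trans (max_card _) _.
  by rewrite card_site leq_exp2r // (leq_trans _ d_ge2).
pose j0 := Ordinal (leq_trans (isT : 0 < 2) d_ge2); pose j1 := Ordinal (d_ge2 : 1 < d).
have j01 : j0 != j1 by [].
have [i0 s0] := clean_slice (O := O) j0 bL; have [i1 s1] := clean_slice (O := O) j1 bL.
case: (set_0Vmem O) => [->|[v0 _]]; first by rewrite cards0 min0n.
pose vc := upd (upd v0 j0 i0) j1 i1; pose c := vc \in O.
have col0 v : v j0 = i0 -> (v \in O) = c.
  by move=> v0i; apply: s0 => //; rewrite !updE (negPf j01) eqxx.
have col1 v : v j1 = i1 -> (v \in O) = c by move=> v1i; apply: s1 => //; rewrite !updE eqxx.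
pose Oc := [set v | (v \in O) != c].
have le : minn #|O| #|~: O| <= #|Oc|.
  case cE : c; [apply: leq_trans (geq_minr _ _) _|apply: leq_trans (geq_minl _ _) _];
  apply: subset_leq_card; apply/subsetP => v; rewrite !inE cE; by case: (v \in O).
apply: leq_trans le _.
(* The first component keeps all coordinates but [j0], the second keeps [j0]; so [F] is injective
   whatever is picked. *)
pose F v : V * V := (upd v j0 (odflt i0 [pick i | upd v j0 i \in bdry nearest O]),
                     upd v j1 (odflt i1 [pick i | upd v j1 i \in bdry nearest O])).
have Finj : injective F.
  move=> v w; rewrite /F => -[/ffunP h0 /ffunP h1]; apply/ffunP => k.
  case: (eqVneq k j0) => [->|k0]; last by have := h0 k; rewrite !updE (negPf k0).
  by have := h1 j0; rewrite !updE (negPf j01).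
have : #|Oc| <= b ^ 2.
  rewrite -(card_imset (mem Oc) Finj) -mulnn /b -cardsX; apply: subset_leq_card.
  apply/subsetP => p /imsetP[v]; rewrite inE => vc' ->; rewrite inE /=.
  have m0 : exists i, upd v j0 i \in bdry nearest O.
    apply: (mixed_line (w := upd v j0 i0)); first by rewrite updE eqxx.
    by rewrite (col0 (upd v j0 i0)) // updE eqxx.
  have m1 : exists i, upd v j1 i \in bdry nearest O.
    apply: (mixed_line (w := upd v j1 i1)); first by rewrite updE eqxx.
    by rewrite (col1 (upd v j1 i1)) // updE eqxx.
  apply/andP; split; case: pickP => [//|h]; [case: m0|case: m1] => i; by rewrite h.
move/leq_trans; apply; case: (posnP b) => [->|b0]; last exact: leq_pexp2l.
by rewrite exp0n.
Qed.

(* Timar's argument: if K did not wind around the torus, the cut edges at K would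
   form the coboundary of a function constant on O and on its complement. *)
Lemma winding O K : K \subset bdry nearest O -> K != set0 -> K != bdry nearest O ->
    (forall x y, x \in O -> y \in O -> y \in cluster nearest O x) ->
    (forall x y, x \in ~: O -> y \in ~: O -> y \in cluster nearest (~: O) x) ->
    (forall x y, x \in K -> y \in bdry nearest O -> star x y -> y \in K) ->
  exists j, forall v, exists i, upd v j i \in K.
Proof.
move=> Kb K0 Kneq cO cO' stK.
have KO x : x \in K -> x \in O by move/(subsetP Kb); rewrite inE => /andP[].
suff H : [exists j, forall v, exists i, upd v j i \in K].
  by case/existsP: H => j /forallP h; exists j => v; apply/existsP.
apply: contraR Kneq => /existsPn h.
(* The cut edges of [O] whose end in [O] belongs to [K]. *)
pose f v j := ((v \in O) (+) (shift v j \in O)) && ((if v \in O then v else shift v j) \in K).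
(* On a plaquette meeting [K], all cut edges are counted, since [K] is closed under [star] within
   the boundary; there [f] is the coboundary of [O]. On the other plaquettes [f] is zero. *)
have cf : closed f.
  move=> v j k; case: (boolP (has (mem K) (plaq v j k))) => [/hasP[p pv pK]|/hasPn nK].
    have fE u l : u \in plaq v j k -> shift u l \in plaq v j k ->
        f u l = (u \in O) (+) (shift u l \in O).
      move=> h1 h2; rewrite /f; case: (boolP (u \in O)) => uO; case: (boolP (shift u l \in O)) => sO //=.
        apply: (stK p) => //; first exact: edge_bd (nn_shift _ _) uO sO.
        by apply/starP; exists v, j, k.
      apply: (stK p) => //; first by apply: edge_bd sO uO; rewrite nn_sym nn_shift.
      by apply/starP; exists v, j, k.
    rewrite !fE ?inE ?eqxx ?orbT //; last by rewrite (shiftC v k) eqxx !orbT.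
    rewrite (shiftC v k j); by do 4!case: (_ \in O).
  have nK' w : w \in plaq v j k -> (w \in K) = false by move/nK/negPf.
  have f0 u l : u \in plaq v j k -> shift u l \in plaq v j k -> f u l = false.
    move=> h1 h2; rewrite /f; case: (u \in O); last by rewrite (nK' _ h2) andbF.
    by rewrite (nK' _ h1) andbF.
  rewrite !f0 ?inE ?eqxx ?orbT //; by rewrite (shiftC v k) eqxx !orbT.
(* In each direction some line misses [K]; the holonomy is zero on it, hence on all parallel
   lines. *)
have hf v j : hol f v j = false.
  have /forallPn[u /existsPn nu] := h j; rewrite (hol_const v u j cf) /hol big1 // => i _.
  rewrite /f shift_upd; case: (_ \in O) => /=; by rewrite (negPf (nu _)) andbF.
have [g gE] := flat_exact (conj cf hf).
have gstep v w : (v \in O) = (w \in O) -> nearest v w -> g v = g w.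
  move=> vw /existsP[j /orP[/eqP e|/eqP e]].
    have := gE v j; rewrite /f -e vw addbb /cob -e /=.
    by case: (g v); case: (g w).
  have := gE w j; rewrite /f -e vw addbb /cob -e /=.
  by case: (g v); case: (g w).
have gO x y : x \in O -> y \in O -> g x = g y.
  move=> xO yO; apply/eqP; move: (cO x y xO yO); move: y {yO}.
  apply: cl_ind => // y z yx /eqP-> zO yz; apply/eqP; apply: gstep => //.
  by rewrite zO (subsetP (cl_sub _ _ _) _ yx).
have gO' x y : x \in ~: O -> y \in ~: O -> g x = g y.
  move=> xO yO; apply/eqP; move: (cO' x y xO yO); move: y {yO}.
  apply: cl_ind => // y z yx /eqP-> zO yz; apply/eqP; apply: gstep => //.
  move: (subsetP (cl_sub _ _ _) _ yx) zO; rewrite !inE.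
  by move=> /negPf-> /negPf->.
have gK x y : x \in bdry nearest O -> y \in ~: O -> nearest x y -> (x \in K) = g x (+) g y.
  rewrite !inE => /andP[xO _] yO /existsP[j /orP[/eqP e|/eqP e]].
    by have := gE x j; rewrite /f /cob -e xO (negPf yO).
  by have := gE y j; rewrite /f /cob -e xO (negPf yO) [g y (+) _]addbC.
have [x xK] : exists x, x \in K by apply/set0Pn.
have xb := subsetP Kb _ xK.
have [x' x'O xx'] : exists2 y, y \in ~: O & nearest x y by apply/adjsP; move: xb; rewrite inE => /andP[].
have := gK _ _ xb x'O xx'; rewrite xK => gx.
rewrite eqEsubset Kb; apply/subsetP => y yb.
have [y' y'O yy'] : exists2 z, z \in ~: O & nearest y z by apply/adjsP; move: yb; rewrite inE => /andP[].
rewrite (gK _ _ yb y'O yy') -(gO' _ _ x'O y'O) -(gO x y) ?gx //; first exact: KO.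
by move: yb; rewrite inE => /andP[].
Qed.

(** If the unit is not [star]-connected, each of its [star] components winds in some direction,
    hence meets the line through [v0] in that direction. The union [X] of the coordinate lines
    through [v0] thus joins them all, and its size [d * L] is at most [d] times that of the unit. *)
Lemma unit_in_animal (A : {set V}) v0 : v0 \notin A -> exists Y : {set V},
  [/\ unit_of nearest A v0 \subset Y, connected_at star v0 Y & #|Y| <= d.+1 * #|unit_of nearest A v0|].
Proof.
move=> v0A; set D := unit_of nearest A v0.
have v0D : v0 \in D by apply: mem_unit.
case: (eqVneq (cluster star D v0) D) => [eD|neD].
  by exists D; split=> //; [rewrite /connected_at v0D eD eqxx|rewrite leq_pmull].
(* A chain of links leaves the [star] component [K] of [y] at some link from [a] to [b]. Both ends
   lie on the boundary of the same [O], and this boundary lies in the unit, so its part in [K] is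
   proper, nonempty and [star]-closed: [winding] applies. *)
have wind y : y \in D -> exists j, forall v, exists i, upd v j i \in cluster star D y.
  move=> yD; set K := cluster star D y.
  have [z zD zK] : exists2 z, z \in D & z \notin K.
    have : ~~ (D \subset K).
      apply: contra neD => DK.
      have : v0 \in K by apply: subsetP DK _ v0D.
      by move/(cl_eq star_sym) => ->; rewrite eqEsubset cl_sub.
    by case/subsetPn => z; exists z.
  have yz : connect (link nearest A) y z by move: zD; rewrite /D -(unit_eq nn_sym yD) inE.
  have [a [b [aK bK ab]]] := exit_edge yz (mem_cl _ yD) zK.
  have aD := subsetP (cl_sub _ _ _) _ aK.
  have bD := unit_step aD ab.
  have [C [aA bA hC aC [bC abC]]] := linkP _ _ _ _ ab.
  set O := cluster nearest (~: C) a in abC.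
  have [_ [_ sub]] := bd_sub_unit nn_sym v0A hC aD aD aC.
  have aCc : a \in ~: C by rewrite inE; apply: contra aA; apply/subsetP/comps_sub/hC.
  have aO : a \in O by apply: mem_cl.
  have CO : C \subset ~: O by rewrite -[C]setCK setCS cl_sub.
  have bdin w : w \in O -> touches nearest w C -> w \in bdry nearest O.
    by move=> wO /adjsP[c cC wc]; apply: edge_bd wc wO _; have := subsetP CO _ cC; rewrite inE.
  have hO : O \in clusters nearest (~: C) by apply: cl_comps.
  have [c0 c0C] := comps_n0 hC.
  (* The complement of [O] is connected: it is made of the connected set [C] and of the other
     components of [~: C], each adjacent to [C]. *)
  have toc u : u \in ~: O -> c0 \in cluster nearest (~: O) u.
    have Cc u' : u' \in C -> c0 \in cluster nearest (~: O) u'.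
      move=> u'C; apply: (subsetP (cl_mono _ _ CO)).
      exact: (comps_conn nn_sym hC).
    move=> uO; case: (boolP (u \in C)) => uC; first exact: Cc.
    have uCc : u \in ~: C by rewrite inE.
    have c0n : c0 \notin cluster nearest (~: C) u.
      by apply/negP => /(subsetP (cl_sub _ _ _)); rewrite inE c0C.
    have [p [q [pO qO pq]]] := exit_edge (nn_connect u c0) (mem_cl _ uCc) c0n.
    have qC : q \in C.
      apply: contraR qO => qC; apply: cl_step pO _ pq; by rewrite inE.
    have sub' : cluster nearest (~: C) u \subset ~: O.
      apply/subsetP => r ru; rewrite inE; apply: contraL uO => rO; rewrite inE negbK.
      by rewrite /O -(cl_eq nn_sym rO) cl_sym //; exact: nn_sym.
    have pu : p \in cluster nearest (~: O) u.
      apply: (subsetP (cl_mono _ _ sub')).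
      by rewrite (cl_idem _ uCc).
    have qu := cl_step pu (subsetP CO _ qC) pq.
    by rewrite -(cl_eq nn_sym qu); apply: Cc.
  have [j jP] : exists j, forall v, exists i, upd v j i \in K :&: bdry nearest O.
    apply: (@winding O); first exact: subsetIr.
    - by apply/set0Pn; exists a; rewrite inE aK bdin.
    - by apply: contraNneq bK => eK; have := bdin _ abC bC; rewrite -eK inE => /andP[].
    - by move=> u w uO wO; apply: (comps_conn nn_sym hO).
    - move=> u w uO wO; rewrite -(cl_eq nn_sym (toc _ uO)) (cl_sym nn_sym).
      exact: toc.
    - move=> u w; rewrite inE => /andP[uK _] wb uw; rewrite inE wb andbT.
      by apply: cl_step uK _ uw; apply: subsetP sub _ wb.
  by exists j => v; have [a0] := jP v; rewrite inE => /andP[? _]; exists a0.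
pose X := \bigcup_j [set upd v0 j i | i : 'I_L].
have cX : #|X| <= d * L.
  apply: leq_trans (card_bigcup_le _ _) _.
  apply: leq_trans (_ : \sum_(j < d) L <= _); last by rewrite sum_nat_const card_ord.
  by apply: leq_sum => j _; apply: leq_trans (leq_imset_card _ _) _; rewrite card_ord.
(* The component winding in direction [j] meets [L] disjoint parallel lines, indexed by a coordinate
   [k != j]. *)
have LD : L <= #|D|.
  have [j jP] := wind _ v0D.
  have [k kj] : exists k : 'I_d, k != j.
    have : 0 < #|[set~ j]| by rewrite cardsC1 card_ord -ltnS prednK // (leq_trans _ d_ge2).
    by case/card_gt0P => k; rewrite !inE => kj; exists k.
  pose F (a : 'I_L) := upd (upd v0 k a) j (odflt a [pick i | upd (upd v0 k a) j i \in D]).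
  have Finj : injective F.
    by move=> a b /ffunP/(_ k); rewrite !updE (negPf kj) eqxx.
  rewrite -[X in X <= _](card_ord L) -cardsT -(card_imset _ Finj); apply: subset_leq_card.
  apply/subsetP => p /imsetP[a _ ->]; rewrite /F; case: pickP => [//|h].
  by have [i /(subsetP (cl_sub _ _ _))] := jP (upd v0 k a); rewrite h.
exists (D :|: X); split; first exact: subsetUl.
- have v0Y : v0 \in D :|: X by rewrite inE v0D.
  have XY j i : upd v0 j i \in D :|: X.
    by rewrite inE; apply/orP; right; apply/bigcupP; exists j => //; apply: imset_f.
  have Xcl j i : upd v0 j i \in cluster star (D :|: X) v0.
    have -> : (upd v0 j i \in cluster star (D :|: X) v0) = (upd v0 j (v0 j) \in cluster star (D :|: X) v0).
      apply: (ordS_const (h := fun i => upd v0 j i \in cluster star (D :|: X) v0)) => {}i.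
      apply/idP/idP => h; apply: cl_step h (XY _ _) _; rewrite -shift_upd ?star_shift //.
      by rewrite star_sym star_shift.
    by rewrite upd_id mem_cl.
  rewrite /connected_at v0Y eqEsubset cl_sub; apply/subsetP => y; rewrite inE => /orP[yD|].
    have [j jP] := wind _ yD; have [i yi] := jP v0.
    have := subsetP (cl_mono star y (subsetUl D X)) _ yi.
    by rewrite (cl_sym star_sym) (cl_eq star_sym (Xcl j i)).
  by case/bigcupP => j _ /imsetP[i _ ->].
- by apply: leq_trans (leq_card_setU _ _) _; rewrite mulSn leq_add2l; apply: leq_trans cX _; rewrite leq_mul2l LD orbT.
Qed.
End Torus.

Import Order.TTheory GRing.Theory Num.Theory.
Local Open Scope ring_scope.

(** * The percolation model *)

Lemma geom_half_le (R : realFieldType) (q : R) m : 0 <= q -> q <= 2^-1 ->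
  \sum_(n < m) q ^+ n <= 2.
Proof.
move=> q0 q2; have : \sum_(n < m) (2^-1 : R) ^+ n <= 2.
  suff -> : \sum_(n < m) (2^-1 : R) ^+ n = 2 - 2 * (2^-1) ^+ m.
    by rewrite gerBl mulr_ge0 // exprn_ge0 // invr_ge0.
  elim: m => [|m IH]; first by rewrite big_ord0 expr0 mulr1 subrr.
  rewrite big_ord_recr /= IH exprS; by field.
by move=> h; apply: le_trans h; apply: ler_sum => n _; rewrite lerXn2r ?nnegrE ?invr_ge0.
Qed.

(** There are at most [Delta ^ (2 n)] animals of [n.+1] sites, so the sum is at most [r] times a
    geometric series. The condition on [r] makes both the ratio and [r] at most one half, also for
    [Delta = 0]. *)
Lemma animals_sum (R : realFieldType) (V : finType) (e : rel V) (Delta : nat) (r : R) x :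
    symmetric e -> (forall x, #|[set y | e x y]| <= Delta)%N ->
    0 <= r -> r * (2 * Delta.+1 ^ 2)%:R <= 1 ->
  \sum_(Y : {set V} | connected_at e x Y) r ^+ #|Y| <= 1.
Proof.
move=> es deg r0 rD.
have D2 : r * (Delta ^ 2)%:R <= 2^-1.
  rewrite -[2^-1]mul1r ler_pdivlMr // -mulrA -natrM; apply: le_trans rD.
  rewrite ler_wpM2l // ler_nat; nia.
have r2 : r <= 2^-1.
  rewrite -[r]mulr1 -[X in _ <= X]mul1r ler_pdivlMr // -mulrA; apply: le_trans rD.
  rewrite mul1r ler_wpM2l // -[2]/(2%:R) ler_nat; nia.
pose h (Y : {set V}) : 'I_#|V|.+1 := inord #|Y|.-1.
have hE Y : connected_at e x Y -> (h Y).+1 = #|Y|.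
  case/andP => xY _; rewrite /h inordK.
    by rewrite prednK //; apply/card_gt0P; exists x.
  by rewrite ltnS (leq_trans (leq_pred _)) // max_card.
rewrite (partition_big h xpredT) //=.
apply: le_trans (_ : \sum_(n < #|V|.+1) r * (r * (Delta ^ 2)%:R) ^+ n <= _).
  apply: ler_sum => n _.
  apply: le_trans (_ : \sum_(Y in [set Y | connected_at e x Y && (#|Y| == n.+1)]) r ^+ n.+1 <= _).
    rewrite [X in _ <= X](eq_bigl (fun Y => connected_at e x Y && (h Y == n))); last first.
      move=> Y; rewrite inE; case cY: (connected_at e x Y) => //=.
      by rewrite -(hE _ cY) eqSS.
    by apply: ler_sum => Y /andP[cY /eqP <-]; rewrite (hE _ cY).
  rewrite sumr_const -[X in X <= _]mulr_natr exprS -mulrA ler_wpM2l // exprMn ler_wpM2l ?exprn_ge0 //.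
  by rewrite -natrX ler_nat -expnM mul2n card_animals.
rewrite -mulr_sumr; apply: le_trans (_ : r * 2 <= _); last by lra.
by rewrite ler_wpM2l // geom_half_le // mulr_ge0.
Qed.

Lemma sum_inj_le (R : realFieldType) (T : finType) (P : pred T) (h : T -> T) (F : T -> R) :
    (forall t, 0 <= F t) -> {in P &, injective h} ->
  \sum_(t | P t) F (h t) <= \sum_t F t.
Proof.
move=> F0 hi; rewrite (eq_bigl (mem P)) // -(big_imset (h := h) F) //=.
by rewrite [X in _ <= X](bigID (mem (h @: P))) /= lerDl sumr_ge0.
Qed.

Section Percolation.
Variables (R : realType) (d L : nat).
Notation V := (site d L).
Notation nearest := (@nearest d L).
Notation N := #|{: V}|.
Implicit Types A D Y : {set V}.

Definition gc_weight (mu : R) A : R := expR (mu * #|A|%:R) * (cluster_wt nearest A)%:R.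
Definition gc_part (mu : R) : R := \sum_A gc_weight mu A.

Lemma gc_weight_gt0 mu A : 0 < gc_weight mu A.
Proof. by rewrite mulr_gt0 ?expR_gt0 // ltr0n wt_gt0. Qed.

Lemma gc_part_gt0 mu : 0 < gc_part mu.
Proof.
rewrite /gc_part (bigD1 set0) //=; apply: ltr_wpDr; last exact: gc_weight_gt0.
by apply: sumr_ge0 => A _; apply/ltW/gc_weight_gt0.
Qed.

Lemma weight_union (mu : R) A D : [disjoint A & D] ->
  expR (mu * #|A|%:R) = expR (- mu) ^+ #|D| * expR (mu * #|A :|: D|%:R).
Proof.
move=> dis; rewrite -expRM_natl -expRD; congr expR.
have -> : #|A :|: D| = (#|A| + #|D|)%N by apply/eqP; rewrite (leq_card_setU A D).2.
rewrite natrD; ring.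
Qed.

Definition animal_fug : R := ((2 * (16 * d ^ 2).+1 ^ 2)%:R)^-1.
(** The exponent accounts for the enlargement of a unit to an animal in [unit_in_animal], the 2 for
    the choice of the unit among the subsets of the animal. *)
Definition fill_fug : R := (animal_fug / 2) ^+ d.+1.

Lemma animal_fug_gt0 : 0 < animal_fug.
Proof. by rewrite invr_gt0 ltr0n. Qed.

Lemma fill_fug_gt0 : 0 < fill_fug.
Proof. by rewrite exprn_gt0 // divr_gt0 ?animal_fug_gt0. Qed.

Lemma animal_fug_le1 : animal_fug <= 1.
Proof. by rewrite invf_le1 ?ltr0n // -[1]/(1%:R) ler_nat. Qed.

Lemma star_animals x : \sum_(Y : {set V} | connected_at (@star d L) x Y) animal_fug ^+ #|Y| <= 1.
Proof.
apply: (animals_sum (Delta := 16 * d ^ 2)); [exact: star_sym|exact: star_deg|exact: ltW animal_fug_gt0|].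
by rewrite mulVf // pnatr_eq0.
Qed.

Lemma nn_animals x : \sum_(Y : {set V} | connected_at nearest x Y) animal_fug ^+ #|Y| <= 1.
Proof.
apply: (animals_sum (Delta := 16 * d ^ 2)); [exact: nn_sym| |exact: ltW animal_fug_gt0|].
  move=> y; apply: leq_trans (nn_deg _) _; nia.
by rewrite mulVf // pnatr_eq0.
Qed.

Lemma spin_sq4_le A : (spin_sq4 nearest A <= N * N.+2)%N.
Proof.
rewrite /spin_sq4; apply: leq_trans (_ : \sum_(C in clusters nearest A) #|C| * N.+2 <= _)%N.
  by apply: leq_sum => C _; rewrite leq_mul2l !ltnS max_card orbT.
by rewrite -big_distrl /= (sum_card_comps (@nn_sym d L)) leq_mul2r max_card orbT.
Qed.

Lemma spin_sq4_low A : spin_sq4 nearest A = (3 * #|A| + \sum_(x in A) #|cluster nearest A x|.-1)%N.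
Proof.
rewrite -(sum_comps (@nn_sym d L) A (fun C => #|C|.-1)) -(sum_card_comps (@nn_sym d L) A).
rewrite big_distrr -big_split /=; apply: eq_bigr => C hC.
have : (0 < #|C|)%N by have [x xC] := comps_n0 hC; apply/card_gt0P; exists x.
by rewrite sum_nat_const; move: #|C| => [//|n] _ /=; nia.
Qed.

(** The cluster [Y] of a site [x] is peeled off: for fixed [x] and [Y] the map from [A] to [A :\: Y]
    is injective, which leaves [gc_part] times a sum over animals at [x]. *)
Lemma low_density (mu : R) : mu <= - (4 / animal_fug) ->
  \sum_A gc_weight mu A * ((spin_sq4 nearest A)%:R - (3 * #|A|)%:R) <= 16 / animal_fug ^+ 2 * N%:R * expR (2 * mu) * gc_part mu.
Proof.
move=> hmu; have r0p := animal_fug_gt0.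
(* From [4 / animal_fug <= 1 - mu <= expR (- mu)]. *)
have mur : 4 * expR mu <= animal_fug.
  have : 4 / animal_fug <= expR (- mu).
    apply: le_trans (expR_ge1Dx _); rewrite ler_wpDl //; lra.
  by rewrite expRN ler_pdivrMr // mulrC ler_pdivlMr ?expR_gt0.
(* Single sites contribute zero, so two factors [expR mu] can be set aside; the polynomial is
   bounded by [4 ^ #|Y|], and each remaining [4 * expR mu] by [animal_fug]. *)
have Ydecay Y : (#|Y|.-1 * #|Y|.+1)%:R * expR mu ^+ #|Y| <= (4 * expR mu / animal_fug) ^+ 2 * animal_fug ^+ #|Y| :> R.
  case: (ltnP #|Y| 2) => [|Y2].
    by case: #|Y| => [|[|//]] _; rewrite /= mul0n mul0r mulr_ge0 ?sqr_ge0 // exprn_ge0 // ltW.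
  apply: le_trans (_ : (4 * expR mu) ^+ #|Y| <= _).
    rewrite exprMn ler_wpM2r ?exprn_ge0 ?expR_ge0 // -natrX ler_nat.
    rewrite (_ : 4 = 2 * 2)%N // expnMn leq_mul //; last exact: ltn_expl.
    by apply: leq_trans (leq_pred _) (ltnW (ltn_expl _ _)).
  rewrite -(subnKC Y2) exprD [X in _ <= X * _]exprMn exprD mulrA exprVn mulfVK ?expf_neq0 ?gt_eqF //.
  rewrite ler_wpM2l ?exprn_ge0 ?mulr_ge0 ?expR_ge0 // lerXn2r ?nnegrE ?mulr_ge0 ?expR_ge0 //.
  exact: ltW.
have clW A x : x \in A -> gc_weight mu A <= #|cluster nearest A x|.+1%:R * expR mu ^+ #|cluster nearest A x| * gc_weight mu (A :\: cluster nearest A x).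
  move=> xA; set Y := cluster nearest A x.
  have YA : Y \subset A by apply: cl_sub.
  have eA : #|A| = (#|A :\: Y| + #|Y|)%N by rewrite cardsD (setIidPr YA) subnK ?subset_leq_card.
  have -> : expR mu ^+ #|Y| = expR (mu * #|Y|%:R) by rewrite -expRM_natr.
  rewrite /gc_weight {1}eA natrD mulrDr expRD.
  have h := wt_setD (@nn_sym d L) (cl_comps nearest xA).
  rewrite -!mulrA mulrCA [X in _ <= X]mulrCA ler_wpM2l ?expR_ge0 //.
  by rewrite [X in _ <= X]mulrCA ler_wpM2l ?expR_ge0 // -natrM ler_nat.
apply: le_trans (_ : \sum_(A : {set V}) \sum_(x in A) gc_weight mu A * #|cluster nearest A x|.-1%:R <= _).
  apply: ler_sum => A _; rewrite spin_sq4_low natrD addrC addKr natr_sum mulr_sumr.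
  exact: lexx.
rewrite (exchange_big_dep xpredT) //=.
apply: le_trans (_ : \sum_(x : V) (4 * expR mu / animal_fug) ^+ 2 * gc_part mu <= _); last first.
  rewrite sumr_const -[X in X <= _]mulr_natl.
  have -> : expR (2 * mu) = expR mu ^+ 2 by rewrite -expRM_natl.
  by rewrite le_eqVlt; apply/orP; left; apply/eqP; field; rewrite gt_eqF.
apply: ler_sum => x _.
rewrite (partition_big (fun A => cluster nearest A x) (connected_at nearest x)) /=; last first.
  by move=> A xA; rewrite /connected_at mem_cl //= cl_idem.
apply: le_trans (_ : \sum_(Y : {set V} | connected_at nearest x Y) (4 * expR mu / animal_fug) ^+ 2 * gc_part mu * animal_fug ^+ #|Y| <= _); last first.
  by rewrite -mulr_sumr ler_piMr ?nn_animals // mulr_ge0 ?exprn_ge0 // ?divr_ge0 ?mulr_ge0 ?expR_ge0 // ltW ?gc_part_gt0.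
apply: ler_sum => Y cY.
apply: le_trans (_ : \sum_(A : {set V} | (x \in A) && (cluster nearest A x == Y))
    (#|Y|.-1 * #|Y|.+1)%:R * expR mu ^+ #|Y| * gc_weight mu (A :\: Y) <= _).
  apply: ler_sum => A /andP[xA /eqP eY]; rewrite -eY mulrC natrM -!mulrA ler_wpM2l // mulrA.
  exact: clW.
rewrite -mulr_sumr [X in _ <= X]mulrAC.
apply: ler_pM (Ydecay Y) _.
- by rewrite mulr_ge0 ?exprn_ge0 ?expR_ge0.
- by apply: sumr_ge0 => A _; exact/ltW/gc_weight_gt0.
apply: (sum_inj_le (h := fun A => A :\: Y)) => [A|]; first exact/ltW/gc_weight_gt0.
have un A : (x \in A) && (cluster nearest A x == Y) -> (A :\: Y) :|: Y = A.
  move=> /andP[xA /eqP <-]; apply/setP => y; rewrite inE [_ \in _ :\: _]inE.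
  case yY: (y \in cluster nearest A x); rewrite ?orbF ?orbT //=; first by rewrite (subsetP (cl_sub _ _ _) _ yY).
by move=> A B hA hB hAB; rewrite -(un A hA) -(un B hB) hAB.
Qed.

(** * The Peierls argument at high density *)

Hypothesis d_ge2 : (2 <= d)%N.

(** Cost per site of a unit: [2 ^ (d * d.*2)] from [wt_fill] with degree [d.*2], and [2 ^ d] to
    absorb the factor [#|D| ^ d] of [deficit]. *)
Definition fillcost : nat := 2 ^ (d + d * d.*2).

Lemma gc_weight_fill (mu : R) A x : x \notin A ->
  gc_weight mu A * (#|unit_of nearest A x| ^ d)%:R <=
  (fillcost%:R * expR (- mu)) ^+ #|unit_of nearest A x| * gc_weight mu (A :|: unit_of nearest A x).
Proof.
move=> xA; set D := unit_of nearest A x.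
have dis : [disjoint A & D].
  by rewrite disjoint_subset; apply/subsetP => y; rewrite inE; apply: contraL; exact: unit_notin.
rewrite /gc_weight (weight_union mu dis) exprMn -natrX /fillcost.
rewrite -!mulrA [X in _ <= X]mulrCA ler_wpM2l ?exprn_ge0 ?expR_ge0 //.
rewrite [X in _ <= X]mulrCA ler_wpM2l ?expR_ge0 // -!natrM ler_nat.
have h1 := wt_fill (@nn_sym d L) (leq_trans (isT : 0 < 2)%N d_ge2) (@nn_deg d L) (nn_iso d_ge2) xA.
have h2 : (#|D| ^ d <= 2 ^ (d * #|D|))%N.
  by rewrite mulnC expnM leq_exp2r ?(ltnW (ltn_expl _ _)) // (leq_trans _ d_ge2).
apply: leq_trans (leq_mul h1 h2) _.
by rewrite mulnAC -expnD -expnM mulnDl [(_ * #|D| + d * _)%N]addnC.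
Qed.

(** The animal [Y] around the unit is summed over rather than chosen. Given [Y], the unit [D] is one
    of [2 ^ #|Y|] subsets; given [D], the map from [A] to [A :|: D] is injective. *)
Lemma unit_sum (mu : R) (x : V) : let z := fillcost%:R * expR (- mu) in z <= fill_fug ->
  \sum_(A : {set V} | x \notin A) gc_weight mu A * (#|unit_of nearest A x| ^ d)%:R <= z / fill_fug * gc_part mu.
Proof.
move=> z zz0; set U := fun A => unit_of nearest A x.
have z_ge0 : 0 <= z by rewrite mulr_ge0 ?expR_ge0.
have q0 : 0 <= z / fill_fug by rewrite divr_ge0 // ltW ?fill_fug_gt0.
have rho0 : 0 <= animal_fug / 2 by rewrite divr_ge0 // ltW ?animal_fug_gt0.
have rho1 : animal_fug / 2 <= 1 by have := animal_fug_le1; lra.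
have U0 A : (0 < #|U A|)%N by apply/card_gt0P; exists x; apply: mem_unit.
(* One factor [z] is kept for the decay in [mu]; the others are bounded by [fill_fug]. *)
have zpow A Y : (#|Y| <= d.+1 * #|U A|)%N -> z ^+ #|U A| <= z / fill_fug * (animal_fug / 2) ^+ #|Y|.
  move=> le; rewrite -(prednK (U0 A)) exprS -mulrA ler_wpM2l //.
  apply: le_trans (_ : fill_fug ^+ #|U A|.-1 <= _).
    by rewrite lerXn2r // nnegrE ltW // fill_fug_gt0.
  rewrite mulrC ler_pdivlMr ?fill_fug_gt0 // -exprSr prednK // /fill_fug -exprM.
  by apply: ler_wiXn2l.
move: (z / fill_fug) q0 zpow => q q0 zpow.
apply: le_trans (_ : \sum_(A : {set V} | x \notin A) \sum_(Y : {set V} | (U A \subset Y) && connected_at (@star d L) x Y)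
    q * (animal_fug / 2) ^+ #|Y| * gc_weight mu (A :|: U A)  <= _).
  apply: ler_sum => A xA; have [Y [sub cY cardY]] := unit_in_animal d_ge2 xA.
  apply: le_trans (gc_weight_fill mu xA) _.
  rewrite (bigD1 Y) ?sub //=; apply: ler_wpDr.
    by apply: sumr_ge0 => Y' _; rewrite mulr_ge0 ?(ltW (gc_weight_gt0 _ _)) // mulr_ge0 ?exprn_ge0.
  by rewrite ler_wpM2r ?(ltW (gc_weight_gt0 _ _)) // zpow.
rewrite (exchange_big_dep (connected_at (@star d L) x)) /=; last by move=> A Y _ /andP[].
apply: le_trans (_ : \sum_(Y : {set V} | connected_at (@star d L) x Y) (q * gc_part mu) * animal_fug ^+ #|Y| <= _); last first.
  by rewrite -mulr_sumr ler_piMr ?star_animals // mulr_ge0 // ltW ?gc_part_gt0.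
apply: ler_sum => Y cY; rewrite -mulr_sumr -!mulrA ler_wpM2l //.
have -> : gc_part mu * animal_fug ^+ #|Y| = (animal_fug / 2) ^+ #|Y| * ((2 ^ #|Y|)%:R * gc_part mu).
  by rewrite mulrA natrX -exprMn mulfVK ?pnatr_eq0 // mulrC.
rewrite ler_wpM2l ?exprn_ge0 //.
rewrite (partition_big U (mem (powerset Y))) /=; last first.
  by move=> A /and3P[_ sub _]; rewrite inE.
rewrite -card_powerset -sum1_card natr_sum mulr_suml; apply: ler_sum => D _; rewrite mul1r.
apply: le_trans (_ : \sum_(A : {set V} | (x \notin A) && (U A == D)) gc_weight mu (A :|: D) <= _).
  rewrite [X in X <= _](eq_bigr (fun A => gc_weight mu (A :|: D))); last by move=> A /andP[_ /eqP->].
  rewrite [X in X <= _]big_mkcond [X in _ <= X]big_mkcond /=; apply: ler_sum => A _.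
  case: (x \notin A) => //=; case: (U A == D); rewrite ?andbT ?andbF //.
  by case: ifP => // _; apply/ltW/gc_weight_gt0.
apply: (sum_inj_le (h := fun A => A :|: D)) => [A|]; first exact/ltW/gc_weight_gt0.
have dis A : (x \notin A) && (U A == D) -> (A :|: D) :\: D = A.
  move=> /andP[xA /eqP <-]; rewrite setDUl setDv setU0; apply/setDidPl.
  by rewrite disjoint_subset; apply/subsetP => y; rewrite inE; apply: contraL; exact: unit_notin.
by move=> A B hA hB hAB; rewrite -(dis A hA) -(dis B hB) hAB.
Qed.

Lemma high_density (mu : R) : fillcost%:R / fill_fug <= mu ->
  \sum_A gc_weight mu A * ((N * N.+2)%:R - (spin_sq4 nearest A)%:R) <=
  (4 + d.*2)%:R * (fillcost%:R / fill_fug) * expR (- mu) * (N * N.+2)%:R * gc_part mu.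
Proof.
move=> hmu.
have F0 : 0 < fillcost%:R :> R by rewrite ltr0n expn_gt0.
(* From [fillcost / fill_fug <= mu <= 1 + mu <= expR mu]. *)
have zz0 : fillcost%:R * expR (- mu) <= fill_fug.
  rewrite expRN ler_pdivrMr ?expR_gt0 // mulrC -ler_pdivrMr ?fill_fug_gt0 //.
  apply: le_trans hmu _; apply: le_trans (expR_ge1Dx _); by rewrite lerDr.
apply: le_trans (_ : \sum_A \sum_(x in ~: A) (N * (4 + d.*2))%:R * (gc_weight mu A * (#|unit_of nearest A x| ^ d)%:R) <= _).
  apply: ler_sum => A _; rewrite -!mulr_sumr [X in _ <= X]mulrCA ler_wpM2l ?(ltW (gc_weight_gt0 _ _)) //.
  rewrite lerBlDl -natr_sum -natrM -natrD ler_nat.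
  exact: (deficit (@nn_sym d L) (leq_trans (isT : 0 < 2)%N d_ge2) (@nn_deg d L) (nn_iso d_ge2) (@nn_connect d L)).
rewrite (exchange_big_dep xpredT) //=.
apply: le_trans (_ : \sum_(x : V) (N * (4 + d.*2))%:R * (fillcost%:R * expR (- mu) / fill_fug * gc_part mu) <= _).
  apply: ler_sum => x _; rewrite -mulr_sumr ler_wpM2l //.
  rewrite (eq_bigl (fun A : {set V} => x \notin A)); first exact: unit_sum.
  by move=> A; rewrite inE.
rewrite sumr_const -[X in X <= _]mulr_natl.
have -> : N%:R * ((N * (4 + d.*2))%:R * (fillcost%:R * expR (- mu) / fill_fug * gc_part mu)) =
   (4 + d.*2)%:R * (fillcost%:R / fill_fug) * expR (- mu) * (N * N)%:R * gc_part mu :> R.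
  rewrite !natrM; ring.
apply: ler_wpM2r; first exact/ltW/gc_part_gt0.
apply: ler_wpM2l.
  apply: mulr_ge0; last exact: expR_ge0.
  apply: mulr_ge0; first exact: ler0n.
  by apply: divr_ge0; [exact: ler0n | exact/ltW/fill_fug_gt0].
by rewrite ler_nat leq_mul2l; apply/orP; right; apply/leqW/leqnSn.
Qed.

End Percolation.

(** * Fermion operators *)

(** The index calculation of [bil_comm] at one site, [F s t] standing for the product of a creation
    operator of spin [s] and an annihilation operator of spin [t]. *)
Lemma spin_comm_sum (K : comPzRingType) (V : lmodType K) (p q : bool -> bool -> K) (F : bool -> bool -> V) :
  \sum_(s : bool) \sum_(t : bool)
     q s t *: (\sum_(r : bool) p r s *: F r t - \sum_(r : bool) p t r *: F s r) =
  \sum_(s : bool) \sum_(t : bool) (\sum_(r : bool) (p s r * q r t - q s r * p r t)) *: F s t.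
Proof.
have -> : \sum_(s : bool) \sum_(t : bool) (\sum_(r : bool) (p s r * q r t - q s r * p r t)) *: F s t =
   \sum_(s : bool) \sum_(t : bool) \sum_(r : bool) (p s r * q r t) *: F s t
   - \sum_(s : bool) \sum_(t : bool) \sum_(r : bool) (q s r * p r t) *: F s t.
  rewrite -sumrB; apply: eq_bigr => s _; rewrite -sumrB; apply: eq_bigr => t _.
  by rewrite -sumrB scaler_suml; apply: eq_bigr => r _; rewrite scalerBl.
have -> : \sum_(s : bool) \sum_(t : bool)
     q s t *: (\sum_(r : bool) p r s *: F r t - \sum_(r : bool) p t r *: F s r) =
   \sum_(s : bool) \sum_(t : bool) \sum_(r : bool) (p r s * q s t) *: F r t
   - \sum_(s : bool) \sum_(t : bool) \sum_(r : bool) (q s t * p t r) *: F s r.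
  rewrite -sumrB; apply: eq_bigr => s _; rewrite -sumrB; apply: eq_bigr => t _.
  rewrite scalerBr !scaler_sumr; congr (_ - _); apply: eq_bigr => r _; rewrite scalerA //.
  by rewrite [q s t * _]mulrC.
congr (_ - _); last by apply: eq_bigr => s _; rewrite exchange_big.
under eq_bigr => s _ do rewrite exchange_big.
by rewrite exchange_big; apply: eq_bigr => r _; rewrite exchange_big.
Qed.

Section Fock.
Variables (R : realType) (d L : nat).
Notation C := R[i].
Notation op := 'M[C]_(fdim d L).
Notation n := (fdim d L).
Implicit Types (s t : fock d L) (x y : mode d L).

Definition idx s : 'I_n := enum_rank s.

Lemma idxK : cancel idx (@cfg d L).
Proof. exact: enum_rankK. Qed.

Lemma cfgK : cancel (@cfg d L) idx.
Proof. exact: enum_valK. Qed.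

Lemma matP m (M M' : 'M[C]_(n, m)) : (forall s k, M (idx s) k = M' (idx s) k) -> M = M'.
Proof. by move=> h; apply/matrixP => i k; rewrite -(cfgK i). Qed.

Definition fill s x : fock d L := [ffun y => if y == x then true else s y].

Lemma fillE s x y : fill s x y = (y == x) || s y.
Proof. by rewrite ffunE; case: eqP. Qed.

Lemma emptyE s x y : empty_at s x y = (y != x) && s y.
Proof. by rewrite ffunE; case: eqP. Qed.

Lemma fillC s x y : fill (fill s x) y = fill (fill s y) x.
Proof. by apply/ffunP => z; rewrite !fillE orbCA. Qed.

Lemma fill_empty s x : s x -> fill (empty_at s x) x = s.
Proof. by move=> sx; apply/ffunP => z; rewrite fillE emptyE; case: eqP => [->|]. Qed.

Lemma empty_fill s x : ~~ s x -> empty_at (fill s x) x = s.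
Proof. by move=> sx; apply/ffunP => z; rewrite emptyE fillE; case: eqP => [->|//]; rewrite (negPf sx). Qed.

Lemma fill_emptyC s x y : x != y -> fill (empty_at s y) x = empty_at (fill s x) y.
Proof.
move=> xy; apply/ffunP => z; rewrite !(fillE, emptyE).
by case: (eqVneq z x) => [->|//]; rewrite xy.
Qed.

Definition before y x := (enum_rank y < enum_rank x)%N.

Lemma before_neq x y : x != y -> before x y = ~~ before y x.
Proof.
move=> xy; rewrite /before -leqNgt ltn_neqAle.
by rewrite (inj_eq (@ord_inj _)) (inj_eq enum_rank_inj) xy.
Qed.

Notation jw := (jw_sign R).

Lemma jwE s x : jw s x = \prod_(y | before y x && s y) (-1).
Proof. by rewrite prodr_const /jw_sign; congr (_ ^+ _); apply: eq_card => y; rewrite !inE. Qed.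

Lemma jw_fill_same s x : jw (fill s x) x = jw s x.
Proof.
rewrite !jwE; apply: eq_bigl => y; rewrite fillE.
by case: eqP => [->|//]; rewrite /before ltnn.
Qed.

Lemma jw_fill s x y : ~~ s y -> jw (fill s y) x = (-1) ^+ before y x * jw s x.
Proof.
move=> sy; rewrite !jwE; case b: (before y x).
  rewrite (bigD1 y) ?b ?fillE ?eqxx //= expr1; congr (_ * _); apply: eq_bigl => z.
  by rewrite fillE; case: (eqVneq z y) => [->|]; rewrite ?andbF ?andbT // (negPf sy) andbF.
by rewrite mul1r; apply: eq_bigl => z; rewrite fillE; case: (eqVneq z y) => [->|//]; rewrite b.
Qed.

Lemma jw_empty s x y : s y -> jw (empty_at s y) x = (-1) ^+ before y x * jw s x.
Proof.
move=> sy; rewrite -{2}(fill_empty sy) jw_fill ?emptyE ?eqxx //.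
by rewrite mulrA -expr2 sqrr_sign mul1r.
Qed.

Lemma jw_sqr s x : jw s x * jw s x = 1.
Proof. by rewrite -expr2 sqrr_sign. Qed.

Lemma annE x m (v : 'M[C]_(n, m)) s k :
  (ann R x *m v) (idx s) k = if s x then 0 else jw s x * v (idx (fill s x)) k.
Proof.
rewrite mxE (bigD1 (idx (fill s x))) //= big1 ?addr0 => [|j jn].
  rewrite mxE !idxK fillE eqxx /= jw_fill_same.
  case sx: (s x); last by rewrite empty_fill ?sx // eqxx.
  case: eqP => [e|_]; last by rewrite mul0r.
  by move: sx; rewrite e emptyE eqxx.
rewrite mxE idxK; case: ifP => [/andP[jx /eqP e]|_]; last by rewrite mul0r.
by move: jn; rewrite e fill_empty // cfgK eqxx.
Qed.

Lemma creE x m (v : 'M[C]_(n, m)) s k :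
  (cre R x *m v) (idx s) k = if s x then jw s x * v (idx (empty_at s x)) k else 0.
Proof.
rewrite mxE (bigD1 (idx (empty_at s x))) //= big1 ?addr0 => [|j jn].
  rewrite !mxE !idxK eqxx andbT.
  by case: (s x); rewrite ?conjC0 ?mul0r // /jw_sign rmorphXn rmorphN1.
rewrite !mxE idxK; case: ifP => [/andP[jx /eqP e]|_]; last by rewrite conjC0 mul0r.
by move: jn; rewrite -e cfgK eqxx.
Qed.

Lemma ann_annV x y m (v : 'M[C]_(n, m)) :
  ann R x *m (ann R y *m v) = - (ann R y *m (ann R x *m v)).
Proof.
apply: matP => s k; rewrite [RHS]mxE !annE.
case: (eqVneq x y) => [->|xy].
  by rewrite fillE eqxx /= mulr0; case: ifP; rewrite oppr0.
rewrite !fillE [y == x]eq_sym (negPf xy) /= (fillC s x y).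
case sx: (s x); case sy: (s y); rewrite ?mulr0 ?oppr0 //.
rewrite (jw_fill y) ?sx // (jw_fill x) ?sy // (before_neq xy).
by case: (before y x) => /=; ring.
Qed.

Lemma ann_creV x y m (v : 'M[C]_(n, m)) :
  ann R x *m (cre R y *m v) = (x == y)%:R *: v - cre R y *m (ann R x *m v).
Proof.
apply: matP => s k; rewrite [RHS]mxE [X in X + _]mxE [X in _ + X]mxE.
rewrite !(annE, creE).
case: (eqVneq x y) => [->|xy].
  rewrite fillE emptyE eqxx /=; case sy: (s y) => /=.
    rewrite jw_empty // /before ltnn fill_empty // expr0 mul1r mulrA jw_sqr.
    by rewrite !mul1r subrr.
  by rewrite jw_fill_same empty_fill ?sy // mulrA jw_sqr subr0.
rewrite fillE emptyE [y == x]eq_sym xy (negPf xy) /= (fill_emptyC _ xy) mul0r add0r.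
case sx: (s x); case sy: (s y); rewrite ?mulr0 ?oppr0 //.
rewrite (jw_fill y) ?sx // (jw_empty x) ?sy // (before_neq xy).
by case: (before y x) => /=; ring.
Qed.

Lemma mulmx_ext m (A B : 'M[C]_(m, n)) : (forall v : 'M[C]_n, A *m v = B *m v) -> A = B.
Proof. by move=> h; rewrite -[A]mulmx1 h mulmx1. Qed.

Lemma ann_ann x y : ann R x *m ann R y = - (ann R y *m ann R x).
Proof. by apply: mulmx_ext => v; rewrite mulNmx -!mulmxA ann_annV. Qed.

Lemma ann_cre x y : ann R x *m cre R y = (x == y)%:R%:M - cre R y *m ann R x.
Proof. by apply: mulmx_ext => v; rewrite mulmxBl mul_scalar_mx -!mulmxA ann_creV. Qed.

Lemma adjM (A B : op) : adj (A *m B) = adj B *m adj A.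
Proof.
apply/matrixP => i j; rewrite !mxE rmorph_sum; apply: eq_bigr => k _.
by rewrite !mxE rmorphM mulrC.
Qed.

Lemma adjK (A : op) : adj (adj A) = A.
Proof. by apply/matrixP => i j; rewrite !mxE conjCK. Qed.

Lemma adjD (A B : op) : adj (A + B) = adj A + adj B.
Proof. by apply/matrixP => i j; rewrite !mxE rmorphD. Qed.

Lemma adjZ a (A : op) : adj (a *: A) = a^* *: adj A.
Proof. by apply/matrixP => i j; rewrite !mxE rmorphM. Qed.

Lemma adj_sum (I : finType) (P : pred I) (F : I -> op) :
  adj (\sum_(i | P i) F i) = \sum_(i | P i) adj (F i).
Proof.
apply/matrixP => i j; rewrite !mxE !summxE rmorph_sum; apply: eq_bigr => k _; by rewrite mxE.
Qed.

(** Second quantization of the spin matrix [p] acting alike on every site. It respects adjoints and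
    commutators, so the three spin components are handled together. *)
Definition bil (p : bool -> bool -> C) : op :=
  \sum_x \sum_(sg : bool) \sum_(tau : bool) p sg tau *: (cre R (x, sg) *m ann R (x, tau)).

Lemma spin_totE a : spin_tot R d L a = bil (fun sg tau => 2^-1 * pauli R a sg tau).
Proof.
apply: eq_bigr => x _; rewrite /spin_op scaler_sumr; apply: eq_bigr => sg _.
by rewrite scaler_sumr; apply: eq_bigr => tau _; rewrite scalerA.
Qed.

Lemma ann_bil p (y : lsite d L) rho : ann R (y, rho) *m bil p =
  bil p *m ann R (y, rho) + \sum_(tau : bool) p rho tau *: ann R (y, tau).
Proof.
rewrite /bil mulmx_sumr mulmx_suml (bigD1 y) //= [X in _ = X + _](bigD1 y) //=.
rewrite addrAC; congr (_ + _); last first.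
  apply: eq_bigr => x xy; rewrite mulmx_sumr mulmx_suml; apply: eq_bigr => sg _.
  rewrite mulmx_sumr mulmx_suml; apply: eq_bigr => tau _.
  rewrite -scalemxAr -scalemxAl; congr (_ *: _).
  rewrite mulmxA ann_cre xpair_eqE eq_sym (negPf xy) /= raddf0 sub0r mulNmx -(mulmxA _ (ann R (y, rho))) ann_ann.
  by rewrite mulmxN opprK mulmxA.
rewrite mulmx_sumr mulmx_suml.
have h sg tau : ann R (y, rho) *m (p sg tau *: (cre R (y, sg) *m ann R (y, tau))) =
   p sg tau *: (cre R (y, sg) *m ann R (y, tau)) *m ann R (y, rho) + (if sg == rho then p rho tau *: ann R (y, tau) else 0).
  rewrite -scalemxAr -scalemxAl mulmxA ann_cre xpair_eqE eqxx /= eq_sym mulmxBl mul_scalar_mx.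
  rewrite -(mulmxA _ (ann R (y, rho))) ann_ann mulmxN opprK mulmxA scalerDr addrC; congr (_ + _).
  by case: eqP => [->|_]; rewrite ?scale1r // scale0r scaler0.
have -> : \sum_(sg : bool) ann R (y, rho) *m (\sum_(tau : bool) p sg tau *: (cre R (y, sg) *m ann R (y, tau))) =
   \sum_(sg : bool) (\sum_(tau : bool) p sg tau *: (cre R (y, sg) *m ann R (y, tau))) *m ann R (y, rho) +
   \sum_(sg : bool) \sum_(tau : bool) (if sg == rho then p rho tau *: ann R (y, tau) else 0).
  rewrite -big_split; apply: eq_bigr => sg _; rewrite mulmx_sumr mulmx_suml -big_split.
  by apply: eq_bigr => tau _; apply: h.
congr (_ + _); rewrite (bigD1 rho) //= [X in _ + X]big1 ?addr0; last first.
  by move=> sg /negPf sr; rewrite big1 // => tau _; rewrite sr.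
by apply: eq_bigr => tau _; rewrite eqxx.
Qed.

Lemma adj_bil p : adj (bil p) = bil (fun sg tau => (p tau sg)^*).
Proof.
rewrite /bil adj_sum; apply: eq_bigr => x _; rewrite adj_sum [RHS]exchange_big /=.
apply: eq_bigr => sg _; rewrite adj_sum; apply: eq_bigr => tau _.
by rewrite adjZ adjM /cre adjK.
Qed.

Lemma bil_cre p (y : lsite d L) rho : bil p *m cre R (y, rho) =
  cre R (y, rho) *m bil p + \sum_(sg : bool) p sg rho *: cre R (y, sg).
Proof.
have := ann_bil (fun sg tau => (p tau sg)^*) y rho.
move/(congr1 (@adj R d L)); rewrite adjM adjD adjM adj_bil adj_sum.
have -> : bil (fun sg tau => ((p sg tau)^*)^*) = bil p.
  by apply: eq_bigr => x _; apply: eq_bigr => sg _; apply: eq_bigr => tau _; rewrite conjCK.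
move=> ->; congr (_ + _); apply: eq_bigr => sg _; by rewrite adjZ conjCK.
Qed.

Lemma bil_comm p q : bil p *m bil q - bil q *m bil p =
  bil (fun sg tau => \sum_(rho : bool) (p sg rho * q rho tau - q sg rho * p rho tau)).
Proof.
have h (x : lsite d L) sg tau : bil p *m (cre R (x, sg) *m ann R (x, tau)) =
   (cre R (x, sg) *m ann R (x, tau)) *m bil p
   + (\sum_(rho : bool) p rho sg *: (cre R (x, rho) *m ann R (x, tau))
   - \sum_(rho : bool) p tau rho *: (cre R (x, sg) *m ann R (x, rho))).
  rewrite mulmxA bil_cre mulmxDl -mulmxA.
  have -> : bil p *m ann R (x, tau) = ann R (x, tau) *m bil p - \sum_(rho : bool) p tau rho *: ann R (x, rho).
    by rewrite ann_bil addrK.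
  rewrite mulmxBr mulmxA -addrA [- _ + _]addrC; congr (_ + (_ - _)).
    by rewrite mulmx_suml; apply: eq_bigr => rho _; rewrite -scalemxAl.
  by rewrite mulmx_sumr; apply: eq_bigr => rho _; rewrite -scalemxAr.
apply/eqP; rewrite subr_eq; apply/eqP.
rewrite {2}/bil {2}/bil {1}/bil mulmx_sumr mulmx_suml -big_split.
apply: eq_bigr => x _ /=; rewrite -spin_comm_sum mulmx_sumr mulmx_suml -big_split.
apply: eq_bigr => sg _; rewrite mulmx_sumr mulmx_suml -big_split.
by apply: eq_bigr => tau _; rewrite -scalemxAr h scalerDr [LHS]addrC /= [X in _ + X = _]scalemxAl.
Qed.

End Fock.
Arguments bil {R d L} p.

Lemma mulmx_extv (K : pzSemiRingType) m n (A B : 'M[K]_(m, n)) :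
  (forall v : 'cV_n, A *m v = B *m v) -> A = B.
Proof.
move=> h; apply/matrixP => i j.
by have := congr1 (fun w : 'cV_m => w i 0) (h (delta_mx j 0)); rewrite -!colE !mxE.
Qed.

(** The entry at index [c o] reads off the coefficient of [Phi o], so [P] is the sum of the rank-one
    matrices [Phi o *m row (c o) P]. This computes the trace in a basis that need not be
    orthogonal. *)
Lemma trace_basis (K : comPzRingType) n (D P : 'M[K]_n) (I : finType) (Q : pred I)
    (Phi : I -> 'cV[K]_n) (c : I -> 'I_n) (f : I -> K) :
    (forall o, Q o -> P *m Phi o = Phi o) ->
    (forall k, col k P = \sum_(o | Q o) P (c o) k *: Phi o) ->
    (forall o, Q o -> Phi o (c o) 0 = 1) ->
    (forall o, Q o -> D *m Phi o = f o *: Phi o) ->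
  \tr (D *m P) = \sum_(o | Q o) f o.
Proof.
move=> hP hspan hc hD.
have -> : P = \sum_(o | Q o) Phi o *m row (c o) P.
  apply/matrixP => i k; have := congr1 (fun w : 'cV_n => w i 0) (hspan k).
  rewrite !mxE !summxE => ->; apply: eq_bigr => o _.
  by rewrite !mxE big_ord1 !mxE mulrC.
rewrite mulmx_sumr raddf_sum /=; apply: eq_bigr => o Qo.
rewrite mulmxA hD // -scalemxAl mxtraceZ mxtrace_mulC -row_mul hP //.
by rewrite /mxtrace big_ord1 mxE hc // mulr1.
Qed.

(** Both sides times [z] are traces of a product with one commutator, namely [A [B, C] rho] and
    [[A, B] C rho]; they agree by cyclicity because [B] commutes with [rho]. *)
Lemma su2_trace (K : fieldType) n (A B C rho : 'M[K]_n) (z : K) : z != 0 ->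
    A *m B - B *m A = z *: C -> B *m C - C *m B = z *: A -> B *m rho = rho *m B ->
  \tr (A *m A *m rho) = \tr (C *m C *m rho).
Proof.
move=> z0 hAB hBC hB; apply: (mulfI z0); rewrite -!mxtraceZ.
have -> : z *: (A *m A *m rho) = A *m (z *: A) *m rho by rewrite -scalemxAr scalemxAl.
have -> : z *: (C *m C *m rho) = (z *: C) *m C *m rho by rewrite -!scalemxAl.
rewrite -hBC -hAB mulmxBr !mulmxBl !raddfB /=; congr (_ - _); first by rewrite !mulmxA.
by rewrite mulmxA -(mulmxA _ B) hB mulmxA mxtrace_mulC !mulmxA.
Qed.

Lemma bond_sum (K : comPzRingType) (V : lmodType K) (A1 A2 A3 : V) (x y z : bool -> V) (p : bool -> K) l :
  (A1 + \sum_(t : bool) p t *: x t) + (A2 + \sum_(t : bool) p t *: y t)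
    + l *: (A3 + \sum_(t : bool) p t *: z t) =
  (A1 + A2 + l *: A3) + \sum_(t : bool) p t *: (x t + y t + l *: z t).
Proof.
rewrite scalerDr (addrACA A1) (addrACA (A1 + A2)); congr (_ + _).
rewrite scaler_sumr -!big_split; apply: eq_bigr => t _ /=.
by rewrite !scalerDr !scalerA [p t * _]mulrC.
Qed.

(** * The kernel of the Hamiltonian and its SU(2) symmetry *)

Section Kernel.
Variables (R : realType) (d L : nat).
Notation C := R[i].
Notation op := 'M[C]_(fdim d L).
Notation n := (fdim d L).
Implicit Types (s t : fock d L) (v w : 'cV[C]_n).

Definition gs (lam : R) v :=
  (forall (b : bond d L) sg, bond_op lam b sg *m v = 0) /\
  (forall x : lsite d L, ann R (x, true) *m (ann R (x, false) *m v) = 0).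

Definition quad (A : op) v : C := \sum_i (v i 0)^* * (A *m v) i 0.

Lemma quad_adj (B : op) v : quad (adj B *m B) v = \sum_k `|(B *m v) k 0| ^+ 2.
Proof.
rewrite /quad -mulmxA.
under eq_bigr => i _ do rewrite mxE mulr_sumr.
rewrite exchange_big /=; apply: eq_bigr => k _.
rewrite normCK mulrC [X in _ = X^* * _]mxE rmorph_sum mulr_suml; apply: eq_bigr => i _.
by rewrite !mxE rmorphM mulrA; congr (_ * _); rewrite mulrC.
Qed.

Lemma quad_adj_ge0 (B : op) v : 0 <= quad (adj B *m B) v.
Proof. by rewrite quad_adj sumr_ge0 // => k _; rewrite exprn_ge0. Qed.

Lemma psum_eq0 (I : finType) (F : I -> C) :
  (forall i, 0 <= F i) -> \sum_i F i = 0 -> forall i, F i = 0.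
Proof. by move=> F0 h i; apply: (psumr_eq0P (P := xpredT)). Qed.

Lemma quad_adj_eq0 (B : op) v : quad (adj B *m B) v = 0 -> B *m v = 0.
Proof.
rewrite quad_adj => h; apply/matrixP => k j; rewrite ord1 [RHS]mxE.
have := psum_eq0 (fun k => exprn_ge0 2 (normr_ge0 ((B *m v) k 0))) h k.
by move/eqP; rewrite sqrf_eq0 normr_eq0 => /eqP.
Qed.

Lemma quadD (A B : op) v : quad (A + B) v = quad A v + quad B v.
Proof. by rewrite -big_split; apply: eq_bigr => i _; rewrite mulmxDl mxE mulrDr. Qed.

Lemma quadZ a (A : op) v : quad (a *: A) v = a * quad A v.
Proof. by rewrite mulr_sumr; apply: eq_bigr => i _; rewrite -scalemxAl mxE mulrCA. Qed.

Lemma quad_sum (I : finType) (F : I -> op) v : quad (\sum_i F i) v = \sum_i quad (F i) v.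
Proof.
rewrite /quad exchange_big; apply: eq_bigr => i _; rewrite mulmx_suml summxE mulr_sumr.
by [].
Qed.

Definition pair_op (x : lsite d L) : op := ann R (x, false) *m ann R (x, true).

Lemma num_pair (x : lsite d L) :
  num_op R (x, true) *m num_op R (x, false) = adj (pair_op x) *m pair_op x.
Proof.
rewrite /num_op /pair_op adjM -!/(cre _ _) mulmxA -(mulmxA (cre R (x, true))) ann_cre.
rewrite xpair_eqE eqxx /= raddf0 sub0r mulmxN mulNmx -!mulmxA.
by rewrite [X in - (_ *m (_ *m X))]ann_ann !mulmxN opprK.
Qed.

Lemma psd_kernel (I J K M : finType) (A : I -> J -> op) (B : K -> op) (D : M -> op) (a b c : C) v :
    0 < a -> 0 < b -> 0 < c ->
  (\sum_i \sum_j a *: (adj (A i j) *m A i j)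
     + (b *: \sum_k adj (B k) *m B k + c *: \sum_m adj (D m) *m D m)) *m v = 0 <->
  [/\ forall i j, A i j *m v = 0, forall k, B k *m v = 0 & forall m, D m *m v = 0].
Proof.
move=> a0 b0 c0; have a0' := ltW a0; have b0' := ltW b0; have c0' := ltW c0.
set E := (X in X *m v); split=> [h|[hA hB hD]]; last first.
  rewrite /E !mulmxDl -!scalemxAl !mulmx_suml big1 ?add0r => [|i _].
    rewrite big1 => [|k _]; last by rewrite -mulmxA hB mulmx0.
    rewrite big1 => [|k _]; last by rewrite -mulmxA hD mulmx0.
    by rewrite !scaler0 addr0.
  by rewrite mulmx_suml big1 // => j _; rewrite -scalemxAl -mulmxA hA mulmx0 scaler0.
have : quad E v = 0 by rewrite /quad h big1 // => i _; rewrite mxE mulr0.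
have q0 i j : 0 <= quad (a *: (adj (A i j) *m A i j)) v by rewrite quadZ mulr_ge0 // quad_adj_ge0.
have q1 i : 0 <= quad (\sum_j a *: (adj (A i j) *m A i j)) v.
  by rewrite quad_sum; apply: sumr_ge0 => j _.
have s0 (T : finType) (F : T -> op) : 0 <= \sum_k quad (adj (F k) *m F k) v.
  by apply: sumr_ge0 => k _; apply: quad_adj_ge0.
rewrite /E quadD quadD !quadZ !quad_sum => /eqP.
rewrite paddr_eq0; last by rewrite addr_ge0 // mulr_ge0.
  rewrite paddr_eq0 ?mulr_ge0 // !mulf_eq0 (gt_eqF b0) (gt_eqF c0) /= => /and3P[/eqP h1 /eqP h2 /eqP h3].
  split=> [i j|k|m].
  - have := psum_eq0 q1 h1 i; rewrite quad_sum => /(psum_eq0 (q0 i))/(_ j)/eqP.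
    by rewrite quadZ mulf_eq0 gt_eqF //= => /eqP/quad_adj_eq0.
  - exact: quad_adj_eq0 (psum_eq0 (fun k => quad_adj_ge0 (B k) v) h2 k).
  - exact: quad_adj_eq0 (psum_eq0 (fun k => quad_adj_ge0 (D k) v) h3 m).
by apply: sumr_ge0 => i _; apply: q1.
Qed.

Lemma H_intE (U U' : R) : H_int d L U U' =
  (U%:C)%C *: \sum_u adj (pair_op (vsite u)) *m pair_op (vsite u)
     + (U'%:C)%C *: \sum_b adj (pair_op (msite b)) *m pair_op (msite b).
Proof.
have e1 : \sum_u num_op R (vsite u, true) *m num_op R (vsite u, false) =
    \sum_(u : site d L) adj (pair_op (vsite u)) *m pair_op (vsite u).
  by apply: eq_bigr => u _; exact: num_pair.
have e2 : \sum_b num_op R (msite b, true) *m num_op R (msite b, false) =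
    \sum_(b : bond d L) adj (pair_op (msite b)) *m pair_op (msite b).
  by apply: eq_bigr => b _; exact: num_pair.
exact: (f_equal2 (fun x y : op => (U%:C)%C *: x + (U'%:C)%C *: y) e1 e2).
Qed.

Lemma gs_Ham (t lam U U' : R) v : 0 < t -> 0 < U -> 0 < U' ->
  (Ham d L t lam U U' *m v = 0) <-> gs lam v.
Proof.
move=> t0 U0 U0'; have c0 (r : R) : 0 < r -> 0 < (r%:C)%C :> C by rewrite ltcR.
rewrite /Ham H_intE /H_hop.
apply: (iff_trans (psd_kernel (fun sg b => bond_op lam b sg) (fun u => pair_op (vsite u))
   (fun b => pair_op (msite b)) v (c0 _ t0) (c0 _ U0) (c0 _ U0'))).
have hp x : pair_op x *m v = 0 <-> ann R (x, true) *m (ann R (x, false) *m v) = 0.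
  rewrite ann_annV mulmxA -/(pair_op x); split=> [->|/eqP]; first by rewrite oppr0.
  by rewrite oppr_eq0 => /eqP.
split=> [[h1 h2 h3]|[h1 h2]]; split=> //.
- by case=> [u|b]; apply/hp; [exact: h2 | exact: h3].
- by move=> u; apply/hp; exact: h2.
- by move=> b; apply/hp; exact: h2.
Qed.

Lemma ann_bilV p (y : lsite d L) sg v : ann R (y, sg) *m (bil p *m v) =
  bil p *m (ann R (y, sg) *m v) + \sum_(tau : bool) p sg tau *: (ann R (y, tau) *m v).
Proof.
rewrite mulmxA ann_bil mulmxDl -mulmxA; congr (_ + _).
by rewrite mulmx_suml; apply: eq_bigr => tau _; rewrite -scalemxAl.
Qed.

Lemma bondE lam (b : bond d L) sg v : bond_op lam b sg *m v =
  ann R (vsite (bond_fst b), sg) *m v + ann R (vsite (bond_snd b), sg) *m v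
  + (lam%:C)%C *: (ann R (msite b, sg) *m v).
Proof. by rewrite /bond_op 2!mulmxDl -scalemxAl. Qed.

Lemma ann_sqrV x v : ann R x *m (ann R x *m v) = 0.
Proof. by apply: matP => s k; rewrite !annE fillE eqxx /= mulr0 mxE; case: ifP. Qed.

(** Commuting [bil p] past an annihilator only mixes the spin index, and the equations hold for both
    spins; terms with two equal annihilators vanish. *)
Lemma gs_bil lam p v : gs lam v -> gs lam (bil p *m v).
Proof.
move=> [hb hd]; split=> [b sg|x].
  rewrite bondE !ann_bilV bond_sum; apply: etrans (_ : 0 + 0 = 0); last by rewrite addr0.
  congr (_ + _); first by rewrite scalemxAr -!mulmxDr -bondE hb mulmx0.
  by rewrite big1 // => tau _; rewrite -bondE hb scaler0.
rewrite ann_bilV mulmxDr ann_bilV hd mulmx0 add0r mulmx_sumr.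
by rewrite !big_bool /= -!scalemxAr !ann_sqrV !hd !scaler0 !addr0.
Qed.

Variables (t lam U U' : R) (P0 : op).
Hypotheses (t0 : 0 < t) (U0 : 0 < U) (U0' : 0 < U').
Hypothesis hP : is_eigenproj (Ham d L t lam U U') 0 P0.

Lemma P0_gs v : P0 *m v = v <-> gs lam v.
Proof.
case: hP => _ [_ h]; rewrite -(gs_Ham lam v t0 U0 U0'); have := h v; rewrite scale0r => e.
by split=> [/eqP|/eqP]; [rewrite -e => /eqP | rewrite e => /eqP].
Qed.

Lemma gs_P0 v : gs lam (P0 *m v).
Proof. by apply/P0_gs; case: hP => h _; rewrite mulmxA h. Qed.

(** The range of [P0] is invariant under [bil p] and under its adjoint, again a [bil]; as [P0] is
    self-adjoint, this gives commutation. *)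
Lemma bil_P0 (p : bool -> bool -> C) : bil p *m P0 = P0 *m bil p.
Proof.
have h q : P0 *m bil q *m P0 = bil q *m P0.
  apply: mulmx_extv => v; rewrite -!mulmxA; apply/P0_gs/gs_bil/gs_P0.
case: (hP) => _ [hadj _].
rewrite -h -[RHS]adjK adjM hadj adj_bil -h !adjM hadj -adj_bil adjK mulmxA.
by [].
Qed.

Definition ecount s : nat := #|[set y | s y]|.

Lemma expNeE (mu : R) m (v : 'M[C]_(n, m)) s k :
  (expNe d L mu *m v) (idx s) k = (expR (mu * (ecount s)%:R))%:C%C * v (idx s) k.
Proof.
rewrite mxE (bigD1 (idx s)) //= big1 ?addr0 => [|j js].
  by rewrite mxE eqxx /ecount; congr ((expR (_ * _%:R))%:C%C * _); apply: eq_card => y; rewrite !inE idxK.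
by rewrite mxE eq_sym (negPf js) mul0r.
Qed.

Lemma ecount_fill s y : ~~ s y -> ecount (fill s y) = (ecount s).+1.
Proof.
move=> sy; rewrite /ecount (_ : [set _ | _] = y |: [set z | s z]) ?cardsU1 ?inE ?sy //.
by apply/setP => z; rewrite !inE fillE.
Qed.

Lemma ecount_empty s y : s y -> ecount s = (ecount (empty_at s y)).+1.
Proof. by move=> sy; rewrite -{1}(fill_empty sy) ecount_fill // emptyE eqxx. Qed.

Lemma expNe_bil (mu : R) (p : bool -> bool -> C) : bil p *m expNe d L mu = expNe d L mu *m bil p.
Proof.
rewrite /bil mulmx_suml mulmx_sumr; apply: eq_bigr => x _.
rewrite mulmx_suml mulmx_sumr; apply: eq_bigr => sg _.
rewrite mulmx_suml mulmx_sumr; apply: eq_bigr => tau _.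
rewrite -scalemxAl -scalemxAr; congr (_ *: _); apply: mulmx_ext => v.
rewrite -!mulmxA; apply: matP => s k; rewrite expNeE !creE.
case sx: (s _); last by rewrite mulr0.
rewrite !annE; case st: (empty_at _ _ _); first by rewrite !mulr0.
rewrite expNeE ecount_fill ?st // -(ecount_empty sx).
by rewrite ![(expR _)%:C%C * _]mulrC !mulrA.
Qed.

Definition rho (mu : R) : op := expNe d L mu *m P0.

Lemma bil_rho (mu : R) (p : bool -> bool -> C) : bil p *m rho mu = rho mu *m bil p.
Proof. by rewrite /rho mulmxA expNe_bil -mulmxA bil_P0 mulmxA. Qed.

Notation o0 := (0 : 'I_3).
Notation o1 := (1 : 'I_3).
Notation o2 := (2%:R : 'I_3).

Lemma spin_comm (a b c : 'I_3) : (b : nat) = (a.+1 %% 3)%N -> (c : nat) = (a.+2 %% 3)%N ->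
  spin_tot R d L a *m spin_tot R d L b - spin_tot R d L b *m spin_tot R d L a
  = 'i *: spin_tot R d L c.
Proof.
move=> hb hc; rewrite !spin_totE bil_comm /bil scaler_sumr.
have i2 : 'i * 'i = -1 :> C by rewrite -expr2 sqrCi.
apply: eq_bigr => x _; rewrite scaler_sumr; apply: eq_bigr => sg _.
rewrite scaler_sumr; apply: eq_bigr => tau _; rewrite scalerA; congr (_ *: _).
rewrite /pauli hb hc big_bool.
case: a {hb hc} => [[|[|[|//]]] ?]; case: sg; case: tau => /=; field: i2; try by [].
Qed.
End Kernel.

(** * Reduction to operators diagonal in the occupation basis *)

Section Diagonal.
Variables (R : realType) (d L : nat).
Notation C := R[i].
Notation op := 'M[C]_(fdim d L).
Notation n := (fdim d L).
Implicit Types (s : fock d L).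

Lemma tr_spin_sq (t lam U U' mu : R) (P0 : op) : 0 < t -> 0 < U -> 0 < U' ->
    is_eigenproj (Ham d L t lam U U') 0 P0 ->
  \tr (spin_tot_sq R d L *m expNe d L mu *m P0) =
  3 * \tr (spin_tot R d L ord_max *m spin_tot R d L ord_max *m (expNe d L mu *m P0)).
Proof.
move=> t0 U0 U0' hP; rewrite -mulmxA /spin_tot_sq.
have i0 : 'i != 0 :> C by apply: neq0Ci.
have h (a b c : 'I_3) : (b : nat) = (a.+1 %% 3)%N -> (c : nat) = (a.+2 %% 3)%N -> (a : nat) = (c.+1 %% 3)%N ->
    \tr (spin_tot R d L a *m spin_tot R d L a *m rho P0 mu) =
    \tr (spin_tot R d L c *m spin_tot R d L c *m rho P0 mu).
  move=> hb hc ha; apply: (su2_trace (B := spin_tot R d L b) i0).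
  - exact: spin_comm hb hc.
  - apply: spin_comm; first by rewrite hb hc; case: (a) => [[|[|[|]]]].
    by rewrite hb ha hc; case: (a) => [[|[|[|]]]].
  - by rewrite spin_totE (bil_rho t0 U0 U0' hP).
rewrite !big_ord_recr big_ord0 /= add0r 2!mulmxDl 2!raddfD /= -/(rho P0 mu).
set a0 := widen_ord _ (widen_ord _ ord_max); set a1 := widen_ord _ ord_max.
have sum3 (x y z : C) : y = x -> x = z -> x + y + z = 3 * z by move=> -> ->; ring.
exact: sum3 (h a1 ord_max a0 erefl erefl erefl) (h a0 a1 ord_max erefl erefl erefl).
Qed.

Definition nspin (sg : bool) s : nat := (\sum_x s (x, sg))%N.

Lemma ecountE s : ecount s = (nspin true s + nspin false s)%N.
Proof.
rewrite /ecount -sum1_card big_mkcond /=.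
rewrite (eq_bigr (fun y : mode d L => (s (y.1, y.2) : nat))) => [|[x sg] _]; last first.
  by rewrite inE /=; case: (s _).
rewrite -(pair_bigA _ (fun x sg => (s (x, sg) : nat))) /= -big_split.
by apply: eq_bigr => x _; rewrite big_bool.
Qed.

Lemma num_opE y m (v : 'M[C]_(n, m)) s k :
  (num_op R y *m v) (idx s) k = (s y)%:R * v (idx s) k.
Proof.
rewrite /num_op -mulmxA creE; case sy: (s y); last by rewrite mul0r.
by rewrite annE emptyE eqxx /= jw_empty // /before ltnn fill_empty // expr0 mul1r mulrA jw_sqr.
Qed.

Lemma sumV (I : finType) (P : pred I) (F : I -> op) m (v : 'M[C]_(n, m)) i k :
  ((\sum_(j | P j) F j) *m v) i k = \sum_(j | P j) (F j *m v) i k.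
Proof. by rewrite mulmx_suml summxE. Qed.

Lemma NeE m (v : 'M[C]_(n, m)) s k :
  (Ne R d L *m v) (idx s) k = (ecount s)%:R * v (idx s) k.
Proof.
rewrite /Ne sumV ecountE /nspin -big_split natr_sum mulr_suml; apply: eq_bigr => x _.
by rewrite mulmxDl mxE !num_opE natrD mulrDl.
Qed.

Definition magn s : C := ((nspin true s)%:R - (nspin false s)%:R) / 2.

Lemma spin_zE m (v : 'M[C]_(n, m)) s k :
  (spin_tot R d L ord_max *m v) (idx s) k = magn s * v (idx s) k.
Proof.
rewrite /spin_tot sumV /magn /nspin !natr_sum -sumrB !mulr_suml; apply: eq_bigr => x _.
rewrite /spin_op -scalemxAl !big_bool /pauli /= !scale0r addr0 add0r scale1r scaleN1r.
rewrite mxE mulmxDl mulNmx mxE [X in _ + X]mxE -!/(num_op R _) !num_opE; ring.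
Qed.
End Diagonal.

(** * The space of zero-energy states *)

Lemma enum_rankE (T : finType) (x : T) : enum_rank x = index x (enum T) :> nat.
Proof. by rewrite -[x in RHS]enum_rankK /enum_val index_uniq ?enum_uniq // -cardE. Qed.

Lemma index_pair_bool (T : eqType) (s : seq T) x b : x \in s ->
  index (x, b) [seq (y, c) | y <- s, c <- [:: true; false]] = ((index x s).*2 + ~~ b)%N.
Proof.
elim: s => [//|y s IH]; rewrite inE /= !xpair_eqE; case: (eqVneq y x) => [<- _|neq].
  by case: (b).
by move=> /= /IH ->; rewrite doubleS.
Qed.

(** Pairs are enumerated lexicographically, [true] first. Hence the two spin modes of a site are
    consecutive, and a mode of another site precedes both or neither. *)
Lemma enum_rank_pair_bool (T : finType) (x : T) b :
  enum_rank (x, b) = ((enum_rank x).*2 + ~~ b)%N :> nat.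
Proof.
rewrite !enum_rankE -(index_pair_bool b (mem_enum T x)).
congr index; rewrite enumT unlock /= /prod_enum.
by rewrite [enum (_ : finType)]enumT unlock.
Qed.

Lemma card_comps (V : finType) (e : rel V) (A W : {set V}) : symmetric e -> W \subset A ->
  #|W| = (\sum_(C in clusters e A) #|W :&: C|)%N.
Proof.
move=> es WA; transitivity (\sum_(x in A) (x \in W : nat))%N.
  rewrite -sum1_card [LHS]big_mkcond [RHS]big_mkcond; apply: eq_bigr => x _.
  by case: (boolP (x \in W)) => xW; [rewrite (subsetP WA)|case: ifP].
rewrite -[in LHS](cover_comps e A) (big_trivIset _ (trivIset_comps es A)) /=.
apply: eq_bigr => C _; rewrite -sum1_card [LHS]big_mkcond [RHS]big_mkcond; apply: eq_bigr => x _.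
by rewrite inE andbC; case: (x \in C); case: (x \in W).
Qed.

(** Induction on [#|U :\: U'|]: with equal counts, an element [a] of [U] outside [U'] has in its
    cluster some [b] in [U'] outside [U], and [a] is traded for [b]. *)
Lemma swap_invariant (V : finType) (e : rel V) (T : Type) (A : {set V}) (g : {set V} -> T) :
    symmetric e ->
    (forall (U : {set V}) a b, U \subset A -> e a b -> a \in U -> b \in A -> b \notin U ->
       g U = g (b |: U :\ a)) ->
  forall U U' : {set V}, U \subset A -> U' \subset A ->
    (forall C, C \in clusters e A -> #|U :&: C| = #|U' :&: C|) -> g U = g U'.
Proof.
move=> es swap.
(* Induction along a path from [a], extended from [b] to [c]. If [b] is in [U], it is first moved on
   to [c] and then replaced by [a]; otherwise [a] goes to [b] and then to [c]. *)
have far (a b : V) : b \in cluster e A a -> forall U : {set V}, U \subset A -> a \in U -> b \notin U ->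
    g U = g (b |: U :\ a).
  move: b; apply: (cl_ind (P := fun b => _)) => [U _ aU|b c ba IH cA bc U UA aU cU].
    by rewrite aU.
  have bA := subsetP (cl_sub _ _ _) _ ba.
  case: (eqVneq b a) => [ba'|nba]; first by apply: swap => //; rewrite -ba'.
  have nca : c != a by apply: contraNneq cU => ->.
  case: (boolP (b \in U)) => bU.
    have ncb : c != b by apply: contraNneq cU => ->.
    rewrite (swap U b c) // (IH (c |: U :\ b)).
    - congr g; apply/setP => z; rewrite !inE.
      case: (eqVneq z b) => [->|_] /=; first by rewrite nba bU orbT.
      by case: (eqVneq z c) => [->|_] /=; rewrite ?nca.
    - apply/subsetP => z; rewrite !inE => /orP[/eqP->//|/andP[_]]; exact: subsetP.
    - by rewrite !inE [a == b]eq_sym nba aU orbT.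
    - by rewrite !inE [b == c]eq_sym (negPf ncb) eqxx.
  case: (eqVneq b c) => [<-|nbc]; first exact: IH.
  rewrite (IH U) // (swap (b |: U :\ a) b c) //.
  - congr g; apply/setP => z; rewrite !inE.
    by case: (eqVneq z b) => [->|//]; rewrite (negPf bU) andbF.
  - apply/subsetP => z; rewrite !inE => /orP[/eqP->//|/andP[_]]; exact: subsetP.
  - by rewrite !inE eqxx.
  - by rewrite !inE [c == b]eq_sym (negPf nbc) (negPf cU) andbF.
move=> U U'; have [k] := ubnP #|U :\: U'|; elim: k U => // k IH U.
rewrite ltnS => le UA U'A eqC.
case: (set_0Vmem (U :\: U')) => [/eqP|[a]].
  rewrite setD_eq0 => UU'; congr g; apply/eqP; rewrite eqEcard UU' /=.
  by rewrite (card_comps es UA) (card_comps es U'A); apply: eq_leq; apply: eq_bigr => C hC; rewrite eqC.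
rewrite inE => /andP[aU' aU]; have aA := subsetP UA _ aU.
have [C [hC aC eC]] : exists C, [/\ C \in clusters e A, a \in C & C = cluster e A a].
  by exists (cluster e A a); rewrite cl_comps ?mem_cl.
have [b bU' bUC] : exists2 b, b \in U' & (b \notin U) && (b \in C).
  apply/exists_inP; apply: contraT; rewrite negb_exists => /forallP h.
  have : U' :&: C \proper U :&: C.
    apply/properP; split; last by exists a; rewrite inE ?aU ?(negPf aU') ?aC.
    apply/subsetP => z; rewrite !inE => /andP[zU' zC]; rewrite zC andbT.
    by have := h z; rewrite zU' zC andbT /= negbK.
  by move/proper_card; rewrite eqC // ltnn.
have /andP[bU bC] := bUC.
have bA := subsetP (comps_sub hC) _ bC.
have ab : a != b by apply: contraNneq bU => <-.
rewrite (far a b _ U UA aU bU) -?eC //; apply: IH => //.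
- apply: leq_trans le; apply: proper_card; apply/properP; split.
    apply/subsetP => z; rewrite !inE; case: (eqVneq z b) => [->|_] /=; first by rewrite bU'.
    by move=> /andP[-> /andP[_ ->]].
  by exists a; rewrite !inE ?aU ?aU' // eqxx (negPf ab).
- apply/subsetP => z; rewrite !inE => /orP[/eqP->//|/andP[_]]; exact: subsetP.
move=> C' hC'; rewrite -eqC //.
case: (eqVneq C' C) => [->|neq].
  have e1 : (b |: U :\ a) :&: C = b |: (U :&: C) :\ a.
    apply/setP => z; rewrite !inE; case: (eqVneq z b) => [->|_] //=.
    by rewrite andbA.
  rewrite e1 cardsU1 !inE (negPf bU) !andbF add1n.
  by rewrite (cardsD1 a (U :&: C)) !inE aU aC.
have nC' z : z \in C -> z \notin C'.
  by move=> zC; apply: contra neq => zC'; apply/eqP; apply: comps_eq hC' hC zC' zC.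
congr #|pred_of_set _|; apply/setP => z; rewrite !inE.
case: (eqVneq z b) => [->|_] /=; first by rewrite (negPf (nC' _ bC)) !andbF.
by case: (eqVneq z a) => [->|_] //=; rewrite (negPf (nC' _ aC)) andbF.
Qed.

(** * A basis of the kernel *)

Section Basis.
Variables (R : realType) (d L : nat).
Hypothesis L_gt1 : (1 < L)%N.
Notation C := R[i].
Notation op := 'M[C]_(fdim d L).
Notation n := (fdim d L).
Notation V := (site d L).
Notation nearest := (@nearest d L).
Notation N := #|{: V}|.
Implicit Types (s : fock d L) (x y : mode d L) (v w : 'cV[C]_n).

Lemma before_up (x z : lsite d L) b b' : z != x ->
  before (x, true) (z, b) = before (x, false) (z, b') /\
  before (z, b) (x, true) = before (z, b') (x, false).
Proof.
move=> zx; have ne : enum_rank z != enum_rank x :> nat.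
  by rewrite (inj_eq (@ord_inj _)) (inj_eq enum_rank_inj).
rewrite /before !enum_rank_pair_bool; move: (nat_of_ord (enum_rank z)) (nat_of_ord (enum_rank x)) ne => p q pq.
by split; apply/idP/idP; case: b; case: b' => /=; lia.
Qed.

Lemma jw_flip s (x : lsite d L) : s (x, true) = false -> s (x, false) = false ->
  jw_sign R s (x, true) = jw_sign R s (x, false).
Proof.
move=> h1 h2; rewrite !jwE; apply: eq_bigl => -[z b].
case: (eqVneq z x) => [->|zx]; first by case: b; rewrite ?h1 ?h2 !andbF.
by have [_ ->] := before_up b b zx.
Qed.

Definition bond_up (b : bond d L) sg v : 'cV[C]_n :=
  ann R (vsite (bond_fst b), sg) *m v + ann R (vsite (bond_snd b), sg) *m v.

Lemma pair_amp x y v s : (ann R x *m (ann R y *m v)) (idx s) 0 =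
  if s x then 0 else jw_sign R s x *
    (if fill s x y then 0 else jw_sign R (fill s x) y * v (idx (fill (fill s x) y)) 0).
Proof. by rewrite !annE. Qed.

Definition single v := forall u : V, ann R (vsite u, true) *m (ann R (vsite u, false) *m v) = 0.

(** [c] records the order of two modes on different sites; the two terms see opposite orders, hence
    carry opposite signs. *)
Lemma sign_cancel (a b x y : C) (c : bool) : a * a = 1 -> b * b = 1 ->
  a * ((-1) ^+ (~~ c) * b * x) + b * ((-1) ^+ c * a * y) = 0 <-> x = y.
Proof.
move=> ha hb; have nz : a * b * (-1) ^+ c != 0.
  rewrite !mulf_neq0 ?signr_eq0 //; apply/eqP => e; [move: ha | move: hb];
  by rewrite e mulr0 => /eqP; rewrite eq_sym oner_eq0.
have -> : a * ((-1) ^+ (~~ c) * b * x) + b * ((-1) ^+ c * a * y) = a * b * (-1) ^+ c * (y - x).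
  by rewrite signrN; ring.
split=> [/eqP|->]; last by rewrite subrr mulr0.
by rewrite mulf_eq0 (negPf nz) subr_eq0 => /eqP.
Qed.

Lemma bond_up2E (b : bond d L) v : single v ->
  bond_up b true (bond_up b false v) =
  ann R (vsite (bond_fst b), true) *m (ann R (vsite (bond_snd b), false) *m v)
  + ann R (vsite (bond_snd b), true) *m (ann R (vsite (bond_fst b), false) *m v).
Proof. by move=> h; rewrite /bond_up !mulmxDr !h add0r addr0. Qed.

Lemma bond_neq (b : bond d L) : bond_fst b != bond_snd b.
Proof.
rewrite /bond_fst /bond_snd; apply/eqP => /ffunP/(_ b.2); rewrite shiftE eqxx.
move/(congr1 val) => /= h; have lt := ltn_ord (b.1 b.2).
case: (ltnP (b.1 b.2).+1 L) => h'; first by move: h; rewrite modn_small //; lia.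
have e : (b.1 b.2).+1 = L by lia.
by move: h; rewrite e modnn; lia.
Qed.

Definition hop_up s (a b : V) := fill (fill s (vsite a, true)) (vsite b, false).

(* No sign appears because the two spin modes of a site are adjacent in the
   enumeration of the modes underlying the Jordan-Wigner signs. *)
Lemma bond_up2_swap (b : bond d L) v s : single v ->
    (forall sg, s (vsite (bond_fst b), sg) = false) ->
    (forall sg, s (vsite (bond_snd b), sg) = false) ->
  (bond_up b true (bond_up b false v)) (idx s) 0 = 0 <->
  v (idx (hop_up s (bond_fst b) (bond_snd b))) 0 =
  v (idx (hop_up s (bond_snd b) (bond_fst b))) 0.
Proof.
move=> hv; rewrite bond_up2E //; have := bond_neq b.
move: (bond_fst b) (bond_snd b) => p q pq hp hq; rewrite mxE !pair_amp !hp !hq !fillE !hp !hq.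
have pq' : vsite q != vsite p by apply: contra pq => /eqP[->].
have pf : (vsite p == vsite q) = false by rewrite eq_sym (negPf pq').
rewrite !xpair_eqE pf (negPf pq') /=.
rewrite !jw_fill ?hp ?hq // !jw_flip ?hp ?hq //.
have -> : before (vsite p, true) (vsite q, false) = ~~ before (vsite q, true) (vsite p, false).
  have [-> _] := before_up false true pq'.
  by rewrite before_neq // xpair_eqE pf.
by apply: sign_cancel; apply: jw_sqr.
Qed.

Lemma gs_bond_up lam (b : bond d L) sg v : gs lam v ->
  bond_up b sg v = - ((lam%:C)%C *: (ann R (msite b, sg) *m v)).
Proof. by move=> [h _]; apply/eqP; rewrite -addr_eq0 /bond_up -bondE h. Qed.

Lemma bond_up_ann (b : bond d L) sg y v :
  bond_up b sg (ann R y *m v) = - (ann R y *m bond_up b sg v).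
Proof. by rewrite /bond_up mulmxDr opprD -!ann_annV. Qed.

Lemma bond_up_lin (b : bond d L) sg (a : C) v w :
  bond_up b sg (v + a *: w) = bond_up b sg v + a *: bond_up b sg w.
Proof. by rewrite /bond_up !mulmxDr -!scalemxAr addrACA scalerDr. Qed.

(** The bond equations replace both sums over the ends of [b] by multiples of midpoint annihilators,
    and the midpoint is not doubly occupied. This is the origin of the exchange symmetry. *)
Lemma gs_bond_up2 lam (b : bond d L) v : gs lam v -> bond_up b true (bond_up b false v) = 0.
Proof.
move=> h; rewrite (gs_bond_up b false h) -scaleNr -[_ *: _]add0r bond_up_lin bond_up_ann.
rewrite (gs_bond_up b true h) mulmxN -scalemxAr ann_annV; case: h => _ ->.
by rewrite oppr0 scaler0 !oppr0 scaler0 addr0 /bond_up !mulmx0 addr0.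
Qed.

Definition mfree s := [forall b : bond d L, forall sg, ~~ s (msite b, sg)].

(** Induction on the number of midpoint electrons: the bond equation, read at [s] with one such
    electron removed, expresses the amplitude at [s] by amplitudes with fewer of them. *)
Lemma gs_zero lam v : lam != 0 -> gs lam v ->
  (forall s, mfree s -> v (idx s) 0 = 0) -> v = 0.
Proof.
move=> l0 [hb _] h0; apply: matP => s k; rewrite ord1 [RHS]mxE.
pose mc s := #|[set p : bond d L * bool | s (msite p.1, p.2)]|.
have [m] := ubnP (mc s); elim: m s => // m IH s; rewrite ltnS => le.
case: (boolP (mfree s)) => [/h0//|/forallPn[b /forallPn[sg]]]; rewrite negbK => sm.
have mcv s1 u : s1 (msite b, sg) = false -> (forall p, s1 p -> p = (vsite u, sg) \/ s p) -> (mc s1 < m)%N.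
  move=> s1m sub; apply: leq_trans le; apply: proper_card; apply/properP; split.
    by apply/subsetP => p; rewrite !inE => /sub[//|].
  by exists (b, sg); rewrite inE /= ?s1m.
have zero u : (ann R (vsite u, sg) *m v) (idx (empty_at s (msite b, sg))) 0 = 0.
  rewrite annE; case: ifP => // _; rewrite IH ?mulr0 //; apply: (mcv _ u).
    by rewrite fillE emptyE eqxx /=.
  by move=> p; rewrite fillE emptyE => /orP[/eqP|/andP[_]]; [left|right].
have := congr1 (fun w : 'cV_n => w (idx (empty_at s (msite b, sg))) 0) (hb b sg).
rewrite bondE mxE [X in X + _]mxE !zero add0r add0r mxE annE emptyE eqxx /= fill_empty // [RHS]mxE.
have nl : ((lam%:C)%C : C) != 0 by apply: contra l0; rewrite eq_complex /= => /andP[].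
move/eqP; rewrite mulf_eq0 (negPf nl) /= mulf_eq0 signr_eq0 /=.
by move/eqP.
Qed.

Lemma amp_double x y v s : x != y -> ann R x *m (ann R y *m v) = 0 -> s x -> s y -> v (idx s) 0 = 0.
Proof.
move=> xy h sx sy.
have := congr1 (fun w : 'cV_n => w (idx (empty_at (empty_at s y) x)) 0) h.
rewrite pair_amp emptyE eqxx /= fill_empty; last by rewrite emptyE xy.
rewrite emptyE eqxx /= fill_empty // [RHS]mxE => /eqP.
by rewrite !mulf_eq0 !signr_eq0 /= => /eqP.
Qed.

Lemma single_double v s (u : V) : single v -> s (vsite u, true) -> s (vsite u, false) -> v (idx s) 0 = 0.
Proof. by move=> h; apply: (amp_double _ (h u)); rewrite xpair_eqE andbF. Qed.

Definition occ s : {set V} := [set u | s (vsite u, true) || s (vsite u, false)].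
Definition ups s : {set V} := [set u | s (vsite u, true)].
Definition valid s := mfree s && [forall u : V, ~~ (s (vsite u, true) && s (vsite u, false))].
Definition conf (A U : {set V}) : fock d L :=
  [ffun y => if y.1 is inl u then (u \in A) && (y.2 == (u \in U)) else false].

Lemma conf_v A U u sg : conf A U (vsite u, sg) = (u \in A) && (sg == (u \in U)).
Proof. by rewrite ffunE. Qed.

Lemma conf_m A U b sg : conf A U (msite b, sg) = false.
Proof. by rewrite ffunE. Qed.

Lemma conf_valid A U : valid (conf A U).
Proof.
apply/andP; split; first by apply/forallP => b; apply/forallP => sg; rewrite conf_m.
by apply/forallP => u; rewrite !conf_v; case: (u \in A); case: (u \in U).
Qed.

Lemma conf_occ A U : occ (conf A U) = A.
Proof.
by apply/setP => u; rewrite inE !conf_v; case: (u \in A) => //=; case: (u \in U).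
Qed.

Lemma conf_ups (A U : {set V}) : U \subset A -> ups (conf A U) = U.
Proof.
move=> UA; apply/setP => u; rewrite inE conf_v eq_sym eqb_id.
by case: (boolP (u \in U)) => uU; rewrite ?andbF // (subsetP UA).
Qed.

Lemma ups_sub s : ups s \subset occ s.
Proof. by apply/subsetP => u; rewrite !inE => ->. Qed.

Lemma valid_conf s : valid s -> s = conf (occ s) (ups s).
Proof.
move=> /andP[/forallP hm /forallP hd]; apply/ffunP => -[[u|b] sg].
  rewrite -[inl u]/(vsite u) conf_v !inE; have := hd u.
  by case: sg; case e1: (s (vsite u, true)); case e2: (s (vsite u, false)); rewrite ?e1 ?e2.
by rewrite -[inr b]/(msite b) conf_m; apply/negbTE; have /forallP := hm b; apply.
Qed.

Lemma nspin_true (A U : {set V}) : U \subset A -> nspin true (conf A U) = #|U|.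
Proof.
move=> UA; rewrite /nspin big_sumType /= [X in (_ + X)%N]big1 ?addn0 => [|b _]; last first.
  by rewrite -[inr b]/(msite b) conf_m.
rewrite -sum1_card [RHS]big_mkcond; apply: eq_bigr => u _.
rewrite -[inl u]/(vsite u) conf_v; case: (boolP (u \in U)) => uU; rewrite ?andbF //.
by rewrite (subsetP UA).
Qed.

Lemma nspin_false (A U : {set V}) : U \subset A -> nspin false (conf A U) = (#|A| - #|U|)%N.
Proof.
move=> UA; rewrite /nspin big_sumType /= [X in (_ + X)%N]big1 ?addn0 => [|b _]; last first.
  by rewrite -[inr b]/(msite b) conf_m.
have -> : (#|A| - #|U|)%N = #|A :\: U| by rewrite cardsD (setIidPr UA).
rewrite -sum1_card [RHS]big_mkcond; apply: eq_bigr => u _.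
by rewrite -[inl u]/(vsite u) conf_v inE andbC; case: (u \in U); case: (u \in A).
Qed.

Lemma conf_swap (A U : {set V}) a b : a \in A -> b \in A -> a != b -> a \in U -> b \notin U ->
  conf A U = hop_up (conf (A :\: [set a; b]) (U :\ a)) a b.
Proof.
move=> aA bA ab aU bU; apply/ffunP => -[[u|c] sg]; last first.
  by rewrite -[inr c]/(msite c) /hop_up !fillE !conf_m.
rewrite -[inl u]/(vsite u) /hop_up !fillE !conf_v !xpair_eqE !inE.
have ve (p q : V) : (vsite p == vsite q) = (p == q) by [].
rewrite !ve; case: (eqVneq u a) => [->|ua] /=.
  by rewrite aA aU (negPf ab); case: sg.
case: (eqVneq u b) => [->|ub] /=; last by [].
by rewrite bA (negPf bU); case: sg.
Qed.

Lemma gs_swap lam v (A U : {set V}) a b : gs lam v -> nearest a b ->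
  a \in U -> U \subset A -> b \in A -> b \notin U ->
  v (idx (conf A U)) 0 = v (idx (conf A (b |: U :\ a))) 0.
Proof.
move=> hv ab aU UA bA bU; have aA := subsetP UA _ aU.
have nab : a != b by apply: contraNneq bU => <-.
rewrite (conf_swap aA bA nab aU bU).
rewrite (@conf_swap A (b |: U :\ a) b a) ?inE ?eqxx ?(negPf nab) //; last by rewrite eq_sym.
have -> : (b |: U :\ a) :\ b = U :\ a.
  by apply/setP => z; rewrite !inE; case: (eqVneq z b) => [->|//]; rewrite (negPf bU) andbF.
rewrite [[set b; a]]setUC -[[set a] :|: _]/[set a; b].
set s := conf _ _.
have sE c sg : c \in [set a; b] -> s (vsite c, sg) = false.
  by move=> cab; rewrite /s conf_v inE cab.
have ha sg : s (vsite a, sg) = false by apply: sE; rewrite !inE eqxx.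
have hb sg : s (vsite b, sg) = false by apply: sE; rewrite !inE eqxx orbT.
have hs : single v by move=> u; case: hv.
case/existsP: ab => j /orP[/eqP e|/eqP e].
  have := bond_up2_swap (b := (a, j)) (s := s) hs; rewrite (gs_bond_up2 _ hv) mxE /bond_fst /bond_snd -e.
  by case=> // h _; apply: h.
have := bond_up2_swap (b := (b, j)) (s := s) hs; rewrite (gs_bond_up2 _ hv) mxE /bond_fst /bond_snd -e.
by case=> // h _; apply/esym/h.
Qed.

Definition kap (A U : {set V}) : {ffun {set V} -> 'I_N.+1} :=
  [ffun D => if D \in clusters nearest A then inord #|U :&: D| else ord0].

Lemma kapE A U (D : {set V}) : D \in clusters nearest A -> kap A U D = #|U :&: D| :> nat.
Proof. by move=> hD; rewrite ffunE hD inordK // ltnS max_card. Qed.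

Lemma kap_eq A U U' : (forall D, D \in clusters nearest A -> #|U :&: D| = #|U' :&: D|) -> kap A U = kap A U'.
Proof. by move=> h; apply/ffunP => D; rewrite !ffunE; case: ifP => // hD; rewrite h. Qed.

Lemma gs_kap lam v (A U U' : {set V}) : gs lam v -> U \subset A -> U' \subset A ->
  kap A U = kap A U' -> v (idx (conf A U)) 0 = v (idx (conf A U')) 0.
Proof.
move=> hv UA UA' hk.
apply: (swap_invariant (e := nearest) (g := fun U => v (idx (conf A U)) 0)) UA UA' _ => [|W a b|D hD].
- exact: nn_sym.
- by move=> WA ab aW bA bW; apply: gs_swap hv ab aW WA bA bW.
by rewrite -(kapE U hD) hk kapE.
Qed.

Lemma nspin_fill sg s (x : lsite d L) b : s (x, b) = false ->
  nspin sg (fill s (x, b)) = (nspin sg s + (sg == b))%N.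
Proof.
move=> sx; rewrite /nspin (bigD1 x) //= [in RHS](bigD1 x) //= fillE xpair_eqE eqxx /=.
rewrite [X in (_ + X)%N](eq_bigr (fun y : lsite d L => s (y, sg) : nat)); last first.
  by move=> y /negPf yx; rewrite fillE xpair_eqE yx.
by case: (eqVneq sg b) => [->|_]; rewrite ?addn0 // sx add0n addnC.
Qed.

Lemma nspin_move sg s (x y : lsite d L) b : s (x, b) -> empty_at s (x, b) (y, b) = false ->
  nspin sg (fill (empty_at s (x, b)) (y, b)) = nspin sg s.
Proof.
move=> sx sy; rewrite nspin_fill //.
by rewrite -[in RHS](fill_empty sx) nspin_fill // emptyE eqxx.
Qed.

(* v - lam^-1 *: dress b sg v satisfies the bond equation (b, sg) when v has no
   electron on the midpoint of b. *)
Definition dress (b : bond d L) sg v : 'cV[C]_n := cre R (msite b, sg) *m bond_up b sg v.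

Lemma dress_ann b sg y v : y != (msite b, sg) ->
  ann R y *m dress b sg v = dress b sg (ann R y *m v).
Proof.
move=> ym; rewrite /dress ann_creV (negPf ym) scale0r sub0r bond_up_ann mulmxN.
by rewrite -mulmxN.
Qed.

Lemma dress_bond_up b sg b' sg' v : bond_up b' sg' (dress b sg v) = dress b sg (bond_up b' sg' v).
Proof.
rewrite {1}/bond_up !dress_ann ?xpair_eqE //.
rewrite /dress -mulmxDr; apply: (congr1 (mulmx (cre R (msite b, sg)))).
by rewrite /bond_up !mulmxDr; exact: addrACA.
Qed.

Lemma dress_lin b sg (a : C) v w :
  dress b sg (v + a *: w) = dress b sg v + a *: dress b sg w.
Proof. by rewrite /dress bond_up_lin mulmxDr -scalemxAr. Qed.

Lemma dress0 b sg : dress b sg 0 = 0.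
Proof. by rewrite /dress /bond_up !mulmx0 addr0 mulmx0. Qed.

Lemma bond_upZ (b : bond d L) sg (a : C) v : bond_up b sg (a *: v) = a *: bond_up b sg v.
Proof. by rewrite /bond_up -!scalemxAr scalerDr. Qed.

Lemma bond_upE lam (b : bond d L) sg v : bond_op lam b sg *m v =
  bond_up b sg v + (lam%:C)%C *: (ann R (msite b, sg) *m v).
Proof. by rewrite bondE. Qed.

Lemma dress_bond lam b sg b' sg' v : (b', sg') != (b, sg) ->
  bond_op lam b' sg' *m dress b sg v = dress b sg (bond_op lam b' sg' *m v).
Proof.
by move=> neq; rewrite !bond_upE dress_lin dress_bond_up dress_ann.
Qed.

Lemma bond_up_anti (b : bond d L) sg sg' v :
  bond_up b sg (bond_up b sg' v) = - bond_up b sg' (bond_up b sg v).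
Proof.
rewrite [bond_up b sg' v]/bond_up -[X in _ + X]scale1r bond_up_lin !bond_up_ann !scale1r.
by rewrite -opprD.
Qed.

Lemma bond_up_sqr (b : bond d L) sg v : bond_up b sg (bond_up b sg v) = 0.
Proof.
rewrite /bond_up !mulmxDr !ann_sqrV add0r addr0 [X in X + _]ann_annV addrC.
by rewrite subrr.
Qed.

Lemma dress_self lam b sg v : (lam%:C)%C != 0 :> C -> ann R (msite b, sg) *m v = 0 ->
  bond_op lam b sg *m (v - (lam%:C)%C^-1 *: dress b sg v) = 0.
Proof.
move=> l0 h; rewrite bond_upE -scaleNr bond_up_lin dress_bond_up {1}/dress bond_up_sqr mulmx0 scaler0 addr0.
rewrite mulmxDr h add0r -scalemxAr /dress ann_creV eqxx scale1r.
have -> : ann R (msite b, sg) *m bond_up b sg v = 0.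
  by rewrite -[LHS]opprK -bond_up_ann h /bond_up !mulmx0 addr0 oppr0.
by rewrite mulmx0 subr0 scalerA mulrN mulfV // scaleN1r subrr.
Qed.

(** The factors [1 - lam^-1 dress b sg] are applied one pair [(b, sg)] at a time. Each solves its
    own bond equation and passes through the other bond operators, so earlier equations persist;
    since [dress] creates a midpoint electron, midpoint-free amplitudes do not change. *)
Lemma extend lam v0 p q : (lam%:C)%C != 0 :> C -> single v0 ->
    (forall b, bond_up b true (bond_up b false v0) = 0) ->
    (forall b sg, ann R (msite b, sg) *m v0 = 0) ->
    (forall s, v0 (idx s) 0 != 0 -> nspin true s = p /\ nspin false s = q) ->
  exists v, [/\ gs lam v, forall s, mfree s -> v (idx s) 0 = v0 (idx s) 0 &
    forall s, v (idx s) 0 != 0 -> nspin true s = p /\ nspin false s = q].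
Proof.
move=> l0 h1 h2 h3 h4.
have H (l : seq (bond d L * bool)) : exists v,
   [/\ single v, forall b, bond_up b true (bond_up b false v) = 0,
       (forall b sg, (b, sg) \in l -> bond_op lam b sg *m v = 0) /\
       (forall b sg, (b, sg) \notin l -> ann R (msite b, sg) *m v = 0),
       forall s, mfree s -> v (idx s) 0 = v0 (idx s) 0 &
       forall s, v (idx s) 0 != 0 -> nspin true s = p /\ nspin false s = q].
  elim: l => [|[b sg] l [v [v1 v2 [v3 v3'] v4 v5]]]; first by exists v0; split.
  case: (boolP ((b, sg) \in l)) => il.
    exists v; split=> //; split=> b' sg' hin.
      by apply: v3; move: hin; rewrite inE => /orP[/eqP->|].
    by apply: v3'; move: hin; rewrite inE negb_or => /andP[].
  pose a : C := - (lam%:C)%C^-1.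
  exists (v + a *: dress b sg v); split.
  - move=> u; rewrite !(mulmxDr, =^~ scalemxAr) v1 add0r !dress_ann ?xpair_eqE //.
    by rewrite v1 dress0 scaler0.
  - by move=> b'; rewrite !bond_up_lin !dress_bond_up v2 dress0 scaler0 addr0.
  - split=> b' sg'; rewrite inE.
      case: (eqVneq (b', sg') (b, sg)) => [[-> ->] _|neq /= hin].
        by rewrite scaleNr; apply: dress_self => //; apply: v3'.
      by rewrite mulmxDr -scalemxAr dress_bond // v3 // dress0 scaler0 addr0.
    rewrite negb_or => /andP[neq hin].
    by rewrite mulmxDr -scalemxAr dress_ann ?v3' // dress0 scaler0 addr0.
  - move=> s sf; rewrite mxE [X in _ + X]mxE creE.
    have /forallP/(_ b)/forallP/(_ sg)/negPf -> := sf.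
    by rewrite mulr0 addr0 v4.
  - move=> s; rewrite mxE [X in _ + X]mxE creE.
    case: (eqVneq (v (idx s) 0) 0) => [->|/v5 //]; rewrite add0r mulf_eq0 negb_or => /andP[_].
    case: ifP => sm; last by rewrite eqxx.
    rewrite mulf_eq0 signr_eq0 /= mxE !annE.
    have mv u : empty_at s (msite b, sg) (vsite u, sg) = false ->
       v (idx (fill (empty_at s (msite b, sg)) (vsite u, sg))) 0 != 0 ->
       nspin true s = p /\ nspin false s = q.
      by move=> e /v5; rewrite !nspin_move.
    case: ifP => e1; case: ifP => e2; rewrite ?addr0 ?add0r ?eqxx // ?mulf_eq0 ?signr_eq0 /=.
    + exact: mv.
    + exact: mv.
    case: (boolP (v (idx (fill (empty_at s (msite b, sg)) (vsite (bond_fst b), sg))) 0 == 0)) => [/eqP ->|/(mv _ e1)//].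
    by rewrite mulr0 add0r mulf_eq0 signr_eq0 /=; apply: mv.
have [v [v1 v2 [v3 _] v4 v5]] := H (enum {: bond d L * bool}).
have hb b sg : bond_op lam b sg *m v = 0 by apply: v3; rewrite mem_enum.
exists v; split=> //; split=> // -[u|b]; first exact: v1.
(* Read backwards, the bond equations turn the condition at the midpoint into the vanishing of
   [bond_up b true (bond_up b false v)]. *)
have am sg : ann R (msite b, sg) *m v = - ((lam%:C)%C^-1 *: bond_up b sg v).
  apply: (scalerI l0); rewrite scalerN scalerA mulfV // scale1r.
  by apply/eqP; rewrite -addr_eq0 addrC -bond_upE hb.
have e : ann R (msite b, true) *m bond_up b false v = (lam%:C)%C^-1 *: bond_up b false (bond_up b true v).
  by rewrite -[LHS]opprK -bond_up_ann am -scaleNr bond_upZ scaleNr opprK.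
rewrite -[inr b]/(msite b) am mulmxN -scalemxAr e bond_up_anti v2.
by rewrite oppr0 !scaler0 oppr0.
Qed.

Definition label := ({set V} * {ffun {set V} -> 'I_N.+1})%type.
(* o.2 D is the number of up spins on the cluster D of o.1; it is set to 0 when D
   is not such a cluster, to make the labelling unique. *)
Definition admissible (o : label) :=
  [forall D : {set V}, if D \in clusters nearest o.1 then (o.2 D <= #|D|)%N else o.2 D == ord0].
(** A representative set of up spins, formed by the first [o.2 D] sites of each cluster [D]; its
    configuration reads off coefficients in [trace_gs]. *)
Definition canon (o : label) : {set V} :=
  [set x in o.1 | (index x (enum (cluster nearest o.1 x)) < o.2 (cluster nearest o.1 x))%N].
Definition nup (o : label) : nat := (\sum_(D in clusters nearest o.1) o.2 D)%N.

Lemma canon_sub o : canon o \subset o.1.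
Proof. by apply/subsetP => x; rewrite inE => /andP[]. Qed.

Lemma kap_canon o : admissible o -> kap o.1 (canon o) = o.2.
Proof.
move=> /forallP ok; apply/ffunP => D; have := ok D; rewrite ffunE; case: ifP => hD; last by move/eqP.
move=> le; apply: val_inj; rewrite /= inordK ?ltnS ?max_card //.
have -> : canon o :&: D = [set x in take (o.2 D) (enum D)].
  apply/setP => x; rewrite !inE; case: (boolP (x \in D)) => xD; last first.
    by rewrite andbF; apply/esym/negbTE; apply: contra xD => /mem_take; rewrite mem_enum.
  rewrite (subsetP (comps_sub hD) _ xD) -(comps_cl (@nn_sym d L) hD xD) andbT /=.
  by rewrite in_take ?mem_enum.
rewrite cardsE (card_uniqP _) ?take_uniq ?enum_uniq // size_take -cardE.
by move: le; rewrite leq_eqVlt => /orP[/eqP->|->//]; rewrite ltnn.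
Qed.

Lemma card_kap (A U : {set V}) : U \subset A -> #|U| = nup (A, kap A U).
Proof.
move=> UA; rewrite (card_comps (@nn_sym d L) UA); apply: eq_bigr => D hD.
by rewrite kapE.
Qed.

Lemma kap_admissible (A U : {set V}) : admissible (A, kap A U).
Proof.
apply/forallP => D /=; case: ifP => hD; first by rewrite kapE // subset_leq_card // subsetIr.
by rewrite ffunE hD.
Qed.

Definition matches (o : label) s := [&& valid s, occ s == o.1 & kap (occ s) (ups s) == o.2].
(** On each cluster this is the fully symmetric spin state, of maximal spin, with a prescribed
    number of up spins. *)
Definition phi0 (o : label) : 'cV[C]_n := \col_i (matches o (cfg i))%:R.

Lemma phi0E o s : phi0 o (idx s) 0 = (matches o s)%:R.
Proof. by rewrite mxE idxK. Qed.

Lemma phi0_single o : single (phi0 o).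
Proof.
move=> u; apply: matP => s k; rewrite ord1 pair_amp [RHS]mxE; case: ifP => // _.
case: ifP => _; first by rewrite mulr0.
rewrite phi0E; case: (boolP (matches _ _)) => [/and3P[/andP[_ /forallP/(_ u)]]|_]; last by rewrite !mulr0.
by rewrite !fillE !eqxx orbT.
Qed.

(** Both configurations occupy the neighbours [p] and [q], which then lie in one cluster, so the
    numbers of up spins on the clusters agree. *)
Lemma matches_hop o s p q : nearest p q -> (forall sg, s (vsite p, sg) = false) ->
  (forall sg, s (vsite q, sg) = false) -> matches o (hop_up s p q) = matches o (hop_up s q p).
Proof.
move=> pq hp hq; case: (eqVneq p q) => [->//|npq].
have ve (x y : V) : (vsite x == vsite y) = (x == y) by [].
have hE (x y z : V) sg : hop_up s x y (vsite z, sg) = [|| (z == x) && sg, (z == y) && ~~ sg | s (vsite z, sg)].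
  by rewrite /hop_up !fillE !xpair_eqE !ve eqb_id; case: sg; rewrite /= ?andbT ?andbF // orbC.
have hocc (x y : V) : occ (hop_up s x y) = x |: (y |: occ s).
  by apply/setP => z; rewrite !inE !hE !andbT !andbF /=; case: (z == x); case: (z == y); rewrite ?orbT.
have hups (x y : V) : ups (hop_up s x y) = x |: ups s.
  by apply/setP => z; rewrite !inE hE andbT andbF.
have hmf (x y : V) : mfree (hop_up s x y) = mfree s.
  by apply: eq_forallb => b; apply: eq_forallb => sg; rewrite /hop_up !fillE !xpair_eqE.
have hval (x y : V) : x != y -> (forall sg, s (vsite x, sg) = false) -> (forall sg, s (vsite y, sg) = false) ->
    valid (hop_up s x y) = valid s.
  move=> xy hx hy; rewrite /valid hmf; congr (_ && _); apply: eq_forallb => z.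
  rewrite !hE !andbT !andbF /=; case: (eqVneq z x) => [->|_]; first by rewrite (negPf xy) !hx.
  by case: (eqVneq z y) => [->|_] //=; rewrite !hy.
rewrite /matches !hval ?hocc ?hups //; last by rewrite eq_sym.
rewrite [q |: (p |: _)]setUCA; congr (_ && _); apply: andb_id2l => /eqP eA; congr (_ == _).
apply: kap_eq => D hD.
have pD : (p \in D) = (q \in D).
  have inA (x : V) : x \in p |: (q |: occ s) -> (x \in D) = (D == cluster nearest (p |: (q |: occ s)) x).
    move=> xA; apply/idP/eqP => [xD|->]; last by rewrite mem_cl.
    exact: (comps_cl (@nn_sym d L) hD xD).
  rewrite !inA ?inE ?eqxx ?orbT //; congr (_ == _); apply/esym/cl_eq; first exact: nn_sym.
  by apply: cl_step (mem_cl _ _) _ pq; rewrite !inE eqxx ?orbT.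
have pU : p \notin ups s :&: D by rewrite !inE hp.
have qU : q \notin ups s :&: D by rewrite !inE hq.
rewrite !setIUl; case: (boolP (p \in D)) pD => pD /esym qD.
  have -> : [set p] :&: D = [set p] by apply/setIidPl; rewrite sub1set.
  have -> : [set q] :&: D = [set q] by apply/setIidPl; rewrite sub1set qD.
  by rewrite !cardsU1 pU qU.
have e (x : V) : (x \in D) = false -> [set x] :&: D = set0.
  by move=> h; apply/setP => z; rewrite !inE; case: eqP => // ->.
by rewrite !e // (negPf pD).
Qed.

(** If an end of [b] is occupied in [s], each term vanishes, by exclusion or because it would need a
    doubly occupied site. Otherwise the two terms cancel by [matches_hop]. *)
Lemma phi0_bond_up2 o b : bond_up b true (bond_up b false (phi0 o)) = 0.
Proof.
have hs := phi0_single o; apply: matP => s k; rewrite ord1 [RHS]mxE.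
have pq : nearest (bond_fst b) (bond_snd b) by apply: nn_shift.
case: (boolP [|| s (vsite (bond_fst b), true), s (vsite (bond_fst b), false),
   s (vsite (bond_snd b), true) | s (vsite (bond_snd b), false)]) => [h|]; last first.
  rewrite !negb_or => /and4P[/negPf e1 /negPf e2 /negPf e3 /negPf e4].
  apply/(bond_up2_swap hs); [by case | by case | rewrite !phi0E].
  by rewrite (matches_hop o pq) //; case.
have t0 (x y : V) : [|| s (vsite x, true), s (vsite x, false), s (vsite y, true) | s (vsite y, false)] ->
    (ann R (vsite x, true) *m (ann R (vsite y, false) *m phi0 o)) (idx s) 0 = 0.
  move=> h'; rewrite pair_amp; case: ifP => // e1; case: ifP => [|e2]; first by rewrite mulr0.
  move: e2; rewrite fillE xpair_eqE andbF /= => e2.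
  rewrite (single_double (u := if s (vsite x, false) then x else y) hs) ?mulr0 //;
    rewrite !fillE !xpair_eqE; move: h'; rewrite e1 e2 /= orbF.
    by case: (s (vsite x, false)) => //=; rewrite ?eqxx ?orbT // => ->; rewrite !orbT.
  by case e3: (s (vsite x, false)) => /=; rewrite ?eqxx ?e3 ?orbT.
rewrite bond_up2E // mxE !t0 ?addr0 //.
by move: h; do 4!case: (s _).
Qed.

Lemma phi0_ann_m o b sg : ann R (msite b, sg) *m phi0 o = 0.
Proof.
apply: matP => s k; rewrite ord1 annE [RHS]mxE; case: ifP => // _.
rewrite phi0E; case: (boolP (matches _ _)) => [/and3P[/andP[/forallP/(_ b)/forallP/(_ sg)]]|_]; last by rewrite mulr0.
by rewrite fillE eqxx.
Qed.

Lemma phi0_sector o s : phi0 o (idx s) 0 != 0 ->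
  nspin true s = nup o /\ nspin false s = (#|o.1| - nup o)%N.
Proof.
rewrite phi0E pnatr_eq0 eqb0 negbK => /and3P[vs /eqP eA /eqP eU].
rewrite (valid_conf vs) nspin_true ?nspin_false ?ups_sub //.
by rewrite (card_kap (ups_sub s)) eU eA -surjective_pairing.
Qed.

Lemma matches_canon o o' : admissible o -> admissible o' ->
  matches o (conf o'.1 (canon o')) = (o == o').
Proof.
move=> ok ok'; rewrite /matches conf_valid conf_occ conf_ups ?canon_sub // kap_canon //.
by rewrite -pair_eqE /= eq_sym [o'.2 == _]eq_sym.
Qed.

(** The basis vectors [Phi o] extend [phi0 o]. They span because a kernel vector is determined by
    its midpoint-free amplitudes, which are zero off the singly occupied configurations and depend
    only on the label. *)
Lemma trace_gs (t lam U U' : R) (P0 D : op) (g : nat -> nat -> C) :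
    0 < t -> 0 < lam -> 0 < U -> 0 < U' ->
    is_eigenproj (Ham d L t lam U U') 0 P0 ->
    (forall s (v : 'cV[C]_n), (D *m v) (idx s) 0 = g (nspin true s) (nspin false s) * v (idx s) 0) ->
  \tr (D *m P0) = \sum_(o | admissible o) g (nup o) (#|o.1| - nup o)%N.
Proof.
move=> t0 l0 U0 U0' hP hD.
have ln : (lam%:C)%C != 0 :> C by rewrite gt_eqF // ltcR.
have /fin_all_exists[Phi hPhi] (o : label) : exists v, [/\ gs lam v,
    forall s, mfree s -> v (idx s) 0 = phi0 o (idx s) 0 &
    forall s, v (idx s) 0 != 0 -> nspin true s = nup o /\ nspin false s = (#|o.1| - nup o)%N].
  exact: extend ln (phi0_single o) (phi0_bond_up2 o) (phi0_ann_m o) (@phi0_sector o).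
have PhiE o s : mfree s -> Phi o (idx s) 0 = (matches o s)%:R.
  by case: (hPhi o) => _ h _ /h ->; rewrite phi0E.
have valid_mf s : valid s -> mfree s by case/andP.
apply: (trace_basis (Phi := Phi) (c := fun o => idx (conf o.1 (canon o)))) => [o _|k|o ok|o _].
- by apply/(P0_gs t0 U0 U0' hP); case: (hPhi o).
- pose a o := P0 (idx (conf o.1 (canon o))) k.
  have gk : gs lam (col k P0).
    rewrite colE; exact: (gs_P0 t0 U0 U0' hP).
  apply/eqP; rewrite -subr_eq0; apply/eqP; apply: (@gs_zero lam); first by rewrite gt_eqF.
    split=> [b sg|x].
      rewrite mulmxBr mulmx_sumr; case: gk => -> _; rewrite big1 ?subr0 // => o _.
      by rewrite -scalemxAr; case: (hPhi o) => [[-> _] _ _]; rewrite scaler0.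
    rewrite 2!mulmxBr 2!mulmx_sumr; case: gk => _ ->; rewrite big1 ?subr0 // => o _.
    by rewrite -!scalemxAr; case: (hPhi o) => [[_ ->] _ _]; rewrite scaler0.
  move=> s sf; rewrite mxE [X in _ + X]mxE summxE.
  under eq_bigr => o _ do rewrite mxE PhiE //.
  case: (boolP (valid s)) => vs; last first.
    rewrite big1 => [|o _]; last by rewrite /matches (negPf vs) mulr0.
    rewrite subr0; move: vs; rewrite /valid sf /= => /forallPn[u]; rewrite negbK => /andP[h1 h2].
    by apply: single_double h1 h2 => u'; case: gk.
  pose o := (occ s, kap (occ s) (ups s)) : label.
  have oko : admissible o by apply: kap_admissible.
  have mE o' : matches o' s = (o' == o).
    by rewrite /matches vs -pair_eqE /= eq_sym [_ == o'.2]eq_sym.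
  rewrite (bigD1 o) //= big1 => [|o' /andP[_ no]]; last by rewrite mE (negPf no) mulr0.
  rewrite mE eqxx mulr1 addr0 {1}(valid_conf vs).
  have e := gs_kap gk (ups_sub s) (canon_sub o) (esym (kap_canon oko)).
  by apply/eqP; rewrite subr_eq0; apply/eqP; rewrite e mxE.
- by rewrite PhiE ?matches_canon ?eqxx //; apply/valid_mf/conf_valid.
- apply: matP => s k; rewrite ord1 hD mxE.
  case: (eqVneq (Phi o (idx s) 0) 0) => [->|]; first by rewrite !mulr0.
  by case: (hPhi o) => _ _ h /h [-> ->].
Qed.
End Basis.

(** * Expectation values *)

Lemma sum_magn (K : numFieldType) n : \sum_(j < n.+1) (j%:R - n%:R / 2 : K) = 0.
Proof.
have h m : \sum_(j < m) (j%:R : K) = m%:R * (m%:R - 1) / 2.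
  elim: m => [|m IH]; first by rewrite big_ord0 !mul0r.
  by rewrite big_ord_recr /= IH -natr1; field.
by rewrite sumrB sumr_const card_ord h -mulr_natl -natr1; field.
Qed.

(** With [S = n / 2], the mean of the squared magnetization over a multiplet is [S (S + 1) / 3]. *)
Lemma sum_magn_sqr (K : numFieldType) n :
  \sum_(j < n.+1) (j%:R - n%:R / 2 : K) ^+ 2 = n.+1%:R * ((n * n.+2)%:R / 12).
Proof.
have h1 m : \sum_(j < m) (j%:R : K) = m%:R * (m%:R - 1) / 2.
  elim: m => [|m IH]; first by rewrite big_ord0 !mul0r.
  by rewrite big_ord_recr /= IH -natr1; field.
have h2 m : \sum_(j < m) (j%:R ^+ 2 : K) = m%:R * (m%:R - 1) * (2 * m%:R - 1) / 6.
  elim: m => [|m IH]; first by rewrite big_ord0 !mul0r.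
  by rewrite big_ord_recr /= IH -natr1; field.
under eq_bigr => j _ do rewrite sqrrB.
rewrite big_split sumrB /= sumr_const card_ord h2.
have -> : \sum_(j < n.+1) j%:R * (n%:R / 2) *+ 2 = (\sum_(j < n.+1) (j%:R : K)) * n%:R.
  by rewrite mulr_suml; apply: eq_bigr => j _; rewrite -mulr_natr; field.
by rewrite h1 -mulr_natl natrM -!natr1; field.
Qed.

(** * Statistics of the cluster magnetizations *)

Section LabelSums.
Variables (K : numFieldType) (d L : nat).
Notation V := (site d L).
Notation nearest := (@nearest d L).
Notation N := #|{: V}|.
Implicit Types A D : {set V}.

Lemma admissible_pfamily A (m : {ffun {set V} -> 'I_N.+1}) :
  admissible (A, m) = (m \in pfamily ord0 (mem (clusters nearest A)) (fun D => [pred j : 'I_N.+1 | (j <= #|D|)%N])).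
Proof.
apply/forallP/pfamilyP => [h|[h1 h2] D /=].
  split=> [|D hD]; last by have := h D; rewrite /= hD inE.
  apply/subsetP => D; rewrite inE => mD; have := h D; rewrite /=; case: ifP => // _ /eqP e.
  by rewrite e eqxx in mD.
case: ifP => hD; first by have := h2 D hD; rewrite inE.
by apply: contraFT hD => mD; apply: (subsetP h1); rewrite inE.
Qed.

Lemma admissible_prod A (F : {set V} -> nat -> K) :
  \sum_(m | admissible (A, m)) \prod_(D in clusters nearest A) F D (m D) =
  \prod_(D in clusters nearest A) \sum_(j < #|D|.+1) F D j.
Proof.
have -> : \prod_(D in clusters nearest A) \sum_(j < #|D|.+1) F D j =
    \prod_(D in clusters nearest A) \sum_(j in [pred j : 'I_N.+1 | (j <= #|D|)%N]) F D j.
  apply: eq_bigr => D _; rewrite (big_ord_widen N.+1 (F D)) ?ltnS ?max_card //.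
rewrite (big_distr_big_dep ord0); apply: eq_bigl => m; exact: admissible_pfamily.
Qed.

Lemma card_admissible A : \sum_(m | admissible (A, m)) (1 : K) = (cluster_wt nearest A)%:R.
Proof.
transitivity (\sum_(m | admissible (A, m)) \prod_(D in clusters nearest A) (1 : K)).
  by apply: eq_bigr => m _; rewrite big1.
rewrite (admissible_prod A (fun _ _ => 1)) /cluster_wt natr_prod; apply: eq_bigr => D _.
by rewrite sumr_const card_ord.
Qed.

(* The magnetizations of different clusters are independent and centred, so the
   cross terms vanish. *)
Lemma magn_variance A :
  \sum_(m | admissible (A, m)) (\sum_(D in clusters nearest A) ((m D)%:R - #|D|%:R / 2 : K)) ^+ 2 =
  (cluster_wt nearest A)%:R * ((spin_sq4 nearest A)%:R / 12).
Proof.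
pose a D (j : nat) : K := j%:R - #|D|%:R / 2.
have cov D E : D \in clusters nearest A -> E \in clusters nearest A ->
   \sum_(m | admissible (A, m)) a D (m D) * a E (m E) =
   if D == E then (cluster_wt nearest A)%:R * ((#|D| * #|D|.+2)%:R / 12) else 0.
  move=> hD hE.
  (* Writes the summand as a product over all clusters, so that the sum factorizes; for [D != E] the
     factor of [D] is a centred sum. *)
  pose F D' (j : nat) : K := (if D' == D then a D j else 1) * (if D' == E then a E j else 1).
  transitivity (\sum_(m | admissible (A, m)) \prod_(D' in clusters nearest A) F D' (m D')).
    apply: eq_bigr => m _; rewrite big_split /=; congr (_ * _).
      by rewrite -big_mkcondr (big_pred1 D) // => D'; rewrite /= andbC; case: eqP => [->|].
    by rewrite -big_mkcondr (big_pred1 E) // => D'; rewrite /= andbC; case: eqP => [->|].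
  rewrite admissible_prod (bigD1 D) //= {1}/F eqxx; case: (eqVneq D E) => [e|ne].
    rewrite -e; have -> : \sum_(j < #|D|.+1) a D j * a D j = #|D|.+1%:R * ((#|D| * #|D|.+2)%:R / 12).
      by rewrite -sum_magn_sqr; apply: eq_bigr => j _; rewrite expr2.
    rewrite /cluster_wt [in RHS](bigD1 D) //=; set q := _ / 12; rewrite natrM mulrAC; congr (_ * _ * _).
    rewrite natr_prod; apply: eq_bigr => D' /andP[_ /negPf nD].
    under eq_bigr => j _ do rewrite /F -e nD mulr1.
    by rewrite sumr_const card_ord.
  under eq_bigr => j _ do rewrite mulr1.
  by rewrite /a sum_magn mul0r.
under eq_bigr => m _ do rewrite expr2 mulr_suml.
rewrite exchange_big /= /spin_sq4 natr_sum mulr_suml mulr_sumr; apply: eq_bigr => D hD.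
under eq_bigr => m _ do rewrite mulr_sumr.
rewrite exchange_big /= (bigD1 D) //= cov // eqxx big1 ?addr0 // => E /andP[hE nE].
by rewrite cov // eq_sym (negPf nE).
Qed.
End LabelSums.

Section Expectations.
Variables (R : realType) (d L : nat).
Hypothesis L_gt1 : (1 < L)%N.
Notation C := R[i].
Notation op := 'M[C]_(fdim d L).
Notation V := (site d L).
Notation nearest := (@nearest d L).
Notation N := #|{: V}|.
Variables (t lam U U' : R) (P0 : op).
Hypotheses (t0 : 0 < t) (lam0 : 0 < lam) (U0 : 0 < U) (U0' : 0 < U').
Hypothesis hP : is_eigenproj (Ham d L t lam U U') 0 P0.

Lemma nup_le (o : label d L) : admissible o -> (nup o <= #|o.1|)%N.
Proof.
move=> /forallP h; rewrite -(sum_card_comps (@nn_sym d L)) /nup; apply: leq_sum => D hD.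
by have := h D; rewrite hD.
Qed.

Lemma trace_occ (D : op) (mu : R) (h : nat -> nat -> R) (H : {set V} -> R) :
    (forall s (v : 'cV[C]_(fdim d L)),
       (D *m v) (idx s) 0 = (h (nspin true s) (nspin false s))%:C%C * v (idx s) 0) ->
    (forall A : {set V}, \sum_(m | admissible (A, m)) h (nup (A, m)) (#|A| - nup (A, m))%N = (cluster_wt nearest A)%:R * H A) ->
  \tr (D *m expNe d L mu *m P0) = (\sum_(A : {set V}) gc_weight mu A * H A)%:C%C.
Proof.
move=> hD hH; pose g p q : R := h p q * expR (mu * (p + q)%:R).
rewrite (trace_gs L_gt1 (g := fun p q => (g p q)%:C%C) t0 lam0 U0 U0' hP); last first.
  move=> s v; rewrite -mulmxA hD expNeE ecountE mulrA; congr (_ * _).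
  by rewrite rmorphM.
rewrite -rmorph_sum; congr (_%:C)%C.
have -> : \sum_(A : {set V}) gc_weight mu A * H A =
    \sum_(A : {set V}) \sum_(m | admissible (A, m)) g (nup (A, m)) (#|A| - nup (A, m))%N.
  apply: eq_bigr => A _; rewrite /gc_weight -mulrA -hH mulr_sumr; apply: eq_bigr => m hm.
  by rewrite /g subnKC ?(nup_le hm) // mulrC.
rewrite pair_big_dep /=; apply: eq_big => [[A m] //|[A m] _ //].
Qed.

Lemma trace_one mu : \tr (expNe d L mu *m P0) = (gc_part d L mu)%:C%C.
Proof.
have := @trace_occ 1%:M mu (fun _ _ => 1) (fun _ => 1).
rewrite mul1mx => ->; [|move=> s v|move=> A].
- by congr (_%:C)%C; apply: eq_bigr => A _; rewrite mulr1.
- by rewrite mul1mx mul1r.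
- by rewrite card_admissible mulr1.
Qed.

Lemma trace_Ne mu : \tr (Ne R d L *m expNe d L mu *m P0) = (\sum_(A : {set V}) gc_weight mu A * #|A|%:R)%:C%C.
Proof.
apply: (@trace_occ _ mu (fun p q => (p + q)%:R)) => [s v|A].
  by rewrite NeE ecountE rmorph_nat.
rewrite -card_admissible mulr_suml; apply: eq_bigr => m hm.
by rewrite mul1r subnKC // (nup_le hm).
Qed.

Lemma trace_spin_sq mu :
  \tr (spin_tot_sq R d L *m expNe d L mu *m P0) = (\sum_(A : {set V}) gc_weight mu A * ((spin_sq4 nearest A)%:R / 4))%:C%C.
Proof.
rewrite (tr_spin_sq mu t0 U0 U0' hP) mulmxA.
rewrite (@trace_occ _ mu (fun p q => ((p%:R - q%:R) / 2) ^+ 2) (fun A => (spin_sq4 nearest A)%:R / 12)).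
- rewrite -[3]/(3%:R) -(rmorph_nat (real_complex R)) -rmorphM mulr_sumr; congr (_%:C)%C.
  by apply: eq_bigr => A _; field.
- move=> s v; rewrite -mulmxA !spin_zE mulrA /magn -expr2; congr (_ * _).
  by rewrite rmorphXn rmorphM rmorphB !rmorph_nat fmorphV rmorph_nat.
move=> A; rewrite -magn_variance; apply: eq_bigr => m hm; congr (_ ^+ 2).
rewrite natrB ?(nup_le hm) // sumrB -mulr_suml -!natr_sum (sum_card_comps (@nn_sym d L)) /nup /=.
by field.
Qed.
End Expectations.

Theorem theorem2p5 (R : realType) (d : nat) (hd : (2 <= d)%N) :
  exists c2 c3 mu1 mu2 : R,
    [/\ 0 < c2, 0 < c3, 0 < mu1 & mu2 < 0] /\
    forall (L : nat), (4 <= L)%N -> ~~ odd L ->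
    forall (t lam U U' : R), 0 < t -> 0 < lam -> 0 < U -> 0 < U' ->
    forall P0 : 'M[R[i]]_(fdim d L),
      is_eigenproj (Ham d L t lam U U') 0 P0 ->
      let Smax : R := (L ^ d)%:R / 2 in
      let S2 := expect P0 ^~ (spin_tot_sq R d L) in
      let Nav := expect P0 ^~ (Ne R d L) in
      (forall mu : R, mu1 <= mu ->
          S2 mu <= ((Smax * (Smax + 1))%:C)%C
       /\ (((Smax * (Smax + 1)) * (1 - c2 * expR (- mu)))%:C)%C <= S2 mu)
   /\ (forall mu : R, mu <= mu2 ->
          (3 / 4)%:C%C * Nav mu <= S2 mu
       /\ S2 mu <= (3 / 4)%:C%C * Nav mu
                   + ((c3 * (#|{: site d L}|)%:R * expR (2 * mu))%:C)%C).
Proof.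
have r0p := animal_fug_gt0 R d; have z0p := fill_fug_gt0 R d.
have Fp : 0 < (fillcost d)%:R :> R by rewrite ltr0n expn_gt0.
(* The constants of [high_density] and [low_density]; the prefactor 16 of the latter becomes 4
   because [spin_sq4] is four times the squared spin. *)
exists ((4 + d.*2)%:R * ((fillcost d)%:R / fill_fug R d)), (4 / animal_fug R d ^+ 2),
  ((fillcost d)%:R / fill_fug R d), (- (4 / animal_fug R d)); split.
  have q0 : 0 < (fillcost d)%:R / fill_fug R d by apply: divr_gt0.
  split=> //; first by apply: mulr_gt0 q0; rewrite ltr0n.
    by apply: divr_gt0; rewrite // exprn_gt0.
  by rewrite oppr_lt0 divr_gt0.
move=> L L4 _ t lam U U' t0 l0 U0 U0' P0 hP.
have L1 : (1 < L)%N by apply: leq_trans L4.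
set Nr : R := (L ^ d)%:R; have NE : #|{: site d L}|%:R = Nr by rewrite card_site.
have NNE : (#|{: site d L}| * #|{: site d L}|.+2)%:R = Nr * (Nr + 2).
  by rewrite natrM -addn2 natrD NE.
have Nr0 : 0 <= Nr by rewrite ler0n.
pose X mu : R := \sum_(A : {set site d L}) gc_weight mu A * (spin_sq4 (@nearest d L) A)%:R.
pose M mu : R := \sum_(A : {set site d L}) gc_weight mu A * #|A|%:R.
have S2E mu : expect P0 mu (spin_tot_sq R d L) = (X mu / 4 / gc_part d L mu)%:C%C.
  rewrite /expect (trace_spin_sq L1 t0 l0 U0 U0' hP) (trace_one L1 t0 l0 U0 U0' hP).
  rewrite -fmorphV -rmorphM; congr ((_ / _)%:C)%C.
  by rewrite mulr_suml; apply: eq_bigr => A _; rewrite mulrA.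
have NavE mu : expect P0 mu (Ne R d L) = (M mu / gc_part d L mu)%:C%C.
  rewrite /expect (trace_Ne L1 t0 l0 U0 U0' hP) (trace_one L1 t0 l0 U0 U0' hP).
  by rewrite -fmorphV -rmorphM.
move=> Smax S2 Nav; rewrite /S2 /Nav; split=> mu hmu; have Zp := gc_part_gt0 d L mu.
  rewrite S2E !lecR !(ler_pdivrMr, ler_pdivlMr) //.
  have up : X mu <= Nr * (Nr + 2) * gc_part d L mu.
    rewrite /gc_part mulr_sumr; apply: ler_sum => A _; rewrite [X in _ <= X]mulrC.
    by rewrite ler_wpM2l ?(ltW (gc_weight_gt0 _ _)) // -NNE ler_nat spin_sq4_le.
  have := high_density L hd hmu; rewrite NNE.
  have -> : \sum_(A : {set site d L}) gc_weight mu A * (Nr * (Nr + 2) - (spin_sq4 (@nearest d L) A)%:R) =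
     Nr * (Nr + 2) * gc_part d L mu - X mu.
    rewrite /gc_part mulr_sumr -sumrB; apply: eq_bigr => A _; ring.
  by rewrite /Smax -/Nr => low; split; lra.
have low : 3 * M mu <= X mu.
  rewrite /M mulr_sumr; apply: ler_sum => A _; rewrite mulrCA ler_wpM2l ?(ltW (gc_weight_gt0 _ _)) //.
  by rewrite -natrM ler_nat spin_sq4_low leq_addr.
have := low_density L hmu.
have -> : \sum_(A : {set site d L}) gc_weight mu A * ((spin_sq4 (@nearest d L) A)%:R - (3 * #|A|)%:R) = X mu - 3 * M mu.
  rewrite /M mulr_sumr -sumrB; apply: eq_bigr => A _; rewrite natrM; ring.
rewrite NE S2E NavE -rmorphM -rmorphD !lecR => up.
have e1 : 3 / 4 * (M mu / gc_part d L mu) = 3 / 4 * M mu / gc_part d L mu by rewrite mulrA.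
rewrite e1; split; first by rewrite ler_pM2r ?invr_gt0 //; lra.
rewrite -lerBlDl -mulrBl ler_pdivrMr //.
have e2 : 4 / animal_fug R d ^+ 2 = 16 / animal_fug R d ^+ 2 / 4 by field; rewrite gt_eqF.
by rewrite e2; lra.
Qed.
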